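(* Let $(X_{i,k})_{i\in\mathbb{N},k\in\mathbb{N}_0}$ and $(J_k)_{k\in\mathbb{N}_0}$ be as in the context, and let $Y=(Y_n)_{n\in\mathbb{N}_0}$ be the Galton–Watson process with immigration $$Y_n=\sum_{k=0}^n\sum_{i=1}^{J_k}X_{i,k}(n-k),\qquad n\in\mathbb{N}_0.$$ Assume that for some $c>0$, $$\lim_{x\to\infty} x\,\mathbb{P}\{\log J>x\}=c.$$ Then, as $n\to\infty$, $$\frac{\log^+\big(Y_{[n\cdot]}\big)}{n}\ \Rightarrow\ \sup_{t_k^{(c,1)}\le \cdot}\Big(j_k^{(c,1)}+(\cdot-t_k^{(c,1)})\log\mu\Big),$$ where $\Rightarrow$ denotes weak convergence on the Skorokhod space $D[0,\infty)$ endowed with the $J_1$-topology.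
   Context: $\mathbb{N}_0=\mathbb{N}\cup\{0\}$. The families $(X_{i,k})_{i\in\mathbb{N},k\in\mathbb{N}_0}$ and $(J_k)_{k\in\mathbb{N}_0}$ are mutually independent, each consisting of i.i.d. random objects; each $X_{i,k}=(X_{i,k}(n))_{n\in\mathbb{N}_0}$ is a Galton–Watson process with $X_{i,k}(0)=1$ and offspring mean $\mathbb{E}X_{i,k}(1)=\mu\in(0,\infty)$; each $J_k$ is a nonnegative integer-valued random variable with $\mathbb{P}\{J_k=0\}<1$, and $J$ denotes a random variable with the law of $J_k$. $\log^+x=\max(\log x,0)$ (with $\log^+0=0$), $[\cdot]$ is the integer part. For $a,b>0$, $N^{(a,b)}=\sum_{k}\varepsilon_{(t_k^{(a,b)},\,j_k^{(a,b)})}$ is a Poisson random measure on $[0,\infty)\times(0,\infty]$ with mean measure $\mathrm{Leb}\times\mu_{a,b}$, where $\mu_{a,b}((x,\infty])=ax^{-b}$ for $x>0$ and $\varepsilon_{(t,x)}$ is the Dirac measure at $(t,x)$. The supremum over the empty set is $0$. *)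

(* Defs.v *)
From HB Require Import structures.
From mathcomp Require Import all_boot all_order all_algebra.
From mathcomp Require Import all_classical all_reals all_analysis.
Set Implicit Arguments. Unset Strict Implicit. Unset Printing Implicit Defensive.
Import Order.TTheory GRing.Theory Num.Theory.
Import numFieldNormedType.Exports.
Local Open Scope classical_set_scope.
Local Open Scope ring_scope.

Section Defs.
Variable R : realType.

Definition logp (x : R) : R := if x <= 0 then 0 else Num.max (ln x) 0.

Definition sup0 (E : set R) : R := if E == set0 then 0 else sup E.

Variables (d : measure_display) (Omega : measurableType d).

Definition sigma_of_process (Z : nat -> Omega -> nat) : set (set Omega) :=
  <<s [set A | exists (n : nat) (B : set nat), A = Z n @^-1` B] >>.

Definition mutually_independent (P : probability Omega R) (I : eqType)
    (obj : I -> nat -> Omega -> nat) : Prop :=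
  forall (s : seq I) (A : I -> set Omega), uniq s ->
    (forall i, i \in s -> sigma_of_process (obj i) (A i)) ->
    P (\bigcap_(i in [set` s]) A i) = (\prod_(i <- s) P (A i))%E.

Definition path_sigma : set (set (nat -> nat)) :=
  <<s [set C | exists (n : nat) (B : set nat), C = [set f | B (f n)]] >>.

Definition same_law (P : probability Omega R) (Z1 Z2 : nat -> Omega -> nat) :=
  forall C, path_sigma C ->
    P [set w | C (fun n => Z1 n w)] = P [set w | C (fun n => Z2 n w)].

Definition conv (p q : nat -> R) : nat -> R :=
  fun n => \sum_(j < n.+1) p j * q (n - j)%N.

Fixpoint convpow (p : nat -> R) (m : nat) : nat -> R :=
  match m with
  | 0 => fun n => (n == 0)%:R
  | m'.+1 => conv p (convpow p m')
  end.

(* Z is a Galton--Watson process started at 1 with offspring distribution p: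
   finite-dimensional distributions of the Markov chain with transition
   x -> p^{*x} *)
Definition is_GW (P : probability Omega R) (Z : nat -> Omega -> nat) : Prop :=
  exists p : nat -> R, forall (n : nat) (x : nat -> nat),
    P [set w | forall m, (m <= n)%N -> Z m w = x m] =
    (((x 0%N == 1%N)%:R * \prod_(m < n) convpow p (x m) (x m.+1)) : R)%:E.

Definition cadlag (x : R -> R) : Prop :=
  (forall t, 0 <= t -> x s @[s --> t^'+] --> x t) /\
  (forall t, 0 < t -> exists l : R, x s @[s --> t^'-] --> l).

Definition time_change (l : R -> R) : Prop :=
  l 0 = 0 /\ (forall s t, 0 <= s -> s < t -> l s < l t) /\
  {within [set t | 0 <= t], continuous l} /\
  (forall y, 0 <= y -> exists t, 0 <= t /\ l t = y).

(* J1 convergence in D[0,oo) (Jacod--Shiryaev, Thm VI.1.14) *)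
Definition J1_conv (xn : nat -> R -> R) (x : R -> R) : Prop :=
  exists ln : nat -> R -> R, (forall n, time_change (ln n)) /\
    (forall e : R, 0 < e -> \forall n \near \oo,
        forall t, 0 <= t -> `|ln n t - t| <= e) /\
    (forall T e : R, 0 < e -> \forall n \near \oo,
        forall t, 0 <= t <= T -> `|xn n (ln n t) - x t| <= e).

(* F is continuous on (D[0,oo), J1); J1 is metrizable, so sequential
   continuity is continuity *)
Definition J1_continuous (F : (R -> R) -> R) : Prop :=
  forall (xn : nat -> R -> R) (x : R -> R),
    (forall n, cadlag (xn n)) -> cadlag x -> J1_conv xn x ->
    F (xn n) @[n --> \oo] --> F x.

End Defs.

Definition weak_conv_J1 (R : realType)
    (d : measure_display) (Omega : measurableType d) (P : probability Omega R)
    (Zn : nat -> Omega -> R -> R)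
    (d' : measure_display) (Omega' : measurableType d') (P' : probability Omega' R)
    (Z : Omega' -> R -> R) : Prop :=
  forall F : (R -> R) -> R, J1_continuous F -> (exists M : R, forall x, `|F x| <= M) ->
    (\int[P]_w (F (Zn n w))%:E)%E @[n --> \oo] --> (\int[P']_w (F (Z w))%:E)%E.

Section PRM.
Variable R : realType.

Definition rect (s1 s2 x1 x2 : R) : set (R * R) :=
  [set z | s1 <= z.1 < s2 /\ x1 < z.2 <= x2].

(* mean measure Leb x mu_{a,b} of a rectangle, mu_{a,b}((x,oo]) = a x^{-b} *)
Definition mean_rect (a b s1 s2 x1 x2 : R) : R :=
  (s2 - s1) * (a * powR x1 (- b) - a * powR x2 (- b)).

Definition count_is (pts : nat -> R * R) (A : set (R * R)) (n : nat) : Prop :=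
  exists s : seq nat, uniq s /\ size s = n /\ (forall k, k \in s <-> A (pts k)).

Definition poisson_pmf (m : R) (n : nat) : R := expR (- m) * m ^+ n / (n`!)%:R.

(* N = sum_k eps_{(t_k, j_k)} is a Poisson random measure on
   [0,oo) x (0,oo] with mean Leb x mu_{a,b}: counts on finitely many disjoint
   rectangles are independent Poisson with the prescribed means *)
Definition is_PRM (d : measure_display) (Omega : measurableType d)
    (P : probability Omega R) (a b : R) (tk jk : nat -> Omega -> R) : Prop :=
  (forall k, measurable_fun setT (tk k)) /\ (forall k, measurable_fun setT (jk k)) /\
  (forall k w, 0 <= tk k w /\ 0 < jk k w) /\
  forall (m : nat) (s1 s2 x1 x2 : nat -> R) (ns : nat -> nat),
    (forall i, (i < m)%N -> 0 <= s1 i < s2 i /\ 0 < x1 i < x2 i) ->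
    (forall i j, (i < m)%N -> (j < m)%N -> i <> j ->
       rect (s1 i) (s2 i) (x1 i) (x2 i) `&` rect (s1 j) (s2 j) (x1 j) (x2 j) = set0) ->
    P [set w | forall i, (i < m)%N ->
         count_is (fun k => (tk k w, jk k w)) (rect (s1 i) (s2 i) (x1 i) (x2 i)) (ns i)] =
    (\prod_(i < m) poisson_pmf (mean_rect a b (s1 i) (s2 i) (x1 i) (x2 i)) (ns i))%:E.

End PRM.

Section Proc.
Variables (R : realType) (Omega : Type).

(* Y_n = sum_{k=0}^n sum_{i=1}^{J_k} X_{i,k}(n-k);
   X i k stands for X_{i+1,k} (the paper indexes i from 1) *)
Definition GWI (X : nat -> nat -> nat -> Omega -> nat) (J : nat -> Omega -> nat)
    (n : nat) (w : Omega) : nat :=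
  (\sum_(k < n.+1) \sum_(i < J k w) X i k (n - k)%N w)%N.

Definition scaled_log (Y : nat -> Omega -> nat) (n : nat) (w : Omega) : R -> R :=
  fun t => logp ((Y (Num.truncn (n%:R * t)) w)%:R : R) / n%:R.

Definition sup_process (mu : R) (tk jk : nat -> Omega -> R) (w : Omega) : R -> R :=
  fun t => sup0 [set v | exists k, tk k w <= t /\ v = jk k w + (t - tk k w) * ln mu].
End Proc.

(* Main.v *)
Require Import Defs.
From HB Require Import structures.
From mathcomp Require Import all_boot all_order all_algebra.
From mathcomp Require Import all_classical all_reals all_analysis.
From mathcomp Require Import measurable_realfun lra ring zify.
Set Implicit Arguments. Unset Strict Implicit. Unset Printing Implicit Defensive.
Import Order.TTheory GRing.Theory Num.Theory.
Import numFieldNormedType.Exports.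
Local Open Scope classical_set_scope.
Local Open Scope ring_scope.

(* The immigrants are coupled to the Poisson points.  Cut time into slots
   [k/n, (k+1)/n).  By the void probabilities of the Poisson random measure the
   largest marks of the slots are independent, and [n] times such a mark has the
   Frechet law [x |-> exp (- c / x)]; its quantile transform to the law of [J]
   gives i.i.d. copies [J_k^(n)] of [J], and the tail assumption makes
   [log J_k^(n) / n] close to the largest mark.  Replacing [J_k] by [J_k^(n)]
   on the product space leaves the law of [Y] unchanged, so it is enough to
   show, for almost every fixed Poisson sample, that the rescaled logarithm
   converges almost surely in J1.

   For fixed immigrants two exponential-scale estimates suffice, both obtained
   from the iterates of the offspring generating function [f] and Borel-Cantelli:
   [Y_m] is at most [e^(en)] times [sum_k J_k mu^(m-k)] because
   [1 - f (1 - u) <= mu u], and a cohort of [J] immigrants with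
   [J min(1, rho^r) >= e^(en)] has at least [J rho^r / 4] descendants after [r]
   generations because [1 - f (1 - u) >= rho u] for [rho < mu] and small [u].
   The J1 time change moves the finitely many times of big marks to the left
   ends of their slots.

   Marks at small times keep the limit above [t log mu] when [mu > 1], and marks
   just before [t] keep it nonnegative when [mu <= 1], so that small marks only
   matter through the bound [max (log mu, 0) t]. *)

(** * Step paths and J1 convergence *)

(** Only the first moment of the offspring law is at hand, so nothing finer than the exponential
    growth rate is used. This suffices: logarithms are divided by [n], and a factor [e^(en)] costs
    only [e]. The obstacle is uniformity. The bounds must hold for all times [m <= T n] and all
    cohorts [k] at once, although small or subcritical cohorts die out. Hence tail estimates whose
    failure probability decays like [e^(-en)], strong enough for a union bound over polynomially
    many pairs [(m, k)], and the cut-offs [max 1] and [min 1]. Freezing the Poisson sample makes the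
    cohort sizes deterministic, so these estimates never have to condition on the immigrants.

    The second obstacle is measurability: a test functional [F] is only known to be J1-continuous.
    The prelimit is handled on a countable-coordinate state space, where truncated states take
    countably many values and continuity passes to the limit. The limit functional is a limit of
    measurable functions only off a null set, so its integral is first restricted to the complement
    of that set. *)

Section StepPath.
Variable R : realType.

Definition step_path (n : nat) (y : nat -> nat) : R -> R :=
  fun t => logp ((y (Num.truncn (n%:R * t)))%:R : R) / n%:R.

Lemma cadlag_step_path n y : cadlag (step_path n y).
Proof.
rewrite /step_path; case: n => [|n].
  split=> [t _|t _]; last exists 0.
    by under eq_fun do rewrite invr0 mulr0; rewrite invr0 mulr0; exact: cvg_cst.
  by under eq_fun do rewrite invr0 mulr0; exact: cvg_cst.
set N := n.+1%:R : R; have N0 : 0 < N by rewrite ltr0n.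
split=> t t0.
  have /andP[h1 h2] := @truncn_itv R (N * t) (mulr_ge0 (ltW N0) t0).
  apply: cvg_near_cst; near=> s.
  congr (logp (y _)%:R / _); apply: truncn_def.
  have ts : t <= s by near: s; exact: nbhs_right_ge.
  apply/andP; split; first by rewrite (le_trans h1)// ler_pM2l.
  have : s < (Num.truncn (N * t)).+1%:R / N.
    by near: s; apply: nbhs_right_lt; rewrite ltr_pdivlMr// [t * N]mulrC.
  by rewrite ltr_pdivlMr// [s * N]mulrC.
(* Left limits need the integer part with ties broken downwards: if [N * t] is an integer, the value
   just before [t] belongs to the preceding index. *)
have [m /andP[m1 m2]] : exists m : nat, (m%:R < N * t) && (N * t <= m.+1%:R).
  have Nt0 : 0 < N * t by rewrite mulr_gt0.
  have /andP[h1 h2] := @truncn_itv R (N * t) (ltW Nt0).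
  have [h|h] := eqVneq (N * t) (Num.truncn (N * t))%:R; last first.
    by exists (Num.truncn (N * t)); rewrite lt_neqAle eq_sym h h1/= ltW.
  case E : (Num.truncn (N * t)) h => [|m] h; first by rewrite h ltxx in Nt0.
  by exists m; rewrite h ltr_nat ltnSn lexx.
exists (logp (y m)%:R / N); apply: cvg_near_cst; near=> s.
congr (logp (y _)%:R / _); apply: truncn_def; apply/andP; split.
  have : m%:R / N <= s.
    by near: s; apply: nbhs_left_ge; rewrite ltr_pdivrMr// [t * N]mulrC.
  by rewrite ler_pdivrMr// [s * N]mulrC.
by rewrite (lt_le_trans _ m2)// ltr_pM2l//; near: s; exact: nbhs_left_lt.
Unshelve. all: by end_near. Qed.

(** Identity time changes suffice, because on [[0, T]] a step path reads only finitely many values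
    of [y]. This is what makes path functionals limits of functionals of truncated states. *)
Lemma J1_conv_step_path n (ya : nat -> nat -> nat) y :
  (forall K, \forall a \near \oo, forall m, (m < K)%N -> ya a m = y m) ->
  J1_conv (fun a => step_path n (ya a)) (step_path n y).
Proof.
move=> h; exists (fun _ => id); split.
  move=> _; split=> //; split=> //; split.
    by apply: continuous_subspaceT => z; exact: cvg_id.
  by move=> z z0; exists z.
split=> [e e0|T e e0].
  by apply: nearW => a t t0; rewrite subrr normr0 ltW.
near=> a => t /andP[t0 tT].
rewrite /step_path; suff -> : ya a (Num.truncn (n%:R * t)) = y (Num.truncn (n%:R * t)).
  by rewrite subrr normr0 ltW.
have : (Num.truncn (n%:R * t) < (Num.truncn (n%:R * T)).+1)%N.
  by rewrite ltnS; apply: le_truncn; rewrite ler_wpM2l.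
move: (Num.truncn _); near: a; exact: h.
Unshelve. all: by end_near. Qed.

(* A J1 limit may be checked one precision at a time: the time changes for
   precision [1/N] are glued diagonally. *)
Lemma J1_conv_diag (xn : nat -> R -> R) (x : R -> R) :
  (forall N : nat, \forall n \near \oo, exists l, [/\ time_change l,
     forall t, 0 <= t -> `|l t - t| <= N.+1%:R^-1 &
     forall t, 0 <= t <= N%:R -> `|xn n (l t) - x t| <= N.+1%:R^-1]) ->
  J1_conv xn x.
Proof.
move=> H.
pose Q N n l := [/\ time_change l,
     forall t, 0 <= t -> `|l t - t| <= N.+1%:R^-1 &
     forall t, 0 <= t <= N%:R -> `|xn n (l t) - x t| <= N.+1%:R^-1].
have {H}/choice[f Hf] : forall N, exists m, forall n, (m <= n)%N -> exists l, Q N n l.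
  by move=> N; have [m _ Hm] := H N; exists m.
(* [ok n N] says that [n] has passed the thresholds of all precisions up to [N]. The time change at
   [n] serves the largest such precision [N <= n], which eventually exceeds any given one. *)
pose ok n N := [forall i : 'I_N.+1, (f i <= n)%N].
have tc_id : time_change (id : R -> R).
  split=> //; split=> //; split.
    by apply: continuous_subspaceT => z; exact: cvg_id.
  by move=> z z0; exists z.
have {Hf}/choice[l Hl] : forall n, exists l, time_change l /\
    forall N, (N <= n)%N -> ok n N -> exists2 N', (N <= N')%N & Q N' n l.
  move=> n.
  have [/existsP[N0 okN0]|] := boolP [exists N : 'I_n.+1, ok n N]; last first.
    rewrite negb_exists => /forallP no; exists id; split=> // N Nn okN.
    by have := no (Ordinal (Nn : (N < n.+1)%N)); rewrite okN.
  have := @arg_maxnP _ N0 (fun N => ok n (val N)) val okN0.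
  case=> N1 okN1 maxN1.
  have /(_ (ltnSn _)) fN1 : (N1 < N1.+1)%N -> (f N1 <= n)%N.
    by move=> h; have /forallP/(_ (Ordinal h)) := okN1.
  have [l [tl l1 l2]] := Hf _ _ fN1.
  exists l; split=> // N Nn okN; exists (val N1); last by split.
  exact: (maxN1 (Ordinal (Nn : (N < n.+1)%N)) okN).
have ev N : \forall n \near \oo, exists2 N', (N <= N')%N & Q N' n (l n).
  exists (N + \max_(i < N.+1) f i)%N => // n /= hn.
  have [_ /(_ N)] := Hl n; apply; first by apply: leq_trans hn; exact: leq_addr.
  apply/forallP => i; apply: leq_trans hn; apply: leq_trans (leq_addl _ _).
  exact: (leq_bigmax i).
have arch (e : R) : 0 < e -> exists N : nat, forall N', (N <= N')%N -> N'.+1%:R^-1 <= e.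
  move=> e0; exists (Num.truncn e^-1) => N' hN'.
  rewrite invf_ple// ?posrE ?ltr0n//; apply: ltW; apply: lt_le_trans (truncnS_gt _) _.
  by rewrite ler_nat.
exists l; split; first by move=> n; have [] := Hl n.
split=> [e /arch[N hN]|T e /arch[N hN]].
  near=> n => t t0.
  have [N' NN' [_ h _]] : exists2 N', (N <= N')%N & Q N' n (l n) by near: n; exact: ev.
  by rewrite (le_trans (h t t0))// hN.
near=> n => t /andP[t0 tT].
have [N' NN' [_ _ h]] : exists2 N', (maxn N (Num.truncn T).+1 <= N')%N & Q N' n (l n).
  by near: n; exact: ev.
move: NN'; rewrite geq_max => /andP[NN' TN'].
rewrite (le_trans (h t _)) ?hN// t0/= (le_trans tT)//.
by apply: ltW; apply: lt_le_trans (truncnS_gt _) _; rewrite ler_nat.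
Unshelve. all: by end_near. Qed.

(** A Lipschitz constant below one keeps identity plus [g] strictly increasing. Since [|g| <= b],
    the value [y] is reached on [[0, y + b]] by the intermediate value theorem. *)
Lemma time_change_perturb (g : R -> R) (b : R) :
  g 0 = 0 -> (forall s t, `|g s - g t| <= 2^-1 * `|s - t|) ->
  (forall t, `|g t| <= b) -> time_change (fun t => t + g t).
Proof.
move=> g0 gL gb.
have cont : continuous (fun t => t + g t).
  move=> t; apply/cvgrPdist_le => e e0; near=> s.
  have : `|t - s| <= e / 2.
    by near: s; apply: (@cvgr_dist_le _ _ _ _ _ (fun s => s) t) => //; rewrite divr_gt0.
  have -> : t + g t - (s + g s) = (t - s) + (g t - g s) by ring.
  move=> h; rewrite (le_trans (ler_normD _ _))//.
  have := gL t s; move: h; set u := `|t - s|; set v := `|g t - g s| => h1 h2; lra.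
split; first by rewrite g0 addr0.
split.
  move=> s t s0 st; have := gL s t; rewrite [X in _ * X]distrC [X in _ * X]gtr0_norm ?subr_gt0//.
  rewrite ler_norml => /andP[h1 h2]; lra.
split; first exact: continuous_subspaceT.
move=> y y0.
have b0 : 0 <= b by apply: le_trans (gb 0); rewrite normr_ge0.
have yb0 : 0 <= y + b by rewrite addr_ge0.
have h : Num.min (0 + g 0) (y + b + g (y + b)) <= y <=
    Num.max (0 + g 0) (y + b + g (y + b)).
  rewrite g0 addr0 ge_min y0/= le_max; apply/orP; right.
  have := gb (y + b); rewrite ler_norml => /andP[h1 h2]; lra.
have [c c1 c2] := @IVT R _ 0 (y + b) y yb0 (continuous_subspaceT cont) h.
exists c; split=> //.
by move: c1; rewrite in_itv/= => /andP[].
Unshelve. all: by end_near. Qed.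

End StepPath.

(** * Time changes and the limit path *)

Section AlignedTimeChange.
Variable R : realType.

Lemma positive_lower_bound (s : seq R) :
  exists2 e : R, 0 < e & forall x, x \in s -> 0 < x -> e <= x.
Proof.
elim: s => [|a s [e e0 IH]]; first by exists 1.
have [a0|a0] := ltP 0 a.
  exists (Num.min a e) => [|x]; first by rewrite lt_min a0 e0.
  by rewrite inE => /orP[/eqP->|xs] x0; rewrite ge_min ?lexx// IH ?orbT.
by exists e => // x; rewrite inE => /orP[/eqP->|]; [rewrite ltNge a0|exact: IH].
Qed.

Definition tent (c e t : R) : R := Num.max 0 (1 - `|t - c| / e).

Lemma tent_ge0 c e t : 0 <= tent c e t.
Proof. by rewrite /tent le_max lexx. Qed.

Lemma tent_le1 c e t : 0 < e -> tent c e t <= 1.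
Proof. by move=> e0; rewrite /tent ge_max ler01 gerBl divr_ge0// ltW. Qed.

Lemma tent_center c e : tent c e c = 1.
Proof. by rewrite /tent subrr normr0 mul0r subr0; apply/max_idPr. Qed.

Lemma tent_far c e t : 0 < e -> e <= `|t - c| -> tent c e t = 0.
Proof. by move=> e0 h; apply/max_idPl; rewrite subr_le0 ler_pdivlMr// mul1r. Qed.

Lemma tent_lipschitz c e s t : 0 < e -> `|tent c e s - tent c e t| <= `|s - t| / e.
Proof.
move=> e0.
have maxL (x y : R) : `|Num.max 0 x - Num.max 0 y| <= `|x - y|.
  by have [x0|x0] := leP 0 x; have [y0|y0] := leP 0 y => //;
    rewrite ler_norml; apply/andP; split; have := ler_norm (x - y);
    have := ler_norm (y - x); rewrite (distrC y); move: `|_| => u; lra.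
apply: le_trans (maxL _ _) _.
have -> : 1 - `|s - c| / e - (1 - `|t - c| / e) = (`|t - c| - `|s - c|) / e by ring.
rewrite normrM (gtr0_norm (_ : 0 < e^-1)) ?invr_gt0// ler_pM2r ?invr_gt0//.
apply: le_trans (ler_dist_dist _ _) _.
by rewrite distrC; have -> : s - c - (t - c) = s - t by ring.
Qed.

(** Each [c] is pushed left to its grid point, by at most [1/n], through a tent centred at [c]. The
    tents have a width independent of [n], so the Lipschitz constant of the perturbation is at most
    [size ts / (e n)], which is below [1/2] for large [n]. *)
Lemma aligned_time_change (ts : seq R) : uniq ts -> (forall c, c \in ts -> 0 <= c) ->
  \forall n \near \oo, exists l, [/\ time_change l,
    forall t, `|l t - t| <= (size ts)%:R / n%:R &
    forall c, c \in ts -> l c = (Num.truncn (n%:R * c))%:R / n%:R :> R].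
Proof.
move=> uts ts0.
(* Pairwise distances keep each tent zero at the other centres; the times themselves are listed so
   that tents of positive centres vanish at 0 and [l 0 = 0]. *)
have [e e0 He] := positive_lower_bound (ts ++ [seq `|x - y| | x <- ts, y <- ts]).
near=> n.
have n0 : 0 < n%:R :> R by rewrite ltr0n; near: n; exists 1%N.
pose d c : R := c - (Num.truncn (n%:R * c))%:R / n%:R.
have dP c : c \in ts -> 0 <= d c <= n%:R^-1.
  move=> /ts0 c0; have /andP[h1 h2] := @truncn_itv R (n%:R * c) (mulr_ge0 (ltW n0) c0).
  rewrite /d subr_ge0 ler_pdivrMr// [c * _]mulrC h1/=.
  rewrite lerBlDr -{1}[n%:R^-1]mul1r -mulrDl ler_pdivlMr// [c * _]mulrC ltW//.
  by rewrite (lt_le_trans h2)// -natr1 addrC.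
pose g t : R := - \sum_(c <- ts) d c * tent c e t.
have gbound t : `|g t| <= (size ts)%:R / n%:R.
  rewrite /g normrN (le_trans (ler_norm_sum _ _ _))//.
  have -> : (size ts)%:R / n%:R = \sum_(c <- ts) n%:R^-1 :> R.
    by rewrite big_const_seq count_predT iter_addr_0 mulr_natl.
  rewrite big_seq [leRHS]big_seq; apply: ler_sum => c /dP/andP[d0 d1].
  rewrite normrM !ger0_norm ?tent_ge0// -[leRHS]mulr1 ler_pM ?tent_ge0//.
  exact: tent_le1.
have gc c : c \in ts -> g c = - d c.
  move=> cts; rewrite /g (bigD1_seq c)//= tent_center mulr1 big_seq_cond big1 ?addr0//.
  move=> c' /andP[c'ts c'c]; rewrite tent_far ?mulr0// He//.
    by rewrite mem_cat; apply/orP; right; apply/allpairsP; exists (c, c').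
  by rewrite normr_gt0 subr_eq0 eq_sym.
have g0 : g 0 = 0.
  rewrite /g big_seq big1 ?oppr0// => c cts.
  have := ts0 c cts; rewrite le_eqVlt => /orP[/eqP<-|c0].
    by rewrite /d mulr0 truncn0 mul0r subr0 mul0r.
  by rewrite tent_far ?mulr0// sub0r normrN gtr0_norm// He// mem_cat cts.
have gL s t : `|g s - g t| <= 2^-1 * `|s - t|.
  rewrite /g opprK addrC -sumrB (le_trans (ler_norm_sum _ _ _))//.
  apply: (@le_trans _ _ (\sum_(c <- ts) n%:R^-1 * (`|s - t| / e))).
    rewrite big_seq [leRHS]big_seq; apply: ler_sum => c /dP/andP[d0 d1].
    rewrite -mulrBr normrM ger0_norm// ler_pM// distrC; exact: tent_lipschitz.
  rewrite big_const_seq count_predT iter_addr_0 -[leLHS]mulr_natr.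
  have -> : n%:R^-1 * (`|s - t| / e) * (size ts)%:R = ((size ts)%:R / e / n%:R) * `|s - t|.
    by ring.
  rewrite ler_wpM2r// ler_pdivrMr// -ler_pdivrMl// invrK.
  by near: n; exact: nbhs_infty_ger.
exists (fun t => t + g t); split.
- exact: time_change_perturb g0 gL gbound.
- by move=> t; rewrite addrC addKr.
- by move=> c cts; rewrite gc// /d; ring.
Unshelve. all: by end_near. Qed.

End AlignedTimeChange.

(** * Regularity of the limit path for a fixed point configuration *)

Section SupPath.
Variables (R : realType) (lam : R) (tt jj : nat -> R).

Definition sup_path (t : R) : R :=
  Defs.sup0 [set v | exists k, tt k <= t /\ v = jj k + (t - tt k) * lam].

Definition locally_finite_points := forall T d : R, 0 < d ->
  exists s : seq nat, forall k, tt k <= T -> d < jj k -> k \in s.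

Definition dense_times := forall a b : R, 0 <= a -> a < b ->
  exists k, a <= tt k /\ tt k < b.

Hypothesis tt0 : forall k, 0 <= tt k.
Hypothesis jj0 : forall k, 0 < jj k.
Hypothesis fin_pts : locally_finite_points.
Hypothesis dense : dense_times.

Lemma marks_bounded (T : R) : exists2 B, 0 < B & forall k, tt k <= T -> jj k <= B.
Proof.
have [s Hs] := fin_pts T ltr01.
have [B B1 HB] : exists2 B : R, 1 <= B & forall k, k \in s -> jj k <= B.
  elim: s {Hs} => [|a s [B B1 HB]]; first by exists 1.
  exists (Num.max (jj a) B) => [|k]; first by rewrite le_max B1 orbT.
  by rewrite inE le_max => /orP[/eqP->|/HB->]; rewrite ?lexx ?orbT.
exists B => [|k kT]; first exact: lt_le_trans B1.
have [h|h] := ltP 1 (jj k); first exact: HB (Hs k kT h).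
exact: le_trans B1.
Qed.

Lemma sup_path_ge k t : tt k <= t -> jj k + (t - tt k) * lam <= sup_path t.
Proof.
move=> kt; rewrite /sup_path /Defs.sup0.
have ne : [set v | exists k, tt k <= t /\ v = jj k + (t - tt k) * lam]
   (jj k + (t - tt k) * lam) by exists k.
case: eqP => [E|_]; first by rewrite E in ne.
have [B B0 HB] := marks_bounded t.
apply: ub_le_sup => //; exists (B + t * `|lam|) => _ [i [it ->]].
rewrite lerD ?HB//.
apply: le_trans (ler_norm _) _; rewrite normrM ger0_norm ?subr_ge0// ler_wpM2r//.
by rewrite gerBl.
Qed.

Lemma sup_path_le t V : 0 <= V ->
  (forall k, tt k <= t -> jj k + (t - tt k) * lam <= V) -> sup_path t <= V.
Proof.
move=> V0 H; rewrite /sup_path /Defs.sup0; case: eqP => [//|/eqP/set0P ne].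
by apply: ge_sup => // _ [k [kt ->]]; exact: H.
Qed.

Lemma sup_path_base t : 0 <= t -> Num.max lam 0 * t <= sup_path t.
Proof.
(* At time 0 only points with time 0 compete; if there are none, the empty supremum gives 0. *)
rewrite le_eqVlt => /orP[/eqP<-|t0].
  rewrite mulr0; have [[k k0]|no] := pselect (exists k, tt k <= 0).
    apply: le_trans (sup_path_ge k0).
    have -> : tt k = 0 by apply/le_anti; rewrite k0 tt0.
    by rewrite subrr mul0r addr0 ltW.
  rewrite /sup_path /Defs.sup0; case: eqP => // /eqP/set0P[v [k [k0 _]]].
  by case: no; exists k.
apply/ler_addgt0Pr => e e0.
(* Within a window of length [h] the drift changes a value by at most [e]. *)
pose h := Num.min t (e / (`|lam| + 1)).
have L0 : 0 < `|lam| + 1 by rewrite ltr_wpDl.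
have h0 : 0 < h by rewrite /h lt_min t0 divr_gt0.
have hL : h * `|lam| <= e.
  have : h <= e / (`|lam| + 1) by rewrite /h ge_min lexx orbT.
  rewrite ler_pdivlMr//; apply: le_trans; rewrite ler_wpM2l ?ltW//.
  by rewrite ltrDl.
have ht : h <= t by rewrite /h ge_min lexx.
have [l0|l0] := leP 0 lam.
  have [k [_ kh]] := dense (lexx 0) h0.
  have := @sup_path_ge k t (ltW (lt_le_trans kh ht)).
  have : tt k * lam <= h * `|lam| by apply: ler_pM => //; [exact: ltW|exact: ler_norm].
  have := jj0 k; nra.
rewrite mul0r.
have th0 : 0 <= t - h by lra.
have tht : t - h < t by lra.
have [k [k1 k2]] := dense th0 tht.
have := @sup_path_ge k t (ltW k2).
have : (t - tt k) * `|lam| <= h * `|lam|.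
  by rewrite ler_wpM2r//; lra.
rewrite (ltr0_norm l0) in hL *; have := jj0 k; nra.
Qed.

Lemma sup_path_ge0 t : 0 <= t -> 0 <= sup_path t.
Proof.
move=> t0; apply: le_trans (sup_path_base t0); rewrite mulr_ge0//.
by rewrite le_max lexx orbT.
Qed.

(** Points available at [s] remain available at [t], so the path can fall only through the drift. *)
Lemma sup_path_descent s t : 0 <= s -> s <= t ->
  sup_path s <= sup_path t + (t - s) * `|lam|.
Proof.
move=> s0 st; apply: sup_path_le => [|k ks].
  by apply: addr_ge0; [apply: sup_path_ge0; exact: le_trans st|rewrite mulr_ge0 ?subr_ge0].
have := @sup_path_ge k t (le_trans ks st).
have : (s - t) * lam <= (t - s) * `|lam|.
  by apply: le_trans (ler_norm _) _; rewrite normrM distrC [`|t - s|]ger0_norm// subr_ge0.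
set a := (t - s) * _ => h1 h2; nra.
Qed.

(** Old points gain at most the drift; new ones start from a mark at most [d]. Adding both bounds is
    allowed because the path is nonnegative at [s]. *)
Lemma sup_path_ascent s t d : 0 <= s -> s <= t -> 0 <= d ->
  (forall k, s < tt k -> tt k <= t -> jj k <= d) ->
  sup_path t <= sup_path s + d + (t - s) * `|lam|.
Proof.
move=> s0 st d0 small.
have Zs := sup_path_ge0 s0.
have ts0 : 0 <= (t - s) * `|lam| by rewrite mulr_ge0 ?subr_ge0.
apply: sup_path_le => [|k kt]; first by rewrite !addr_ge0.
have [ks|sk] := leP (tt k) s.
  have := @sup_path_ge k s ks.
  have : (t - s) * lam <= (t - s) * `|lam| by rewrite ler_wpM2l ?subr_ge0// ler_norm.
  set a := (t - s) * `|_| in ts0 * => h1 h2; nra.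
have := small k sk kt.
have : (t - tt k) * lam <= (t - s) * `|lam|.
  apply: le_trans (ler_norm _) _; rewrite normrM ger0_norm ?subr_ge0// ler_wpM2r//.
  by rewrite lerB// ltW.
move: (_ * `|_|) ts0 (_ * lam) => a a0 b; lra.
Qed.

(* Only finitely many big marks lie in a bounded time window, so next to [t]
   there is a one-sided gap free of them. *)
Lemma no_big_mark_after t d : 0 < d ->
  exists2 e : R, 0 < e & forall k, t < tt k -> tt k <= t + e -> jj k <= d.
Proof.
move=> d0; have [s Hs] := fin_pts (t + 1) d0.
have [e e0 He] := positive_lower_bound [seq tt k - t | k <- s].
exists (Num.min 1 (e / 2)) => [|k tk kte]; first by rewrite lt_min ltr01 divr_gt0.
have [//|dk] := leP.
have [h1 h2] : tt k <= t + 1 /\ tt k <= t + e / 2.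
  by split; apply: le_trans kte _; rewrite lerD2l ge_min lexx ?orbT.
have := He (tt k - t) (map_f _ (Hs k h1 dk)); rewrite subr_gt0 tk => /(_ isT); lra.
Qed.

Lemma cadlag_sup_path : cadlag sup_path.
Proof.
split=> t t0.
  apply/cvgrPdist_le => e e0.
  have e2 : 0 < e / 2 by rewrite divr_gt0.
  have [h h0 small] := no_big_mark_after t e2.
  have L0 : 0 < `|lam| + 1 by rewrite ltr_wpDl.
  near=> s.
  have ts : t <= s by near: s; exact: nbhs_right_ge.
  have sth : s <= t + h by near: s; apply: nbhs_right_le; rewrite ltrDl.
  have : s - t <= e / 2 / (`|lam| + 1).
    rewrite lerBlDl; near: s; apply: nbhs_right_le.
    by rewrite ltrDl divr_gt0.
  rewrite ler_pdivlMr// => he.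
  have h1 := sup_path_descent t0 ts.
  have h2 := @sup_path_ascent t s (e / 2) t0 ts (ltW e2)
    (fun k a b => small k a (le_trans b sth)).
  have st0 : 0 <= s - t by rewrite subr_ge0.
  rewrite ler_norml; apply/andP; split; move: h1 h2 he st0;
    move: (`|lam|) => L h1 h2 he st0; nra.
(* By [sup_path_descent], adding [s |lam|] makes the path nondecreasing, so left limits exist by
   monotonicity. *)
pose W s := sup_path s + s * `|lam|.
have Wnd s s' : 0 <= s -> s <= s' -> W s <= W s'.
  by move=> s0 ss'; have := sup_path_descent s0 ss'; rewrite /W; move: `|_| => L; nra.
have /cvg_ex[l Hl] : cvg (W s @[s --> t^'-]).
  apply: nondecreasing_at_left_is_cvgr.
    apply: filterS (nbhs_left_ge t0) => x x0 a b; rewrite !in_itv/= => /andP[xa _] _; apply: Wnd.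
    exact: le_trans x0 (ltW xa).
  apply: filterS (nbhs_left_ge t0) => z z0.
  exists (W t) => v [s /=]; rewrite in_itv/= => /andP[xs st] <-.
  by apply: Wnd; [exact: le_trans z0 (ltW xs)|exact: ltW].
exists (l - t * `|lam|).
have -> : sup_path = (fun s => W s - s * `|lam|) by apply/funext => s; rewrite /W addrK.
apply: cvgB => //; apply: cvgMr_tmp.
by apply: cvg_at_left_filter; exact: cvg_id.
Unshelve. all: by end_near. Qed.

End SupPath.

(** * Convergence of a sample path *)

Section ExpGrowth.
Variable R : realType.

Lemma logp_ge0 (x : R) : 0 <= logp x.
Proof. by rewrite /logp; case: (x <= 0) => //; rewrite le_max lexx orbT. Qed.

Lemma logp_le (x V : R) : 0 <= V -> x <= expR V -> logp x <= V.
Proof.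
move=> V0 xV; rewrite /logp; case: (leP x 0) => // x0; rewrite ge_max V0 andbT.
by rewrite -ler_expR lnK.
Qed.

Lemma logp_ge (x V : R) : expR V <= x -> V <= logp x.
Proof.
move=> Vx; have x0 := lt_le_trans (expR_gt0 V) Vx.
by rewrite /logp (leNgt x) x0/= le_max -{1}[V]expRK ler_ln ?posrE ?expR_gt0// Vx.
Qed.

Lemma linear_le_expR (a b e : R) : 0 < e -> \forall n \near \oo,
  a * n%:R + b <= expR (e * n%:R).
Proof.
move=> e0; near=> n.
have n0 : 1 <= n%:R :> R by near: n; exact: nbhs_infty_ger.
have h : (`|a| + `|b|) / (e ^+ 2 / 2) <= n%:R by near: n; exact: nbhs_infty_ger.
have e2 : 0 < e ^+ 2 / 2 by rewrite divr_gt0// exprn_gt0.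
apply: le_trans (expR_ge1Dxn 1 _); last by rewrite mulr_ge0// ltW.
move: h; rewrite ler_pdivrMr// (_ : 2`!%:R = 2 :> R)// => h.
have h2 : (`|a| + `|b|) * n%:R <= (e * n%:R) ^+ 2 / 2.
  have -> : (e * n%:R) ^+ 2 / 2 = (n%:R * (e ^+ 2 / 2)) * n%:R by ring.
  by rewrite ler_wpM2r.
apply: le_trans (_ : (`|a| + `|b|) * n%:R <= _); last by rewrite (le_trans h2)// lerDr.
rewrite mulrDl lerD// ?ler_wpM2r ?ler_norm//.
by apply: le_trans (ler_norm b) _; rewrite ler_peMr.
Unshelve. all: by end_near. Qed.

End ExpGrowth.

Section Convergence.
Variable R : realType.
Implicit Types (lam : R) (tt jj : nat -> R).
Implicit Types (Jn y : nat -> nat -> nat).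

(* The mark of the [k]-th time slot [k/n, (k+1)/n) governs [ln (Jn n k) / n],
   up to a relative error [e] and an error [C / n]. *)
Definition marks_below_immigration tt jj Jn := forall e : R, 0 < e -> exists C : R,
  forall n k, (0 < n)%N ->
    n%:R * jj k <= (1 + e) * ln (Jn n (Num.truncn (n%:R * tt k)))%:R + C.

Definition immigration_below_marks tt jj Jn := forall e : R, 0 < e -> e < 1 -> exists C : R,
  forall n i, (0 < n)%N -> (1 < Jn n i)%N -> exists2 k,
    Num.truncn (n%:R * tt k) = i & (1 - e) * ln (Jn n i)%:R <= n%:R * jj k + C.

(** The cut-off [max 1] keeps the threshold at least 1, as [population_tail] requires; it is
    harmless because the limit path is nonnegative. *)
Definition population_upper lam Jn y := forall (e : R) (T : nat), 0 < e -> \forall n \near \oo,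
  forall m, (m <= T * n)%N ->
    (y n m)%:R <= expR (e * n%:R) *
      Num.max 1 (\sum_(k < m.+1) (Jn n k)%:R * expR lam ^+ (m - k)).

(** With [min 1] the cohort has to be exponentially large both on arrival and at age [m - k]; a
    smaller one may be extinct. The factor 4 is the loss in [cohort_tail]. *)
Definition population_lower lam Jn y := forall (e : R) (T : nat), 0 < e -> \forall n \near \oo,
  forall m k, (k <= m)%N -> (m <= T * n)%N ->
    expR (e * n%:R) <= (Jn n k)%:R * Num.min 1 (expR (lam - e) ^+ (m - k)) ->
    (Jn n k)%:R * expR (lam - e) ^+ (m - k) <= 4 * (y n m)%:R.

(** Upper bound: every summand of the mean population has exponent at most [Z t + kap / 2], and the
    number of summands is absorbed in [e^(en)]. Lower bound: the cohort of a single big mark already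
    realizes its term of the supremum. All other marks are covered by the base line
    [max (lam, 0) t]. *)
Lemma J1_conv_step_sup lam tt jj Jn y :
  (forall k, 0 <= tt k) -> (forall k, 0 < jj k) ->
  locally_finite_points tt jj -> dense_times tt ->
  marks_below_immigration tt jj Jn -> immigration_below_marks tt jj Jn ->
  population_upper lam Jn y -> population_lower lam Jn y ->
  J1_conv (fun n => @step_path R n (y n)) (sup_path lam tt jj).
Proof.
move=> tt0 jj0 fin_pts dense mJ Jm yU yL; set Z := sup_path lam tt jj.
apply: J1_conv_diag => N; set kap := N.+1%:R^-1.
have kap0 : 0 < kap by rewrite invr_gt0 ltr0n.
have kap1 : kap <= 1 by rewrite invf_le1 ?ler1n ?ltr0n.
set L := `|lam|; have L0 : 0 <= L by exact: normr_ge0.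
(* Slots up to index [(N + 1) n] end no later than time [N + 2]. *)
have [B B0 HB] := marks_bounded fin_pts N.+2%:R.
(* Over a time [eta] the drift is at most [kap / 4]; the point [k0] found in [[0, eta)] will stand
   in for small marks when [lam > 0]. *)
pose eta := kap / (4 * (L + 1)).
have eta0 : 0 < eta by rewrite divr_gt0// mulr_gt0// ltr_wpDl.
have etaL : eta * L <= kap / 4.
  rewrite /eta invfM mulrA mulrAC ler_pdivrMr ?ltr_wpDl//.
  rewrite -[_ / 4 * _]mulrC; have : 0 <= kap / 4 by rewrite divr_ge0// ltW.
  by move: (kap / 4) => u u0; nra.
have [k0 [_ k0eta]] := dense 0 eta (lexx 0) eta0.
(* Marks at most [del] are negligible against [kap], while [k0] still counts as big. *)
pose del := Num.min (kap / 8) (jj k0 / 2).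
have del0 : 0 < del by rewrite lt_min !divr_gt0.
have delkap : del <= kap / 8 by rewrite ge_min lexx.
have delk0 : del < jj k0.
  have : del <= jj k0 / 2 by rewrite ge_min lexx orbT.
  by have := jj0 k0; lra.
have [s Hs] := fin_pts N.+2%:R del del0.
pose ts := undup [seq tt k | k <- s].
have uts : uniq ts by exact: undup_uniq.
have ts0 c : c \in ts -> 0 <= c by rewrite mem_undup => /mapP[k _ ->].
have Hts k : tt k <= N.+2%:R -> del < jj k -> tt k \in ts.
  by move=> h1 h2; rewrite mem_undup map_f// Hs.
set q : R := (size ts)%:R; have q0 : 0 <= q by exact: ler0n.
pose S := B + N.+2%:R + L + 10.
have N2 : 0 <= N.+2%:R :> R by exact: ler0n.
have S0 : 0 < S by rewrite /S; lra.
(* [S] collects every quantity that [e] multiplies later: the marks (relative error of the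
   logarithms), the ages (rate [lam - e] in place of [lam]), the drift, and constants. All these
   errors together stay at [del / 16]. *)
pose e := del / (16 * S).
have e0 : 0 < e by rewrite divr_gt0// mulr_gt0.
have eS : e * S = del / 16 by rewrite /e; field; rewrite gt_eqF.
have eB : 0 <= e * B by rewrite mulr_ge0 ?ltW.
have eN : 0 <= e * N.+2%:R by rewrite mulr_ge0// ltW.
have eL : 0 <= e * L by rewrite mulr_ge0// ltW.
have eSum : e * B + e * N.+2%:R + e * L + 10 * e = del / 16.
  by rewrite -eS /S; ring.
have ehalf : e <= 2^-1 by lra.
have e1 : e < 1 by lra.
have small : 2 * (e * B) + 10 * e <= del / 8 by lra.
have ekap : 8 * e <= kap by lra.
have [C1 HC1] := mJ e e0; have [C2 HC2] := Jm e e0 e1.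
have ger (a : R) : \forall n \near \oo, a <= e * n%:R.
  near=> p; rewrite -ler_pdivrMl//.
  by near: p; exact: nbhs_infty_ger.
near=> n.
have n0 : (0 < n)%N by near: n; exists 1%N.
have n0R : 0 < n%:R :> R by rewrite ltr0n.
have [l [tl ld lc]] : exists l, [/\ time_change l,
    forall t, `|l t - t| <= q / n%:R &
    forall c, c \in ts -> l c = (Num.truncn (n%:R * c))%:R / n%:R :> R].
  by near: n; exact: aligned_time_change.
have U : forall m, (m <= N.+1 * n)%N -> (y n m)%:R <= expR (e * n%:R) *
      Num.max 1 (\sum_(k < m.+1) (Jn n k)%:R * expR lam ^+ (m - k)).
  by near: n; exact: yU.
have W : forall m k, (k <= m)%N -> (m <= N.+1 * n)%N ->
    expR (e * n%:R) <= (Jn n k)%:R * Num.min 1 (expR (lam - e) ^+ (m - k)) ->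
    (Jn n k)%:R * expR (lam - e) ^+ (m - k) <= 4 * (y n m)%:R.
  by near: n; exact: yL.
have nC1 : C1 <= e * n%:R by near: n; exact: ger.
have nC2 : C2 <= e * n%:R by near: n; exact: ger.
have nq : (2 * q + 2) * (L + 1) <= e * n%:R by near: n; exact: ger.
have n4 : 4 <= e * n%:R by near: n; exact: ger.
have nN : N.+1%:R * n%:R + 1 <= expR (e * n%:R) by near: n; exact: linear_le_expR.
have qn : 2 * q + 2 <= n%:R by near: n; exact: nbhs_infty_ger.
have inv0 : 0 < n%:R^-1 :> R by rewrite invr_gt0.
have qnL : (2 * q + 2) / n%:R * (L + 1) <= e.
  by rewrite mulrAC ler_pdivrMr.
have qnL' : (2 * q + 2) / n%:R * L <= e.
  apply: le_trans qnL; rewrite ler_wpM2l// ?lerDl// divr_ge0 ?ler0n//; clear -q0; lra.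
have qne : (2 * q + 2) / n%:R <= e.
  apply: le_trans qnL; rewrite -[leLHS]mulr1 ler_wpM2l ?lerDr// divr_ge0 ?ler0n//; clear -q0; lra.
exists l; split=> //.
  move=> t _; apply: le_trans (ld t) _; apply: le_trans (_ : (2 * q + 2) / n%:R <= _).
    by rewrite ler_pM2r//; clear -q0; lra.
  by apply: le_trans qne _; rewrite -/kap; clear -ekap kap0; lra.
move=> t /andP[t0 tN].
have [l0 [lmono [_ _]]] := tl.
have lt0 : 0 <= l t.
  move: t0; rewrite le_eqVlt => /orP[/eqP<-|t0]; first by rewrite l0.
  by apply: ltW; rewrite -l0; exact: lmono.
set m := Num.truncn (n%:R * l t).
have /andP[m1 m2] := @truncn_itv R (n%:R * l t) (mulr_ge0 (ltW n0R) lt0).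
rewrite -/m in m1 m2.
have mn1 : m%:R / n%:R <= l t by rewrite ler_pdivrMr// mulrC.
have mn2 : l t <= m%:R / n%:R + n%:R^-1.
  rewrite -[X in _ + X]mul1r -mulrDl ler_pdivlMr// mulrC ltW//.
  by rewrite (lt_le_trans m2)// -natr1.
have lqt := ld t; rewrite ler_norml in lqt; have /andP[lq1 lq2] := lqt.
have q2E : (2 * q + 2) / n%:R = q / n%:R + q / n%:R + n%:R^-1 + n%:R^-1 by field; rewrite gt_eqF.
have qninv : 0 <= q / n%:R by rewrite divr_ge0 ?ler0n.
have mt : `|m%:R / n%:R - t| <= q / n%:R + n%:R^-1.
  by rewrite ler_norml; apply/andP; split; clear -mn1 mn2 lq1 lq2; lra.
have mN : (m <= N.+1 * n)%N.
  have : m%:R <= N.+1%:R * n%:R :> R.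
    rewrite -ler_pdivrMr//; apply: le_trans mn1 _.
    have -> : N.+1%:R = N%:R + 1 :> R by rewrite -natr1.
    have : q / n%:R <= 1 by rewrite ler_pdivrMr// mul1r; clear -qn q0; lra.
    by clear -lq2 tN; lra.
  by rewrite -natrM ler_nat.
have Zt0 : 0 <= Z t by exact: (sup_path_ge0 lam tt0 jj0 fin_pts dense).
have Zb : Num.max lam 0 * t <= Z t by exact: (sup_path_base lam tt0 jj0 fin_pts dense).
have lam0 : 0 <= Num.max lam 0 by rewrite le_max lexx orbT.
have lamL : Num.max lam 0 <= L by rewrite ge_max ler_norm L0.
have NN2 : N%:R <= N.+2%:R :> R by rewrite ler_nat -addn2 leq_addr.
(* A big mark in slot [i <= m] sits at a time at most [t], by alignment. *)
have big k : tt k <= N.+2%:R -> del < jj k ->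
    (Num.truncn (n%:R * tt k) <= m)%N = (tt k <= t) /\
    `|(Num.truncn (n%:R * tt k))%:R / n%:R - tt k| <= q / n%:R.
  move=> kN dk; have lk := lc _ (Hts k kN dk); rewrite -lk; split; last exact: ld.
  apply/idP/idP => [km|kt].
    rewrite leNgt; apply/negP => tk; have := lmono _ _ t0 tk; rewrite lk.
    apply/negP; rewrite -leNgt; apply: le_trans mn1.
    by rewrite ler_pM2r// ler_nat.
  rewrite /m truncn_ge_nat ?mulr_ge0// [n%:R * l t]mulrC -ler_pdivrMr// -lk.
  by move: kt; rewrite le_eqVlt => /orP[/eqP->//|kt]; apply/ltW/lmono.
(* The age counted in slots differs from [t - tt k] only by rounding and by the time change, which
   costs at most [e] after multiplication by [L]. *)
have drift k : tt k <= N.+2%:R -> del < jj k -> tt k <= t ->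
    L * `|(m - Num.truncn (n%:R * tt k))%:R / n%:R - (t - tt k)| <= e.
  move=> kN dk kt; have [E h] := big k kN dk.
  rewrite natrB ?E// mulrBl; apply: le_trans qnL'; rewrite mulrC ler_wpM2r//.
  have -> : m%:R / n%:R - (Num.truncn (n%:R * tt k))%:R / n%:R - (t - tt k) =
    (m%:R / n%:R - t) - ((Num.truncn (n%:R * tt k))%:R / n%:R - tt k) by ring.
  by apply: le_trans (ler_normB _ _) _; clear -mt h q2E inv0; lra.
(* Growth alone, from any slot, stays below the base line of the limit; this settles all slots with
   a small mark. *)
have rmax (i : nat) : (i <= m)%N -> (m - i)%:R / n%:R * lam <= Z t + e.
  move=> im; apply: (@le_trans _ _ (Num.max lam 0 * (m%:R / n%:R))).
    apply: (@le_trans _ _ (Num.max lam 0 * ((m - i)%:R / n%:R))).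
      by rewrite mulrC ler_wpM2r ?divr_ge0 ?ler0n// le_max lexx.
    by rewrite ler_wpM2l// ler_pM2r// ler_nat leq_subr.
  have -> : m%:R / n%:R = t + (m%:R / n%:R - t) by ring.
  rewrite mulrDr lerD//; apply: le_trans qnL'.
  apply: le_trans (_ : Num.max lam 0 * ((2 * q + 2) / n%:R) <= _).
    by rewrite ler_wpM2l//; apply: le_trans (ler_norm _) _; clear -mt q2E inv0 qninv; lra.
  by rewrite mulrC ler_wpM2l// divr_ge0 ?ler0n//; clear -q0; lra.
(* A single immigrant has logarithm 0 and is not covered by [immigration_below_marks]; it is treated
   by growth alone. *)
have exponent (i : nat) : (i <= m)%N -> (0 < Jn n i)%N ->
    ln (Jn n i)%:R / n%:R + (m - i)%:R / n%:R * lam <= Z t + kap / 2.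
  move=> im; rewrite leq_eqVlt => /orP[/eqP<-|J1].
    by rewrite ln1 mul0r add0r; apply: le_trans (rmax i im) _; clear -ekap kap0; lra.
  have [k ki hk] := HC2 n i n0 J1.
  set a := ln _ / _.
  have ha : (1 - e) * a <= jj k + e.
    rewrite /a mulrA ler_pdivrMr// [leRHS]mulrDl [jj k * _]mulrC.
    by apply: le_trans hk _; rewrite lerD2l.
  have kN : tt k <= N.+2%:R.
    have /andP[_ h] := @truncn_itv R (n%:R * tt k) (mulr_ge0 (ltW n0R) (tt0 k)).
    rewrite ki in h; rewrite -(ler_pM2l n0R); apply: le_trans (ltW h) _.
    rewrite -natrM ler_nat; clear -n0 im mN; nia.
  have jB := HB k kN.
  have aj : a <= jj k + 2 * (e * B) + 4 * e.
    have eJ : e * jj k <= e * B by rewrite ler_wpM2l// ltW.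
    have eJ0 : 0 <= e * jj k by rewrite mulr_ge0 ?ltW.
    rewrite leNgt; apply/negP => h.
    have : (1 - e) * (jj k + 2 * (e * B) + 4 * e) < (1 - e) * a.
      by rewrite ltr_pM2l//; clear -e1; lra.
    have e2B : e * (e * B) <= 2^-1 * (e * B) by rewrite ler_wpM2r.
    have e2 : e * e <= 2^-1 * e by rewrite ler_wpM2r// ltW.
    by rewrite !mulrBl !mul1r !mulrDr; clear -ha eJ e2B e2 e0 eB; lra.
  have [jd|dj] := leP (jj k) del.
    by have := rmax i im; clear -aj jd small delkap kap0 e0; lra.
  have [E _] := big k kN dj.
  have kt : tt k <= t by rewrite -E ki.
  have := drift k kN dj kt; rewrite ki -normrM => /(le_trans (ler_norm _)).
  rewrite mulrBr => hd; have := sup_path_ge lam tt0 fin_pts kt; rewrite -/(Z t) => hZ.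
  move: hd hZ; clear -aj small delkap kap0 e0; lra.
have upper : @step_path R n (y n) (l t) <= Z t + kap.
  rewrite /step_path -/m ler_pdivrMr//; apply: logp_le.
    by rewrite mulr_ge0 ?addr_ge0// ltW.
  apply: le_trans (U m mN) _.
  pose V := (Z t + kap / 2) * n%:R.
  have V1 : 1 <= expR V.
    by rewrite -expR0 ler_expR mulr_ge0 ?addr_ge0// ?divr_ge0// ltW.
  have term (i : 'I_m.+1) : (Jn n i)%:R * expR lam ^+ (m - i) <= expR V.
    have im : (i <= m)%N by rewrite -ltnS.
    have [->|] := posnP (Jn n i); first by rewrite mul0r expR_ge0.
    move=> J0; rewrite -expRM_natl -{1}[(Jn n i)%:R]lnK ?posrE ?ltr0n//.
    rewrite -expRD ler_expR /V -ler_pdivrMr// mulrDl.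
    by apply: le_trans (exponent i im J0); rewrite lerD2l mulrAC.
  have msum : Num.max 1 (\sum_(k < m.+1) (Jn n k)%:R * expR lam ^+ (m - k)) <=
      expR (e * n%:R) * expR V.
    have mexp : m.+1%:R <= expR (e * n%:R) :> R.
      by apply: le_trans nN; rewrite -natrM natr1 ler_nat.
    rewrite ge_max; apply/andP; split.
      by apply: mulr_ege1 => //; apply: le_trans mexp; rewrite ler1n.
    apply: (@le_trans _ _ (\sum_(k < m.+1) expR V)); first exact: ler_sum.
    by rewrite sumr_const card_ord -[leLHS]mulr_natl ler_wpM2r ?expR_ge0.
  apply: le_trans (_ : expR (e * n%:R) * (expR (e * n%:R) * expR V) <= _).
    by rewrite ler_wpM2l ?expR_ge0.
  rewrite -!expRD ler_expR /V -!mulrDl ler_pM2r//; clear -ekap kap0; lra.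
have sp0 : 0 <= @step_path R n (y n) (l t) by rewrite divr_ge0 ?logp_ge0.
have lower_big k : tt k <= t -> del < jj k ->
    jj k + (t - tt k) * lam <= @step_path R n (y n) (l t) + kap / 2.
  move=> kt dj.
  have kN : tt k <= N.+2%:R by apply: le_trans kt _; clear -tN NN2; lra.
  set v := jj k + _.
  have [vk|kv] := leP v (kap / 2); first by clear -vk sp0; lra.
  pose i := Num.truncn (n%:R * tt k).
  have [E _] := big k kN dj; have im : (i <= m)%N by rewrite E.
  have jB := HB k kN.
  have eJ : e * jj k <= e * B by rewrite ler_wpM2l// ltW.
  have eJ0 : 0 <= e * jj k by rewrite mulr_ge0 ?ltW.
  pose a : R := ln (Jn n i)%:R / n%:R.
  have ha : jj k <= (1 + e) * a + e.
    rewrite -(ler_pM2l n0R) (le_trans (HC1 n k n0))// -/i.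
    have -> : n%:R * ((1 + e) * a + e) = (1 + e) * (a * n%:R) + e * n%:R by ring.
    by rewrite /a divfK ?gt_eqF// lerD2l.
  have aj : jj k - e - e * B <= a.
    rewrite leNgt; apply/negP => h.
    have : (1 + e) * a < (1 + e) * (jj k - e - e * B) by rewrite ltr_pM2l//; clear -e0; lra.
    have e2B : 0 <= e * (e * B) by rewrite mulr_ge0// ltW.
    have e2 : 0 <= e * e by rewrite mulr_ge0// ltW.
    by rewrite !mulrDl !mul1r !mulrBr; clear -ha eJ e2 e2B; lra.
  have aE : ln (Jn n i)%:R = a * n%:R by rewrite /a divfK// gt_eqF.
  have J0 : (0 < Jn n i)%N.
    rewrite lt0n; apply/eqP => J0; move: aj; rewrite /a J0 ln0// mul0r; clear -dj small eB e0 del0; lra.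
  have JE : (Jn n i)%:R = expR (a * n%:R) by rewrite -aE lnK ?posrE ?ltr0n.
  pose r : R := (m - i)%:R / n%:R.
  have r0 : 0 <= r by rewrite divr_ge0 ?ler0n.
  have rN : r <= N.+2%:R.
    rewrite /r ler_pdivrMr// -natrM ler_nat; clear -n0 im mN; nia.
  have rE : expR (lam - e) ^+ (m - i) = expR (r * (lam - e) * n%:R).
    by rewrite -expRM_natl /r; congr expR; field; rewrite gt_eqF.
  have er : r * e <= e * N.+2%:R by rewrite mulrC ler_wpM2l// ltW.
  have hr : (t - tt k) * lam <= r * lam + e.
    have := drift k kN dj kt; rewrite -/i -/r -normrM => /ler_normlP[+ _].
    by rewrite mulrBr; clear; lra.
  have big_exp : v - del / 4 <= a + r * (lam - e) by rewrite /v mulrBr; clear -aj hr er eSum eL e0 eB eN del0; lra.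
  (* The cohort qualifies for the lower bound: it is large on arrival as its mark exceeds [del], and
     large at age [m - i] as its term [v] exceeds [kap / 2]. *)
  have cond : expR (e * n%:R) <=
      expR (a * n%:R) * Num.min 1 (expR (r * (lam - e) * n%:R)).
    rewrite minr_pMr ?expR_ge0// mulr1 -expRD -mulrDl le_min !ler_expR !ler_pM2r//.
    by apply/andP; split; clear -aj dj small eB e0 big_exp kv delkap del0 ekap kap0; lra.
  have := W m i im mN; rewrite JE rE => /(_ cond); rewrite -expRD -mulrDl => h.
  have h4 : 4 <= expR (e * n%:R) by apply: le_trans (expR_ge1Dx _); clear -n4; lra.
  rewrite -lerBlDr ler_pdivlMr//; apply: logp_ge.
  rewrite -(@ler_pM2l _ 4)//; apply: le_trans h.
  apply: le_trans (_ : expR (e * n%:R) * expR ((v - kap / 2) * n%:R) <= _).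
    by rewrite ler_wpM2r ?expR_ge0.
  rewrite -expRD ler_expR -mulrDl ler_pM2r//; clear -big_exp ekap delkap kap0; lra.
have lower : Z t <= @step_path R n (y n) (l t) + kap.
  apply: sup_path_le => // [|k kt]; first by rewrite addr_ge0// ltW.
  have [jd|dj] := leP (jj k) del; last first.
    by have := lower_big k kt dj; clear -kap0; lra.
  have : (t - tt k) * lam <= Num.max lam 0 * t.
    apply: (@le_trans _ _ (Num.max lam 0 * (t - tt k))).
      by rewrite mulrC ler_wpM2r ?subr_ge0// le_max lexx.
    by rewrite ler_wpM2l// gerBl.
  (* For a small mark and [lam > 0], either [t < tt k0 < eta] and the whole drift is negligible, or
     the cohort of [k0] supplies nearly all of [lam * t]. *)
  have [lam_le0|lam_gt0] := leP lam 0; first by rewrite mul0r; clear -jd sp0 delkap kap0; lra.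
  have lamE : L = lam by rewrite /L gtr0_norm.
  have [tk0|k0t] := ltP t (tt k0).
    have : lam * t <= L * eta by rewrite lamE ler_wpM2l ?ltW// (lt_trans tk0).
    by rewrite [L * _]mulrC; clear -jd sp0 delkap kap0 etaL; lra.
  have := lower_big k0 k0t delk0.
  have : tt k0 * lam <= eta * L by rewrite lamE ler_wpM2r ?ltW.
  have := jj0 k0; rewrite mulrBl [t * _]mulrC; clear -jd sp0 delkap kap0 etaL; lra.
by rewrite ler_norml; apply/andP; split; clear -upper lower; lra.
Unshelve. all: by end_near.
Qed.

End Convergence.

(** * Offspring laws and generating functions *)

Section NatValued.
Context d (Omega : measurableType d) (R : realType).
Variable P : probability Omega R.

Lemma measurable_fun_nat d' (T : measurableType d') (g : nat -> T) :
  measurable_fun setT g.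
Proof. by []. Qed.

Lemma measurable_natcomp d' (T : measurableType d') (Z : Omega -> nat) (g : nat -> T) :
  measurable_fun setT Z -> measurable_fun setT (fun w => g (Z w)).
Proof. by move=> mZ; apply: (measurableT_comp (measurable_fun_nat g)). Qed.

Lemma measurable_nateq (Z : Omega -> nat) (B : set nat) :
  measurable_fun setT Z -> measurable (Z @^-1` B).
Proof. by move=> mZ; rewrite -[X in measurable X]setTI; exact: mZ. Qed.

Lemma bigcup_nateq (Z : Omega -> nat) (A : set Omega) :
  \bigcup_y (A `&` Z @^-1` [set y]) = A.
Proof.
rewrite eqEsubset; split=> [w [y _ []]//|w Aw]; by exists (Z w).
Qed.

Lemma trivIset_nateq (Z : Omega -> nat) (A : set Omega) :
  trivIset setT (fun y => A `&` Z @^-1` [set y]).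
Proof.
apply/trivIsetP => i j _ _ ij; rewrite -subset0 => w [[_ /= Zi] [_ /= Zj]].
by move: ij; rewrite -Zi -Zj eqxx.
Qed.

(** Elementary conditioning on the value of [Z]: on each level set the factor [g (Z w)] is a
    constant. *)
Lemma integral_nat_split (A : set Omega) (Z : Omega -> nat) (g : nat -> R)
    (h : Omega -> \bar R) :
  measurable A -> measurable_fun setT Z -> (forall y, 0 <= g y) ->
  measurable_fun setT h -> (forall w, 0 <= h w)%E ->
  (\int[P]_(w in A) ((g (Z w))%:E * h w) =
   \sum_(0 <= y <oo) ((g y)%:E * \int[P]_(w in A `&` Z @^-1` [set y]) h w))%E.
Proof.
move=> mA mZ g0 mh h0.
have mgh : measurable_fun setT (fun w => (g (Z w))%:E * h w)%E.
  apply: emeasurable_funM => //.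
  exact/measurable_EFinP/(measurable_natcomp g).
have mAy y : measurable (A `&` Z @^-1` [set y]).
  by apply: measurableI => //; exact: measurable_nateq.
rewrite -{1}(bigcup_nateq Z A) ge0_integral_bigcup //; last 3 first.
- exact: measurable_funTS.
- by move=> w _; rewrite mule_ge0// lee_fin.
- exact: trivIset_nateq.
apply: eq_eseriesr => y _.
rewrite -ge0_integralZl//; last 2 first.
- exact: measurable_funTS.
- by rewrite lee_fin.
by apply: eq_integral => w; rewrite inE => -[_ /= ->].
Qed.

Lemma expectation_nat (Z : Omega -> nat) (g : nat -> R) :
  measurable_fun setT Z -> (forall y, 0 <= g y) ->
  (\int[P]_w (g (Z w))%:E = \sum_(0 <= y <oo) ((g y)%:E * P (Z @^-1` [set y])))%E.
Proof.
move=> mZ g0.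
transitivity (\int[P]_(w in setT) ((g (Z w))%:E * 1))%E.
  by apply: eq_integral => w _; rewrite mule1.
rewrite (@integral_nat_split setT Z g (cst 1%E))//.
apply: eq_eseriesr => y _; rewrite setTI; congr (_ * _)%E.
by rewrite integral_cst ?mul1e//; exact: measurable_nateq.
Qed.

Lemma prob_nat_split (A : set Omega) (Z : Omega -> nat) :
  measurable A -> measurable_fun setT Z ->
  P A = (\sum_(0 <= y <oo) P (A `&` Z @^-1` [set y]))%E.
Proof.
move=> mA mZ; have mAy y : measurable (A `&` Z @^-1` [set y]).
  by apply: measurableI => //; exact: measurable_nateq.
rewrite -{1}(bigcup_nateq Z A) measure_semi_bigcup//; first exact: trivIset_nateq.
exact: bigcup_measurable.
Qed.

End NatValued.

Section GeneratingFunction.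
Variable R : realType.
Implicit Types (p q : nat -> R) (s : R).

Definition gen_fun p s : \bar R := (\sum_(0 <= y <oo) (p y * s ^+ y)%:E)%E.

Lemma conv_ge0 p q : (forall y, 0 <= p y) -> (forall y, 0 <= q y) ->
  forall y, 0 <= Defs.conv p q y.
Proof. by move=> p0 q0 y; apply: sumr_ge0 => j _; rewrite mulr_ge0. Qed.

Lemma convpow_ge0 p x : (forall y, 0 <= p y) -> forall y, 0 <= convpow p x y.
Proof.
move=> p0; elim: x => [y /=|x IH]; first exact: ler0n.
exact: conv_ge0.
Qed.

(** Cauchy product as a Tonelli interchange: the triangular sum is extended by zeros to all [j], and
    each inner series is then shifted to start at [y = j]. *)
Lemma gen_fun_conv p q s : (forall y, 0 <= p y) -> (forall y, 0 <= q y) -> 0 <= s ->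
  gen_fun p s \is a fin_num -> gen_fun q s \is a fin_num ->
  gen_fun (Defs.conv p q) s = (gen_fun p s * gen_fun q s)%E.
Proof.
move=> p0 q0 s0 fp fq.
pose a (y j : nat) : \bar R :=
  if (j <= y)%N then ((p j * s ^+ j) * (q (y - j)%N * s ^+ (y - j)))%:E else 0%E.
have a0 y j : (0 <= a y j)%E.
  by rewrite /a; case: ifP => // _; rewrite lee_fin !mulr_ge0// exprn_ge0.
transitivity (\sum_(0 <= y <oo) \sum_(0 <= j <oo) a y j)%E.
  apply: eq_eseriesr => y _.
  rewrite (@nneseries_split _ _ 0 y.+1)// add0n.
  rewrite [X in (_ + X)%E]eseries0 ?adde0; last first.
    by move=> i yi _; rewrite /a leqNgt yi.
  rewrite big_mkord /Defs.conv mulr_suml -sumEFin; apply: eq_bigr => j _.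
  rewrite /a -ltnS ltn_ord; congr EFin.
  have jy : (j <= y)%N by rewrite -ltnS.
  have -> : s ^+ y = s ^+ j * s ^+ (y - j) by rewrite -exprD subnKC.
  ring.
rewrite nneseries_interchange//.
transitivity (\sum_(0 <= j <oo) ((p j * s ^+ j)%:E * gen_fun q s))%E.
  apply: eq_eseriesr => j _.
  rewrite (@nneseries_split _ _ 0 j)// add0n big_nat big1 ?add0e; last first.
    by move=> i /andP[_ ij]; rewrite /a leqNgt ij.
  rewrite -nneseries_addn// /gen_fun -nneseriesZl; last first.
    by move=> y _; rewrite lee_fin mulr_ge0// exprn_ge0.
  by apply: eq_eseriesr => y _; rewrite /a leq_addl addnK -EFinM.
rewrite -(fineK fq) muleC -nneseriesZl; last first.
  by move=> y _; rewrite lee_fin mulr_ge0// exprn_ge0.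
by apply: eq_eseriesr => y _; rewrite muleC.
Qed.

Lemma gen_fun_convpow p x s : (forall y, 0 <= p y) -> 0 <= s ->
  gen_fun p s \is a fin_num ->
  gen_fun (convpow p x) s = (fine (gen_fun p s) ^+ x)%:E.
Proof.
move=> p0 s0 fp; elim: x => [|x IH].
  rewrite /gen_fun (@nneseries_split _ _ 0 1)//; last first.
    by move=> k _; rewrite lee_fin mulr_ge0// ?exprn_ge0// ler0n.
  rewrite big_nat1 eseries0 ?adde0 /= ?mulr1//.
  by move=> [//|i] _ _; rewrite /= mul0r.
rewrite /= gen_fun_conv//.
- by rewrite IH exprS EFinM fineK.
- exact: convpow_ge0.
- by rewrite IH.
Qed.

End GeneratingFunction.

(** * Branching property and iterates of the generating function *)

Section Markov.
Context d (Omega : measurableType d) (R : realType).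
Variable P : probability Omega R.
Variables (Z : nat -> Omega -> nat) (p : nat -> R).
Hypothesis mZ : forall n, measurable_fun setT (Z n).
Hypothesis Z0 : forall w, Z 0%N w = 1%N.
Hypothesis gw : forall (n : nat) (x : nat -> nat),
    P [set w | forall m, (m <= n)%N -> Z m w = x m] =
    (((x 0%N == 1%N)%:R * \prod_(m < n) convpow p (x m) (x m.+1)) : R)%:E.

Lemma measurable_path (A : set nat) (x : nat -> nat) :
  measurable [set w | forall m, A m -> Z m w = x m].
Proof.
rewrite [X in measurable X](_ : _ = \bigcap_(m in A) Z m @^-1` [set x m]) //.
by apply: bigcap_measurableType => m _; exact: measurable_nateq.
Qed.

(** [is_GW] asks of [p] only the path formula; started from one individual, its first step
    identifies [p] with the law of [Z 1], whence nonnegativity. *)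
Lemma offspring_law y : (p y)%:E = P (Z 1%N @^-1` [set y]).
Proof.
have := gw 1 (fun m => if m == 0%N then 1%N else y).
rewrite eqxx mul1r big_ord1 /= => H.
rewrite (_ : _ @^-1` _ = [set w | forall m, (m <= 1)%N ->
    Z m w = if m == 0%N then 1%N else y]); last first.
  apply/seteqP; split=> w /=.
    by move=> Zy [|[|//]] _ //=.
  by move=> /(_ 1%N isT).
rewrite H; congr EFin; rewrite /Defs.conv big_ord_recr/= subnn mulr1 big1 ?add0r// => i _.
by rewrite subn_eq0 leqNgt ltn_ord mulr0.
Qed.

Lemma offspring_ge0 y : 0 <= p y.
Proof. by rewrite -lee_fin offspring_law. Qed.

Let suffix j r x := [set w | forall m, (j <= m <= r)%N -> Z m w = x m].

(** The hypothesis gives laws of paths from time 0 only; the initial coordinates are summed out one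
    by one. *)
Lemma markov_suffix r j x : (j <= r)%N ->
  P (suffix j r.+1 x) = (P (suffix j r x) * (convpow p (x r) (x r.+1))%:E)%E.
Proof.
elim: j x => [|j IH] x jr.
  by rewrite /suffix !gw big_ord_recr/= -EFinM mulrA.
have split_suffix r' : (r <= r')%N -> P (suffix j.+1 r' x) =
    (\sum_(0 <= v <oo) P (suffix j r' (fun m => if m == j then v else x m)))%E.
  move=> rr'; rewrite (@prob_nat_split _ _ _ _ (suffix j.+1 r' x) (Z j))//; last first.
    exact: (@measurable_path [set m | (j.+1 <= m <= r')%N]).
  apply: eq_eseriesr => v _; congr (P _).
  apply/seteqP; split=> w /=.
    move=> [h Zj] m /andP[jm mr]; case: eqP => [->//|/eqP mj]; apply: h.
    by rewrite ltn_neqAle eq_sym mj jm.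
  move=> h; split=> [m /andP[jm mr]|]; last first.
    have jr' : (j <= r')%N by exact: leq_trans (ltnW jr) rr'.
    by have := h j; rewrite leqnn jr' eqxx; apply.
  have := h m; rewrite (ltnW jm) mr gtn_eqF//; exact.
rewrite split_suffix// split_suffix// muleC -nneseriesZl//.
apply: eq_eseriesr => v _; rewrite IH ?(ltnW jr)// muleC.
by rewrite !gtn_eqF// ltnS ltnW.
Qed.

Lemma markov_step r x y :
  P (Z r @^-1` [set x] `&` Z r.+1 @^-1` [set y]) =
  (P (Z r @^-1` [set x]) * (convpow p x y)%:E)%E.
Proof.
pose u m := if m == r then x else y.
have -> : Z r @^-1` [set x] `&` Z r.+1 @^-1` [set y] = suffix r r.+1 u.
  apply/seteqP; split=> w /=.
    move=> [h1 h2] m /andP[rm mr]; rewrite /u; case: eqP => [->//|/eqP mne].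
    have -> // : m = r.+1 by apply/eqP; rewrite eqn_leq mr ltn_neqAle eq_sym mne.
  by move=> h; split; [have := h r|have := h r.+1]; rewrite /u ?leqnn ?leqnSn ?eqxx ?gtn_eqF//; exact.
have -> : Z r @^-1` [set x] = suffix r r u.
  apply/seteqP; split=> w /=.
    by move=> h m; rewrite -eqn_leq => /eqP <-; rewrite /u eqxx.
  by move=> h; have := h r; rewrite /u leqnn eqxx; exact.
by rewrite markov_suffix// /u eqxx gtn_eqF.
Qed.

(** An integral rather than [gen_fun p], so that it does not mention the offspring law hidden in the
    existential of [is_GW]. *)
Definition pgf (s : R) : R := fine (\int[P]_w (s ^+ Z 1%N w)%:E)%E.

Lemma integral_pow_bounds (V : Omega -> nat) (s : R) : measurable_fun setT V ->
  0 <= s <= 1 -> (0 <= \int[P]_w (s ^+ V w)%:E <= 1)%E.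
Proof.
move=> mV s01; have /andP[s0 s1] := s01.
apply/andP; split; first by apply: integral_ge0 => w _; rewrite lee_fin exprn_ge0.
have : (\int[P]_w (s ^+ V w)%:E <= \int[P]_w 1)%E.
  apply: ge0_le_integral => //.
  - by move=> w _; rewrite lee_fin exprn_ge0.
  - exact/measurable_EFinP/(measurable_natcomp (fun k => s ^+ k)).
  - by move=> w _; rewrite lee_fin exprn_ile1.
by rewrite integral_cst//= probability_setT mul1e.
Qed.

Lemma integral_pow_fin (V : Omega -> nat) (s : R) : measurable_fun setT V ->
  0 <= s <= 1 -> (\int[P]_w (s ^+ V w)%:E)%E \is a fin_num.
Proof.
move=> mV s01; have /andP[h0 h1] := integral_pow_bounds mV s01.
by rewrite ge0_fin_numE// (le_lt_trans h1)// ltry.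
Qed.

Lemma pgf_gen_fun s : 0 <= s -> gen_fun p s = (\int[P]_w (s ^+ Z 1%N w)%:E)%E.
Proof.
move=> s0; rewrite (@expectation_nat _ _ _ _ _ (fun k => s ^+ k))//; last first.
  by move=> y; exact: exprn_ge0.
by apply: eq_eseriesr => y _; rewrite -offspring_law -EFinM mulrC.
Qed.

Lemma pgf_bounds s : 0 <= s <= 1 -> 0 <= pgf s <= 1.
Proof.
move=> s01; have := integral_pow_bounds (mZ 1) s01.
by rewrite -(fineK (integral_pow_fin (mZ 1) s01)) !lee_fin.
Qed.

(** Given [Z r = x] the next generation has law [convpow p x], whose generating function is the
    [x]-th power of that of [p]. *)
Lemma pgf_step r s : 0 <= s <= 1 ->
  (\int[P]_w (s ^+ Z r.+1 w)%:E = \int[P]_w (pgf s ^+ Z r w)%:E)%E.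
Proof.
move=> s01; have /andP[s0 s1] := s01; have /andP[f0 _] := pgf_bounds s01.
rewrite (@expectation_nat _ _ _ _ _ (fun k => s ^+ k))//; last first.
  by move=> y; exact: exprn_ge0.
rewrite (@expectation_nat _ _ _ _ _ (fun k => pgf s ^+ k))//; last first.
  by move=> y; exact: exprn_ge0.
have cp0 x y := convpow_ge0 x offspring_ge0 y.
transitivity (\sum_(0 <= y <oo) \sum_(0 <= x <oo)
    ((s ^+ y)%:E * (P (Z r @^-1` [set x]) * (convpow p x y)%:E)))%E.
  apply: eq_eseriesr => y _.
  rewrite (@prob_nat_split _ _ _ _ _ (Z r))//; last exact: measurable_nateq.
  rewrite -nneseriesZl//; apply: eq_eseriesr => x _.
  by rewrite setIC markov_step.
rewrite nneseries_interchange; last first.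
  by move=> i j; rewrite !mule_ge0// lee_fin ?exprn_ge0.
apply: eq_eseriesr => x _.
have fin1 : gen_fun p s \is a fin_num by rewrite pgf_gen_fun// integral_pow_fin.
have := gen_fun_convpow x offspring_ge0 s0 fin1.
rewrite pgf_gen_fun// -/(pgf s) => <-.
have Pfin : P (Z r @^-1` [set x]) \is a fin_num by apply: fin_num_measure; exact: measurable_nateq.
rewrite -(fineK Pfin) muleC /gen_fun -nneseriesZl; last first.
  by move=> y _; rewrite lee_fin mulr_ge0// exprn_ge0.
by apply: eq_eseriesr => y _; rewrite -!EFinM; congr EFin; ring.
Qed.

Lemma pgf_iter r s : 0 <= s <= 1 ->
  (\int[P]_w (s ^+ Z r w)%:E = (iter r pgf s)%:E)%E.
Proof.
elim: r s => [|r IH] s s01.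
  under eq_integral do rewrite Z0 expr1.
  by rewrite integral_cst//= probability_setT mule1.
by rewrite pgf_step// IH ?pgf_bounds// -iterSr.
Qed.

End Markov.

(** * Tail bounds for Galton-Watson populations *)

Section PgfBounds.
Context d (Omega : measurableType d) (R : realType).
Variable P : probability Omega R.
Variables (Z : nat -> Omega -> nat) (mu : R).
Hypothesis mZ : forall n, measurable_fun setT (Z n).
Hypothesis mean : (\int[P]_w ((Z 1%N w)%:R : R)%:E)%E = mu%:E.

Let f := pgf P Z.

Let fE s : 0 <= s <= 1 -> (\int[P]_w (s ^+ Z 1%N w)%:E = (f s)%:E)%E.
Proof. by move=> s01; rewrite /f /pgf fineK// integral_pow_fin. Qed.

Let mpow s : measurable_fun setT (fun w => (s ^+ Z 1%N w : R)%:E).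
Proof. exact/measurable_EFinP/(measurable_natcomp (fun k => s ^+ k : R)). Qed.

Lemma mean_ge0 : 0 <= mu.
Proof. by rewrite -lee_fin -mean; apply: integral_ge0 => w _; rewrite lee_fin. Qed.

Lemma pgf_ub s : 0 <= s <= 1 -> 1 - f s <= mu * (1 - s).
Proof.
move=> s01; have /andP[s0 s1] := s01.
rewrite lerBlDl -lee_fin EFinD -fE// mulrC EFinM -mean.
have u0 : 0 <= 1 - s by rewrite subr_ge0.
have mV : measurable_fun setT (fun w => ((Z 1%N w)%:R : R)%:E).
  exact/measurable_EFinP/(measurable_natcomp (fun k => k%:R : R)).
rewrite -ge0_integralZl//.
rewrite -ge0_integralD//; first last.
- by apply: emeasurable_funM => //; exact: measurable_cst.
- by move=> w _; rewrite mule_ge0 ?lee_fin.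
- by move=> w _; rewrite lee_fin exprn_ge0.
apply: (@le_trans _ _ (\int[P]_(w in setT) 1)%E).
  by rewrite integral_cst//= probability_setT mule1.
apply: ge0_le_integral => //.
- apply: emeasurable_funD => //; apply: emeasurable_funM => //; exact: measurable_cst.
- move=> w _; rewrite -EFinM -EFinD lee_fin.
  move: (Z 1%N w) => k; elim: k => [|k IH]; first by rewrite expr0 mulr0 addr0.
  have := exprn_ge0 k s0; have := exprn_ile1 k s0 s1; rewrite exprS -natr1.
  move: IH; move: (s ^+ k) (k%:R : R) (ler0n R k) => x y y0 h x1 x0; nra.
Qed.

Lemma pgf_monotone s t : 0 <= s -> s <= t -> t <= 1 -> f s <= f t.
Proof.
move=> s0 st t1; rewrite -lee_fin -!fE ?s0 ?t1 ?(le_trans st)// ?(le_trans s0)//.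
apply: ge0_le_integral => //.
- by move=> w _; rewrite lee_fin exprn_ge0.
- by move=> w _; rewrite lee_fin lerXn2r ?nnegrE// (le_trans s0).
Qed.

(** The mean truncated at [K] already exceeds [rho]. For [k < K], Bernoulli's inequality gives
    [1 - (1 - u)^k >= k u / (1 + K u)], and integrating this yields the bound for small [u]. *)
Lemma pgf_lb (rho : R) : 0 < rho -> rho < mu -> exists2 u0, 0 < u0 <= 2^-1 &
  forall u, 0 <= u <= u0 -> rho * u <= 1 - f (1 - u).
Proof.
move=> rho0 rhomu.
pose a y : \bar R := ((y%:R)%:E * P (Z 1%N @^-1` [set y]))%E.
have a0 y : (0 <= a y)%E by rewrite mule_ge0.
have [K HK] : exists K, (rho%:E < \sum_(0 <= y < K) a y)%E.
  apply: contrapT => /forallNP H.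
  have : (mu%:E <= rho%:E)%E; last by rewrite lee_fin leNgt rhomu.
  rewrite -mean (@expectation_nat _ _ _ _ _ (fun k => k%:R : R))//.
  apply: lime_le; first by apply: is_cvg_nneseries => y _ _; exact: a0.
  by apply: nearW => K; rewrite leNgt; apply/negP; exact: H.
pose g (y : nat) : R := if (y < K)%N then y%:R else 0.
have g0 y : 0 <= g y by rewrite /g; case: ifP.
have sumE : (\int[P]_w (g (Z 1%N w))%:E = \sum_(0 <= y < K) a y)%E.
  rewrite (@expectation_nat _ _ _ _ _ g)// (@nneseries_split _ _ 0 K)//; last first.
    by move=> k _; rewrite mule_ge0// lee_fin.
  rewrite add0n [X in (_ + X)%E]eseries0 ?adde0; last first.
    by move=> i Ki _; rewrite /g ltnNge Ki mul0e.
  by apply: eq_big_nat => y /andP[_ yK]; rewrite /g yK.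
have mg : measurable_fun setT (fun w => (g (Z 1%N w))%:E).
  exact/measurable_EFinP/(measurable_natcomp g).
have Sfin : (\sum_(0 <= y < K) a y)%E \is a fin_num.
  rewrite sum_fin_num; apply/allP => _ /mapP[y _ ->].
  by rewrite /a /= fin_numM// fin_num_measure//; exact: measurable_nateq.
set S := fine (\sum_(0 <= y < K) a y)%E.
have SE : (\int[P]_w (g (Z 1%N w))%:E = S%:E)%E by rewrite sumE /S fineK.
have rhoS : rho < S by rewrite -lte_fin /S fineK.
have KR0 : 0 <= K%:R :> R by exact: ler0n.
have den : 0 < rho * K%:R + 1 by rewrite ltr_wpDl// mulr_ge0// ltW.
(* The second term ensures [rho (1 + K u) <= S], its [+ 1] keeping the denominator positive; the
   bound [1/2] serves [1 - u >= e^(-2u)] in [cohort_tail]. *)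
exists (Num.min 2^-1 ((S - rho) / (rho * K%:R + 1))).
  by rewrite lt_min ge_min lexx invr_gt0 ltr0n/= divr_gt0 ?subr_gt0.
move=> u /andP[u0]; rewrite le_min => /andP[u2 uS].
have s01 : 0 <= 1 - u <= 1 by apply/andP; split; lra.
have D0 : 0 < 1 + K%:R * u by rewrite ltr_wpDr// mulr_ge0.
have key : f (1 - u) + u / (1 + K%:R * u) * S <= 1.
  have c0 : 0 <= u / (1 + K%:R * u) by rewrite divr_ge0// ltW.
  rewrite -lee_fin EFinD EFinM -fE// -SE -ge0_integralZl//; last first.
    by move=> w _; rewrite lee_fin.
  rewrite -ge0_integralD//; first last.
  - by apply: emeasurable_funM => //; exact: measurable_cst.
  - by move=> w _; rewrite mule_ge0 ?lee_fin.
  - by move=> w _; rewrite lee_fin; apply: exprn_ge0; case/andP: s01.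
  apply: (@le_trans _ _ (\int[P]_(w in setT) 1)%E); last first.
    by rewrite integral_cst//= probability_setT mule1.
  apply: ge0_le_integral => //.
  - move=> w _; rewrite -EFinM -EFinD lee_fin.
    apply: addr_ge0; last exact: mulr_ge0.
    by apply: exprn_ge0; case/andP: s01.
  - apply: emeasurable_funD => //; apply: emeasurable_funM => //; exact: measurable_cst.
  move=> w _; rewrite -EFinM -EFinD lee_fin; move: (Z 1%N w) => k.
  rewrite /g; case: ifP => kK; last by rewrite mulr0 addr0; case/andP: s01; exact: exprn_ile1.
  (* Bernoulli: [(1-u)^k (1+ku) <= 1]. *)
  have bern : (1 - u) ^+ k * (1 + k%:R * u) <= 1.
    elim: (k) => [|j IH]; first by rewrite expr0 mul0r addr0 mulr1.
    rewrite exprS -natr1; have /andP[s0 _] := s01; have := exprn_ge0 j s0.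
    move: IH; move: (_ ^+ j) (j%:R : R) (ler0n R j) => x y y0 h x0.
    have := mulr_ge0 x0 (mulr_ge0 (addr_ge0 y0 ler01) (mulr_ge0 u0 u0)); lra.
  have k0 : 0 <= k%:R :> R by exact: ler0n.
  have D1 : 0 < 1 + k%:R * u by rewrite ltr_wpDr// mulr_ge0.
  rewrite -lerBrDr; apply: (@le_trans _ _ (1 + k%:R * u)^-1).
    by rewrite -[leRHS]mul1r ler_pdivlMr.
  have -> : (1 + k%:R * u)^-1 = 1 - u / (1 + k%:R * u) * k%:R.
    by field; rewrite gt_eqF.
  rewrite lerD2l lerN2 ler_wpM2r// ler_wpM2l// lef_pV2 ?posrE//.
  by rewrite lerD2l ler_wpM2r// ler_nat ltnW.
apply: le_trans (_ : u / (1 + K%:R * u) * S <= _); last lra.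
rewrite mulrAC ler_pdivlMr// [u * S]mulrC [leLHS]mulrAC ler_wpM2r//.
move: uS u0; rewrite ler_pdivlMr//; clear; lra.
Qed.

Lemma iter_pgf_bounds r s : 0 <= s <= 1 -> 0 <= iter r f s <= 1.
Proof. by move=> s01; elim: r => //= r IH; exact: pgf_bounds. Qed.

Lemma iter_pgf_ub r s : 0 <= s <= 1 -> 1 - iter r f s <= mu ^+ r * (1 - s).
Proof.
move=> s01; elim: r => [|r IH]; first by rewrite /= mul1r.
apply: le_trans (pgf_ub (iter_pgf_bounds r s01)) _.
by rewrite exprS -mulrA ler_wpM2l// mean_ge0.
Qed.

(** [rho^l u] is monotone in [l], so control at both ends [l = 0] and [l = r] keeps every
    intermediate value in the range where the linear bound holds. *)
Lemma iter_pgf_lb (rho u0 u : R) r : 0 < rho -> u0 <= 2^-1 ->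
  (forall u, 0 <= u <= u0 -> rho * u <= 1 - f (1 - u)) ->
  0 <= u -> u <= u0 -> rho ^+ r * u <= u0 ->
  rho ^+ r * u <= 1 - iter r f (1 - u).
Proof.
move=> rho0 u02 H u_ge0 uu0 ru0.
have s01 : 0 <= 1 - u <= 1 by apply/andP; split; lra.
suff : forall l, (l <= r)%N -> rho ^+ l * u <= 1 - iter l f (1 - u) by exact.
have inter l : (l <= r)%N -> rho ^+ l * u <= u0.
  move=> lr; have [r1|r1] := leP rho 1.
    by apply: le_trans uu0; rewrite ler_piMl// exprn_ile1// ltW.
  by apply: le_trans ru0; rewrite ler_wpM2r// ler_weXn2l// ltW.
elim=> [|l IH] lr; first by rewrite /= mul1r; lra.
have /andP[i0 i1] := iter_pgf_bounds l s01.
have rl0 : 0 <= rho ^+ l * u by rewrite mulr_ge0// exprn_ge0// ltW.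
have rl1 := inter l (ltnW lr).
have := H _ (introT andP (conj rl0 rl1)); rewrite exprS -mulrA => /le_trans; apply.
rewrite lerD2l lerN2 /=; apply: pgf_monotone => //; last by lra.
have := IH (ltnW lr); lra.
Qed.

End PgfBounds.

(** * Expectations of products from independence of events *)

Section IndependentProduct.
Context d (Omega : measurableType d) (R : realType).
Variable P : probability Omega R.
Variables (I : eqType) (obj : I -> nat -> Omega -> nat).
Hypothesis mobj : forall i n, measurable_fun setT (obj i n).
Hypothesis indep : mutually_independent P obj.

Lemma sigma_of_process_measurable i A : sigma_of_process (obj i) A -> measurable A.
Proof.
apply: smallest_sub; first exact: sigma_algebra_measurable.
by move=> _ [n [B ->]]; exact: measurable_nateq.
Qed.

(** Independence is given for events. Each factor is split over the values of its variable, and the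
    event fixing that value joins the list [t]; the restriction to an intersection is what lets this
    induction run. *)
Lemma expectation_prod_restr (g : nat -> R) (r : nat) (e : I -> R)
    (s t : seq I) (A : I -> set Omega) :
  (forall y, 0 <= g y) ->
  (forall i, \int[P]_w (g (obj i r w))%:E = (e i)%:E)%E ->
  uniq (s ++ t) ->
  (forall i, i \in t -> sigma_of_process (obj i) (A i)) ->
  (\int[P]_(w in \bigcap_(i in [set` t]) A i) (\prod_(i <- s) g (obj i r w))%:E =
   (\prod_(i <- s) e i)%:E * \prod_(i <- t) P (A i))%E.
Proof.
move=> g0 eE; elim: s t A => [|i s IH] t A; rewrite ?cat0s => ust sA.
  rewrite big_nil mul1e -indep//; transitivity (\int[P]_(w in \bigcap_(i in [set` t]) A i) 1)%E.
    by apply: eq_integral => w _; rewrite big_nil.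
  rewrite integral_cst ?mul1e//.
  by apply: fin_bigcap_measurable => [|i it]; [exact: finite_seq|apply: sigma_of_process_measurable; exact: sA].
have mt : measurable (\bigcap_(i in [set` t]) A i).
  by apply: fin_bigcap_measurable => [|j jt]; [exact: finite_seq|apply: sigma_of_process_measurable; exact: sA].
have mprod : measurable_fun setT (fun w => (\prod_(j <- s) g (obj j r w))%:E).
  apply/measurable_EFinP.
  by apply: measurable_prod => j _; exact: (measurable_natcomp g).
under eq_integral do rewrite big_cons EFinM.
rewrite (@integral_nat_split _ _ _ P _ (obj i r) g (fun w => (\prod_(j <- s) g (obj j r w))%:E))//; last first.
  by move=> w; rewrite lee_fin prodr_ge0.
have ist : i \notin t by move: ust; rewrite /= mem_cat negb_or => /andP[/andP[]].
have ust' : uniq (s ++ i :: t).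
  by rewrite (perm_uniq (permEl (perm_catCA s [:: i] t))).
have utt : uniq t by move: ust; rewrite cat_uniq => /and3P[].
have Cfin : (\prod_(j <- t) P (A j))%E \is a fin_num by rewrite -indep// fin_num_measure.
pose A' y j := if j == i then obj i r @^-1` [set y] else A j.
set B := \prod_(j <- s) e j.
set C := (\prod_(j <- t) P (A j))%E in Cfin *.
have step y : (\int[P]_(w in (\bigcap_(j in [set` t]) A j) `&` obj i r @^-1` [set y])
    (\prod_(j <- s) g (obj j r w))%:E = B%:E * (P (obj i r @^-1` [set y]) * C))%E.
  have -> : (\bigcap_(j in [set` t]) A j) `&` obj i r @^-1` [set y] =
      \bigcap_(j in [set` i :: t]) A' y j.
    apply/seteqP; split=> w /=.
      move=> [h1 h2] j /=; rewrite inE /A'; case: eqP => [->//|_ /= jt]; exact: h1.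
    move=> h; split=> [j jt|].
      have := h j; rewrite /A' /= inE jt orbT; case: eqP => [ji|_]; last exact.
      by move: ist; rewrite -ji jt.
    by have := h i; rewrite /A' /= inE eqxx; exact.
  rewrite (IH (i :: t) (A' y))//; last first.
    move=> j; rewrite inE /A'; case: eqP => [-> _|_ /= jt]; last exact: sA.
    by apply: sub_gen_smallest; exists r, [set y].
  rewrite big_cons /A' eqxx; congr (_ * (_ * _))%E.
  rewrite /C big_seq [RHS]big_seq; apply: eq_bigr => j jt.
  by case: eqP => // ji; move: ist; rewrite -ji jt.
under eq_eseriesr do rewrite step.
rewrite big_cons.
rewrite -(fineK Cfin) EFinM -eE expectation_nat// -muleA muleC -EFinM -nneseriesZl; last first.
  by move=> y _; rewrite mule_ge0// lee_fin.
apply: eq_eseriesr => y _.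
have Pfin : P (obj i r @^-1` [set y]) \is a fin_num by rewrite fin_num_measure//; exact: measurable_nateq.
by rewrite -(fineK Pfin) -!EFinM; congr EFin; rewrite /B; ring.
Qed.

Lemma expectation_prod (g : nat -> R) (r : nat) (e : I -> R) (s : seq I) :
  (forall y, 0 <= g y) ->
  (forall i, \int[P]_w (g (obj i r w))%:E = (e i)%:E)%E -> uniq s ->
  (\int[P]_w (\prod_(i <- s) g (obj i r w))%:E = (\prod_(i <- s) e i)%:E)%E.
Proof.
move=> g0 eE us.
have := @expectation_prod_restr g r e s [::] (fun _ => setT) g0 eE.
by rewrite cats0 big_nil mule1 set_nil bigcap_set0 => /(_ us); exact.
Qed.

End IndependentProduct.

Section MeasurableSums.
Context d (Omega : measurableType d).
Implicit Types f g : Omega -> nat.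

Lemma measurable_nat_bind f (F : nat -> Omega -> nat) :
  measurable_fun setT f -> (forall y, measurable_fun setT (F y)) ->
  measurable_fun setT (fun w => F (f w) w).
Proof.
move=> mf mF _ B _; rewrite setTI.
rewrite (_ : _ @^-1` _ = \bigcup_y (f @^-1` [set y] `&` F y @^-1` B)); last first.
  by apply/seteqP; split=> [w Bw|w [y _ [/= -> //]]]; exists (f w).
by apply: bigcup_measurable => y _; apply: measurableI; exact: measurable_nateq.
Qed.

Lemma measurable_addn f g : measurable_fun setT f -> measurable_fun setT g ->
  measurable_fun setT (fun w => f w + g w)%N.
Proof.
move=> mf mg; apply: (@measurable_nat_bind f (fun y w => y + g w)%N) => // y.
exact: (measurable_natcomp (fun z => y + z)%N).
Qed.

Lemma measurable_sumn n (F : nat -> Omega -> nat) :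
  (forall i, measurable_fun setT (F i)) ->
  measurable_fun setT (fun w => \sum_(i < n) F i w)%N.
Proof.
move=> mF; elim: n => [|n IH].
  by under eq_fun do rewrite big_ord0; exact: measurable_cst.
by under eq_fun do rewrite big_ord_recr; exact: measurable_addn.
Qed.

Lemma measurable_GWI (X : nat -> nat -> nat -> Omega -> nat) (J : nat -> Omega -> nat) m :
  (forall i k n, measurable_fun setT (X i k n)) ->
  (forall k, measurable_fun setT (J k)) -> measurable_fun setT (GWI X J m).
Proof.
move=> mX mJ.
apply: (@measurable_sumn _ (fun k w => \sum_(i < J k w) X i k (m - k) w)%N) => k.
apply: (@measurable_nat_bind (J k) (fun j w => \sum_(i < j) X i k (m - k) w)%N) => // j.
by apply: (@measurable_sumn _ (fun i w => X i k (m - k)%N w)).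
Qed.

End MeasurableSums.

Lemma one_sub_expr_sum (R : realType) (s : R) (T : Type) (r : seq T) (Q : pred T)
    (n : T -> nat) : 0 <= s <= 1 ->
  1 - s ^+ (\sum_(i <- r | Q i) n i) <= \sum_(i <- r | Q i) (1 - s ^+ n i).
Proof.
move=> /andP[s0 s1]; apply: (big_rec2 (fun a b => 1 - s ^+ a <= b)); first by rewrite expr0 subrr.
move=> i a b _ h; rewrite exprD.
have := exprn_ge0 (n i) s0; have := exprn_ile1 (n i) s0 s1.
have := exprn_ge0 a s0; have := exprn_ile1 a s0 s1.
by move: h; move: (s ^+ a) (s ^+ n i) => x y h x1 x0 y1 y0; nra.
Qed.

Section TailBounds.
Context d (Omega : measurableType d) (R : realType).
Variable P : probability Omega R.
Variables (X : nat -> nat -> nat -> Omega -> nat) (J : nat -> Omega -> nat) (mu : R).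
Hypothesis mX : forall i k n, measurable_fun setT (X i k n).
Hypothesis mJ : forall k, measurable_fun setT (J k).
Hypothesis indep : mutually_independent P
    (fun (a : (nat * nat) + nat) => match a with
       | inl ik => X ik.1 ik.2
       | inr k => fun _ => J k end).
Hypothesis lawX : forall i k, same_law P (X i k) (X 0%N 0%N).
Hypothesis gwX : forall i k, is_GW P (X i k).
Hypothesis X0 : forall i k w, X i k 0%N w = 1%N.
Hypothesis mu0 : 0 < mu.
Hypothesis mean : forall i k, (\int[P]_w ((X i k 1%N w)%:R : R)%:E)%E = mu%:E.

Let f := pgf P (X 0 0).

Lemma pgf_same_law i k s : 0 <= s -> pgf P (X i k) s = f s.
Proof.
move=> s0; rewrite /f /pgf; congr fine.
rewrite !(@expectation_nat _ _ _ _ _ (fun y => s ^+ y : R))//; try by move=> y; exact: exprn_ge0.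
apply: eq_eseriesr => y _; congr (_ * _)%E.
have := @lawX i k [set g | g 1%N = y].
by apply; apply: sub_gen_smallest; exists 1%N, [set y].
Qed.

Lemma expectation_pow i k r s : 0 <= s <= 1 ->
  (\int[P]_w (s ^+ X i k r w)%:E = (iter r f s)%:E)%E.
Proof.
move=> s01; have [p gw] := gwX i k.
rewrite (pgf_iter (mX i k) (X0 i k) gw)//; congr EFin.
elim: r => [//|r IH]; rewrite !iterS IH pgf_same_law//.
by have /andP[] := iter_pgf_bounds P (mX 0 0) r s01.
Qed.

(** A Markov-type inequality drawn from generating functions: at [s = 1 - 1/a], a population at
    least [a] gives [s^S <= e^(-1) <= 1/2], while the expectation of [1 - s^S] is at most the sum
    over ancestors of [mu^r / a]. *)
Lemma population_tail (m : nat) (j : nat -> nat) (a : R) : 1 <= a ->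
  (P [set w | (a <= (GWI X (fun k _ => j k) m w)%:R)%R] <=
   (2 * (\sum_(k < m.+1) (j k)%:R * mu ^+ (m - k)) / a)%:E)%E.
Proof.
move=> a1; have a0 : 0 < a by exact: lt_le_trans a1.
set S := GWI X _ m; set A := \sum_(_ < _) _.
have mS : measurable_fun setT S by apply: measurable_GWI => // k; exact: measurable_cst.
pose s := 1 - a^-1.
have s01 : 0 <= s <= 1.
  by rewrite /s gerBl invr_ge0 (ltW a0) subr_ge0 invf_le1// a1.
have /andP[s0 s1] := s01.
set E := [set w | _].
have mE : measurable E by exact: (measurable_nateq (fun y => a <= y%:R) mS).
have half w : E w -> 2^-1 <= 1 - s ^+ S w.
  move=> Ew; suff : s ^+ S w <= 2^-1 by lra.
  have : s ^+ S w <= expR (- 1).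
    apply: (@le_trans _ _ (expR (- a^-1) ^+ S w)).
      by rewrite lerXn2r ?nnegrE ?expR_ge0// /s expR_ge1Dx.
    rewrite -expRM_natl ler_expR mulrN lerN2 ler_pdivlMr// mul1r; exact: Ew.
  move=> /le_trans; apply; rewrite expRN lef_pV2 ?posrE ?expR_gt0//.
  by apply: le_trans (expR_ge1Dx _); lra.
have step1 : ((2^-1)%:E * P E <= \int[P]_w (1 - s ^+ S w)%:E)%E.
  rewrite -[E]setIT -integral_indic// -ge0_integralZl//; last first.
    exact/measurable_EFinP/measurable_indic.
  apply: ge0_le_integral => //.
  - by apply: emeasurable_funM => //; exact/measurable_EFinP/measurable_indic.
  - exact/measurable_EFinP/(measurable_natcomp (fun y => 1 - s ^+ y : R)).
  move=> w _; rewrite -EFinM lee_fin indicE.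
  have [/[!inE] Ew|_] := boolP (w \in E); first by rewrite mulr1 half.
  by rewrite mulr0 subr_ge0 exprn_ile1.
have step2 : (\int[P]_w (1 - s ^+ S w)%:E <=
    \int[P]_w (\sum_(k < m.+1) \sum_(i < j k) (1 - s ^+ X i k (m - k) w))%:E)%E.
  apply: ge0_le_integral => //.
  - by move=> w _; rewrite lee_fin subr_ge0 exprn_ile1.
  - exact/measurable_EFinP/(measurable_natcomp (fun y => 1 - s ^+ y : R)).
  - apply/measurable_EFinP; apply: measurable_sum => k; apply: measurable_sum => i.
    exact: (measurable_natcomp (fun y => 1 - s ^+ y : R)).
  move=> w _; rewrite lee_fin /S /GWI; apply: le_trans (one_sub_expr_sum _ _ _ s01) _.
  by apply: ler_sum => k _; exact: one_sub_expr_sum.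
have step3 : (\int[P]_w (\sum_(k < m.+1) \sum_(i < j k) (1 - s ^+ X i k (m - k) w))%:E =
    (\sum_(k < m.+1) \sum_(i < j k) (1 - iter (m - k) f s))%:E)%E.
  under eq_integral do rewrite -sumEFin.
  rewrite ge0_integral_sum//; first last.
  - by move=> k w _; rewrite lee_fin sumr_ge0// => i _; rewrite subr_ge0 exprn_ile1.
  - move=> k; apply/measurable_EFinP; apply: measurable_sum => i.
    exact: (measurable_natcomp (fun y => 1 - s ^+ y : R)).
  rewrite -sumEFin; apply: eq_bigr => k _.
  under eq_integral do rewrite -sumEFin.
  rewrite ge0_integral_sum//; first last.
  - by move=> i w _; rewrite lee_fin subr_ge0 exprn_ile1.
  - move=> i; apply/measurable_EFinP.
    exact: (measurable_natcomp (fun y => 1 - s ^+ y : R)).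
  rewrite -sumEFin; apply: eq_bigr => i _.
  under eq_integral do rewrite EFinB.
  have mpow : measurable_fun setT (fun w => (s ^+ X i k (m - k) w : R)%:E).
    exact/measurable_EFinP/(measurable_natcomp (fun y => s ^+ y : R)).
  rewrite integralB//; last first.
  - apply/integrableP; split=> //.
    under eq_integral do rewrite gee0_abs ?lee_fin ?exprn_ge0//.
    by rewrite expectation_pow// ltry.
  - exact: finite_measure_integrable_cst.
  by rewrite expectation_pow// integral_cst//= probability_setT mule1.
have final : ((2^-1)%:E * P E <= (A / a)%:E)%E.
  apply: (le_trans step1); apply: (le_trans step2); rewrite step3 lee_fin.
  rewrite /A mulr_suml; apply: ler_sum => k _; rewrite sumr_const card_ord -[leLHS]mulr_natl.
  rewrite -mulrA ler_wpM2l//.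
  have -> : a^-1 = 1 - s by rewrite /s; ring.
  exact: (iter_pgf_ub (mX 0 0) (mean 0 0)).
have Pfin : P E \is a fin_num by exact: fin_num_measure.
move: final; rewrite -(fineK Pfin) -EFinM !lee_fin.
have -> : 2 * A / a = 2 * (A / a) by ring.
lra.
Qed.

(** A Chernoff bound with [s = 1 - u]. The expectation of [s^S] is at most [exp (- j rho^r u)], and
    on the bad event [s^S >= exp (- 2 u S) >= exp (- u j rho^r / 2)]. The factor 4 leaves half of
    the exponent. *)
Lemma cohort_tail (rho : R) : 0 < rho -> rho < mu -> exists2 th : R, 0 < th &
  forall k r j, (P [set w | (4 * (\sum_(i < j) X i k r w)%:R < j%:R * rho ^+ r)%R]
    <= (expR (- (th * (j%:R * Num.min 1 (rho ^+ r)))))%:E)%E.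
Proof.
move=> rho0 rhomu.
have [u0 /andP[u00 u02] Hu] := pgf_lb (mX 0 0) (mean 0 0) rho0 rhomu.
exists (u0 / 2); first by rewrite divr_gt0.
move=> k r j; set S := fun w => (\sum_(i < j) X i k r w)%N.
have rr0 : 0 < rho ^+ r by rewrite exprn_gt0.
(* The largest [u] for which both [u] and [rho^r u] are at most [u0], as [iter_pgf_lb] requires. *)
pose u := u0 * Num.min 1 (rho ^- r).
have um : rho ^+ r * u = u0 * Num.min 1 (rho ^+ r).
  by rewrite /u mulrCA minr_pMr ?ltW// mulr1 divff ?gt_eqF// minC.
have u_ge0 : 0 < u by rewrite mulr_gt0// lt_min ltr01 invr_gt0.
have uu0 : u <= u0 by rewrite ler_piMr ?(ltW u00)// ge_min lexx.
have ru0 : rho ^+ r * u <= u0 by rewrite um ler_piMr ?(ltW u00)// ge_min lexx.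
pose s := 1 - u.
have s01 : 0 <= s <= 1 by rewrite /s; apply/andP; split; lra.
have /andP[s0 s1] := s01.
have mS : measurable_fun setT S by exact: (@measurable_sumn _ _ _ (fun i w => X i k r w)).
set E := [set w | _].
have mE : measurable E by exact: (measurable_nateq (fun y => 4 * y%:R < j%:R * rho ^+ r) mS).
have ES : (\int[P]_w (s ^+ S w)%:E = (iter r f s ^+ j)%:E)%E.
  have us : uniq [seq inl (i, k) : (nat * nat) + nat | i <- index_iota 0 j].
    by rewrite map_inj_uniq ?iota_uniq// => x y [].
  have mobj (i : (nat * nat) + nat) n : measurable_fun setT (match i with
       | inl ik => X ik.1 ik.2 | inr k => fun _ => J k end n) by case: i.
  (* The product formula asks for an expectation at every index of the family, the immigration
     indices included. *)
  have gall (i : (nat * nat) + nat) : exists e : R,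
    (\int[P]_w (s ^+ (match i with
       | inl ik => X ik.1 ik.2 | inr k => fun _ => J k end r w))%:E = e%:E)%E.
    case: i => [[i k']|k'] /=; first by exists (iter r f s); exact: expectation_pow.
    by exists (fine (\int[P]_w (s ^+ J k' w)%:E)%E); rewrite fineK// integral_pow_fin.
  have [e eE] := choice gall.
  have := expectation_prod mobj indep (fun y => exprn_ge0 y s0) eE us.
  have ee i : e (inl (i, k)) = iter r f s.
    by have := eE (inl (i, k)); rewrite /= expectation_pow// => -[].
  under eq_integral do rewrite big_map prodrXr big_mkord /=.
  rewrite /S => ->; rewrite big_map; under eq_bigr do rewrite ee.
  by rewrite big_const_seq count_predT size_iota subn0 iter_mulr_1.
have it01 : 0 <= iter r f s by have /andP[] := iter_pgf_bounds P (mX 0 0) r s01.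
have ub : iter r f s ^+ j <= expR (- (j%:R * (rho ^+ r * u))).
  apply: (@le_trans _ _ (expR (- (rho ^+ r * u)) ^+ j)).
    rewrite lerXn2r ?nnegrE ?expR_ge0//.
    apply: le_trans (expR_ge1Dx _).
    have := iter_pgf_lb (mX 0 0) rho0 u02 Hu (ltW u_ge0) uu0 ru0.
    by rewrite -/f -/s; lra.
  by rewrite -expRM_natl mulrN.
pose b := expR (- (u / 2 * (j%:R * rho ^+ r))).
have low w : E w -> b <= s ^+ S w.
  move=> Ew; apply: (@le_trans _ _ (expR (- (2 * u)) ^+ S w)).
    rewrite -expRM_natl ler_expR mulrN lerN2.
    have : 4 * (S w)%:R <= j%:R * rho ^+ r by exact: ltW.
    by move: (S w)%:R (j%:R * _) => x y xy; nra.
  rewrite lerXn2r ?nnegrE ?expR_ge0// expRN.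
  have h : 1 + 2 * u <= expR (2 * u) by exact: expR_ge1Dx.
  have h0 : 0 < 1 + 2 * u by lra.
  apply: (@le_trans _ _ (1 + 2 * u)^-1); first by rewrite lef_pV2 ?posrE ?expR_gt0.
  rewrite -[X in X <= _]mul1r ler_pdivrMr// /s.
  have h2 : 0 <= u * (1 - 2 * u) by apply: mulr_ge0; [exact: ltW|lra].
  by move: h2; lra.
have b0 : 0 < b by exact: expR_gt0.
have step1 : (b%:E * P E <= \int[P]_w (s ^+ S w)%:E)%E.
  rewrite -[E]setIT -integral_indic// -ge0_integralZl//; last 2 first.
  - exact/measurable_EFinP/measurable_indic.
  - by rewrite lee_fin ltW.
  apply: ge0_le_integral => //.
  - by move=> w _; rewrite mule_ge0 ?lee_fin//; exact: ltW.
  - by apply: emeasurable_funM => //; exact/measurable_EFinP/measurable_indic.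
  - exact/measurable_EFinP/(measurable_natcomp (fun y => s ^+ y : R)).
  move=> w _; rewrite -EFinM lee_fin indicE.
  have [/[!inE] Ew|_] := boolP (w \in E); first by rewrite mulr1 low.
  by rewrite mulr0 exprn_ge0.
have Pfin : P E \is a fin_num by exact: fin_num_measure.
move: step1; rewrite ES -(fineK Pfin) -EFinM !lee_fin => /le_trans/(_ ub).
rewrite mulrC -ler_pdivlMr// => /le_trans; apply.
rewrite /b -expRN -expRD ler_expR.
have -> : u0 / 2 * (j%:R * Num.min 1 (rho ^+ r)) = j%:R * (u0 * Num.min 1 (rho ^+ r)) / 2.
  by ring.
by rewrite -um; lra.
Qed.

End TailBounds.

(** * Almost sure bounds by Borel-Cantelli *)

Section BorelCantelli.
Context d (Omega : measurableType d) (R : realType).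
Variable P : probability Omega R.

Lemma geometric_borel_cantelli (B : nat -> set Omega) (C q : R) :
  (forall n, measurable (B n)) -> 0 <= C -> 0 <= q < 1 ->
  (forall n, P (B n) <= (C * q ^+ n)%:E)%E ->
  {ae P, forall w, \forall n \near \oo, ~ B n w}.
Proof.
move=> mB C0 /andP[q0 q1] HB.
have : P (lim_sup_set B) = 0%E.
  apply: lim_sup_set_cvg0 => //.
  apply: (@le_lt_trans _ _ (C / (1 - q))%:E); last exact: ltry.
  apply: lime_le; first exact: is_cvg_nneseries.
  apply: nearW => n; apply: (@le_trans _ _ (\sum_(0 <= i < n) (C * q ^+ i)%:E)%E).
    by apply: lee_sum => i _; exact: HB.
  rewrite sumEFin lee_fin -mulr_sumr ler_wpM2l//.
  rewrite -[leRHS]mul1r ler_pdivlMr ?subr_gt0//.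
  suff -> : (\sum_(0 <= i < n) q ^+ i) * (1 - q) = 1 - q ^+ n.
    by rewrite gerBl exprn_ge0.
  elim: n => [|n IH]; first by rewrite big_geq// mul0r subrr.
  by rewrite big_nat_recr//= mulrDl IH exprSr; ring.
move=> H; exists (lim_sup_set B); split=> //.
  by apply: bigcapT_measurable => n; apply: bigcup_measurable => k _.
move=> w /= nw n _; apply: contrapT => h; apply: nw.
exists n => // k /= nk Bk; apply: h; by exists k.
Qed.

Lemma measure_fin_bigcup_le (N : nat) (F : nat -> set Omega) (b : R) :
  (forall i, measurable (F i)) -> (forall i, (i < N)%N -> P (F i) <= b%:E)%E ->
  (P (\big[setU/set0]_(i < N) F i) <= (N%:R * b)%:E)%E.
Proof.
move=> mF H; apply: le_trans (Boole_inequality _ _) _ => //.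
apply: (@le_trans _ _ (\sum_(i < N) b%:E)%E).
  by apply: lee_sum => i _; exact: H.
by rewrite sumEFin sumr_const card_ord -[X in (X%:E <= _)%E]mulr_natl.
Qed.

End BorelCantelli.

(** The square pays for the union bound over pairs [(m, k)]; each factor [T n + 1] is absorbed by
    [e^(en/4)], leaving half of the decay. *)
Lemma poly_exp_geometric (R : realType) (e : R) (T : nat) : 0 < e ->
  exists2 D : R, 0 <= D & forall n : nat,
    (T * n).+1%:R ^+ 2 * expR (- (e * n%:R)) <= D * expR (- (e / 2)) ^+ n.
Proof.
move=> e0; pose D' := 1 + 4 * T%:R / e.
have T0 : 0 <= T%:R / e by rewrite divr_ge0// ltW.
have D0 : 0 <= D' by rewrite /D' -mulrA; lra.
exists (D' ^+ 2) => [|n]; first exact: exprn_ge0.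
have h : (T * n).+1%:R <= D' * expR (e / 4 * n%:R).
  apply: (@le_trans _ _ (D' * (1 + e / 4 * n%:R))); last first.
    by rewrite ler_wpM2l// expR_ge1Dx.
  rewrite -natr1 natrM /D'.
  have -> : (1 + 4 * T%:R / e) * (1 + e / 4 * n%:R) =
    T%:R * n%:R + 1 + (4 * (T%:R / e) + e / 4 * n%:R).
    by field; rewrite gt_eqF.
  by rewrite lerDl addr_ge0// mulr_ge0// ?divr_ge0// ltW.
apply: (@le_trans _ _ ((D' * expR (e / 4 * n%:R)) ^+ 2 * expR (- (e * n%:R)))).
  by rewrite ler_wpM2r ?expR_ge0// lerXn2r// ?nnegrE// ?mulr_ge0 ?expR_ge0.
rewrite exprMn -[leLHS]mulrA ler_wpM2l ?exprn_ge0// -!expRM_natl -expRD ler_expR.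
lra.
Qed.

Section AlmostSureGrowth.
Context d (Omega : measurableType d) (R : realType).
Variable P : probability Omega R.
Variables (X : nat -> nat -> nat -> Omega -> nat) (J : nat -> Omega -> nat) (mu : R).
Hypothesis mX : forall i k n, measurable_fun setT (X i k n).
Hypothesis mJ : forall k, measurable_fun setT (J k).
Hypothesis indep : mutually_independent P
    (fun (a : (nat * nat) + nat) => match a with
       | inl ik => X ik.1 ik.2
       | inr k => fun _ => J k end).
Hypothesis lawX : forall i k, same_law P (X i k) (X 0%N 0%N).
Hypothesis gwX : forall i k, is_GW P (X i k).
Hypothesis X0 : forall i k w, X i k 0%N w = 1%N.
Hypothesis mu0 : 0 < mu.
Hypothesis mean : forall i k, (\int[P]_w ((X i k 1%N w)%:R : R)%:E)%E = mu%:E.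
Variable Jn : nat -> nat -> nat.

Let Y w n m := GWI X (fun k _ => Jn n k) m w.

Lemma ae_population_upper :
  {ae P, forall w, population_upper (ln mu) Jn (Y w)}.
Proof.
(* Only countably many precisions [1/(i+1)] can share one null set; other [e] follow because the
   bound weakens as [e] grows. *)
have : {ae P, forall w, forall i T : nat, \forall n \near \oo,
    forall m, (m <= T * n)%N -> (Y w n m)%:R <= expR (i.+1%:R^-1 * n%:R) *
      Num.max 1 (\sum_(k < m.+1) (Jn n k)%:R * mu ^+ (m - k))}.
  apply: ae_foralln => i; apply: ae_foralln => T.
  set e : R := i.+1%:R^-1; have e0 : 0 < e by rewrite invr_gt0.
  have [D D0 HD] := poly_exp_geometric T e0.
  pose A n m := \sum_(k < m.+1) (Jn n k)%:R * mu ^+ (m - k).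
  pose a n m := expR (e * n%:R) * Num.max 1 (A n m).
  pose F n m := [set w | a n m <= (Y w n m)%:R].
  have mF n m : measurable (F n m).
    apply: (@measurable_nateq _ _ (GWI X (fun k _ => Jn n k) m) (fun y => a n m <= y%:R)).
    by apply: measurable_GWI => // k; exact: measurable_cst.
  have A0 n m : 0 <= A n m by apply: sumr_ge0 => k _; rewrite mulr_ge0// exprn_ge0// ltW.
  have max1 n m : 1 <= Num.max 1 (A n m) by rewrite le_max lexx.
  have max0 n m : 0 < Num.max 1 (A n m) by exact: lt_le_trans (max1 n m).
  have a1 n m : 1 <= a n m.
    by apply: mulr_ege1 => //; rewrite -expR0 ler_expR mulr_ge0// ltW.
  have PF n m : (P (F n m) <= (2 * expR (- (e * n%:R)))%:E)%E.
    apply: le_trans (population_tail mX lawX gwX X0 mean m (Jn n) (a1 n m)) _.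
    rewrite lee_fin -/(A n m) -mulrA ler_wpM2l// /a expRN invfM mulrCA.
    rewrite ler_piMr ?invr_ge0 ?expR_ge0// ler_pdivrMr// mul1r le_max lexx orbT.
    by [].
  have : {ae P, forall w, \forall n \near \oo,
      ~ (\big[setU/set0]_(m < (T * n).+1) F n m) w}.
    apply: (@geometric_borel_cantelli _ _ _ P _ (2 * D) (expR (- (e / 2)))).
    - by move=> n; exact: bigsetU_measurable.
    - by rewrite mulr_ge0.
    - by rewrite expR_ge0/= -[X in _ < X]expR0 ltr_expR oppr_lt0 divr_gt0.
    - move=> n; apply: le_trans (measure_fin_bigcup_le (mF n) (fun m _ => PF n m)) _.
      rewrite lee_fin -mulrA; apply: le_trans (_ : 2 * ((T * n).+1%:R ^+ 2 * expR (- (e * n%:R))) <= _).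
        rewrite mulrCA ler_wpM2l// ler_wpM2r ?expR_ge0// expr2 ler_peMr//.
        by rewrite ler1n.
      by rewrite ler_wpM2l.
  apply: filterS => w hw.
  apply: filterS hw => n hn m mT; rewrite leNgt; apply/negP => h; apply: hn.
  rewrite -bigcup_mkord; exists m => /=; [by rewrite ltnS|exact: ltW].
apply: filterS => w Hw e T e0.
have [i ie] : exists i : nat, i.+1%:R^-1 <= e.
  exists (Num.truncn e^-1); rewrite invf_ple ?posrE ?ltr0n//; exact/ltW/truncnS_gt.
apply: filterS (Hw i T) => n hn m mT; apply: le_trans (hn m mT) _.
rewrite lnK ?posrE// ler_wpM2r//; first by rewrite le_max ler01.
by rewrite ler_expR ler_wpM2r.
Qed.

Lemma ae_population_lower :
  {ae P, forall w, population_lower (ln mu) Jn (Y w)}.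
Proof.
have : {ae P, forall w, forall i T : nat, \forall n \near \oo,
    forall m k, (k <= m)%N -> (m <= T * n)%N ->
    expR (i.+1%:R^-1 * n%:R) <= (Jn n k)%:R * Num.min 1 (expR (ln mu - i.+1%:R^-1) ^+ (m - k)) ->
    (Jn n k)%:R * expR (ln mu - i.+1%:R^-1) ^+ (m - k) <= 4 * (Y w n m)%:R}.
  apply: ae_foralln => i; apply: ae_foralln => T.
  set e : R := i.+1%:R^-1; have e0 : 0 < e by rewrite invr_gt0.
  have [D D0 HD] := poly_exp_geometric T e0.
  set rho := expR (ln mu - e).
  have rhomu : rho < mu by rewrite -[X in _ < X](lnK mu0) ltr_expR gtrBl.
  have [th th0 Hth] := cohort_tail mX mJ indep lawX gwX X0 mean (expR_gt0 (ln mu - e)) rhomu.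
  pose G n m k := if expR (e * n%:R) <= (Jn n k)%:R * Num.min 1 (rho ^+ (m - k))
    then [set w | 4 * (\sum_(i < Jn n k) X i k (m - k) w)%:R < (Jn n k)%:R * rho ^+ (m - k)]
    else set0.
  pose F n m := \big[setU/set0]_(k < (T * n).+1) G n m k.
  have mG n m k : measurable (G n m k).
    rewrite /G; case: ifP => // _.
    apply: (@measurable_nateq _ _ (fun w => \sum_(i < Jn n k) X i k (m - k) w)%N
      (fun y => 4 * y%:R < (Jn n k)%:R * rho ^+ (m - k))).
    exact: (@measurable_sumn _ _ _ (fun i w => X i k (m - k)%N w)).
  have mF n m : measurable (F n m) by exact: bigsetU_measurable.
  have PG n m k : (P (G n m k) <= (th^-1 * expR (- (e * n%:R)))%:E)%E.
    rewrite /G; case: ifPn => [c|_]; last first.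
      by rewrite measure0 lee_fin mulr_ge0 ?expR_ge0// invr_ge0 ltW.
    apply: le_trans (Hth k (m - k)%N (Jn n k)) _; rewrite lee_fin.
    set x := _ * Num.min _ _ in c *.
    have x0 : 0 < x by exact: lt_le_trans (expR_gt0 _) c.
    have tx0 : 0 < th * x by exact: mulr_gt0.
    (* The crude bound [exp (- y) <= 1 / y] is enough, since [x >= e^(en)]. *)
    apply: (@le_trans _ _ (th * x)^-1).
      rewrite expRN lef_pV2 ?posrE ?expR_gt0//; apply: le_trans (expR_ge1Dx _); lra.
    by rewrite invfM expRN ler_wpM2l ?invr_ge0 ?(ltW th0)// lef_pV2 ?posrE ?expR_gt0.
  have : {ae P, forall w, \forall n \near \oo,
      ~ (\big[setU/set0]_(m < (T * n).+1) F n m) w}.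
    apply: (@geometric_borel_cantelli _ _ _ P _ (th^-1 * D) (expR (- (e / 2)))).
    - by move=> n; exact: bigsetU_measurable.
    - by rewrite mulr_ge0// invr_ge0 ltW.
    - by rewrite expR_ge0/= -[X in _ < X]expR0 ltr_expR oppr_lt0 divr_gt0.
    - move=> n.
      have PF m : (P (F n m) <= ((T * n).+1%:R * (th^-1 * expR (- (e * n%:R))))%:E)%E.
        exact: (measure_fin_bigcup_le (mG n m) (fun k _ => PG n m k)).
      apply: le_trans (measure_fin_bigcup_le (mF n) (fun m _ => PF m)) _.
      rewrite lee_fin -mulrA.
      have -> : (T * n).+1%:R * ((T * n).+1%:R * (th^-1 * expR (- (e * n%:R)))) =
        th^-1 * ((T * n).+1%:R ^+ 2 * expR (- (e * n%:R))) by ring.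
      by rewrite ler_wpM2l// invr_ge0 ltW.
  apply: filterS => w hw.
  apply: filterS hw => n hn m k km mT c; rewrite leNgt; apply/negP => h; apply: hn.
  rewrite -bigcup_mkord; exists m => /=; first by rewrite ltnS.
  rewrite /F -bigcup_mkord; exists k => /=; first by rewrite ltnS (leq_trans km).
  rewrite /G c /=; apply: le_lt_trans h; rewrite ler_wpM2l// ler_nat.
  rewrite /Y /GWI (bigD1 (Ordinal (km : (k < m.+1)%N)))//=; exact: leq_addr.
apply: filterS => w Hw e T e0.
have [i ie] : exists i : nat, i.+1%:R^-1 <= e.
  exists (Num.truncn e^-1); rewrite invf_ple ?posrE ?ltr0n//; exact/ltW/truncnS_gt.
apply: filterS (Hw i T) => n hn m k km mT c.
have rhole : expR (ln mu - e) ^+ (m - k) <= expR (ln mu - i.+1%:R^-1) ^+ (m - k).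
  by rewrite lerXn2r ?nnegrE ?expR_ge0// ler_expR lerD2l lerN2.
apply: (@le_trans _ _ ((Jn n k)%:R * expR (ln mu - i.+1%:R^-1) ^+ (m - k))).
  by rewrite ler_wpM2l.
apply: hn => //; apply: (@le_trans _ _ (expR (e * n%:R))); first by rewrite ler_expR ler_wpM2r.
apply: le_trans c _; rewrite ler_wpM2l// le_min !ge_min lexx/=.
by rewrite rhole orbT.
Qed.

End AlmostSureGrowth.

(** * Void probabilities of the Poisson points *)

Section VoidProbability.
Context d (Omega : measurableType d) (R : realType).
Variables (P : probability Omega R) (c : R) (tk jk : nat -> Omega -> R).
Hypothesis c0 : 0 < c.
Hypothesis prm : is_PRM P c 1 tk jk.

Let pts w p := (tk p w, jk p w).

Definition frechet (x : R) : R := if x <= 0 then 0 else expR (- (c / x)).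

Lemma measurable_pts_rect p (s1 s2 x1 x2 : R) :
  measurable [set w | rect s1 s2 x1 x2 (pts w p)].
Proof.
have [mt [mj _]] := prm.
rewrite (_ : mkset _ = (tk p @^-1` `[s1, s2[) `&` (jk p @^-1` `]x1, x2])).
  apply: measurableI; rewrite -[X in measurable X]setTI.
    exact: mt.
  exact: mj.
by apply/seteqP; split=> w; rewrite /rect /= !in_itv/=.
Qed.

Lemma count_is0P (p : nat -> R * R) (A : set (R * R)) :
  count_is p A 0 <-> forall k, ~ A (p k).
Proof.
split=> [[s [_ [/size0nil -> h]]] k /h//|h].
by exists [::]; split=> //; split=> // k; split=> // /h.
Qed.

Lemma measurable_count_is (s1 s2 x1 x2 : R) n :
  measurable [set w | count_is (pts w) (rect s1 s2 x1 x2) n].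
Proof.
pose S (s : seq nat) : set Omega := if uniq s && (size s == n) then
  \bigcap_k (if k \in s then [set w | rect s1 s2 x1 x2 (pts w k)]
             else ~` [set w | rect s1 s2 x1 x2 (pts w k)]) else set0.
rewrite (_ : mkset _ = \bigcup_s S s).
  apply: countable_bigcupT_measurable => // s; rewrite /S; case: ifP => // _.
  apply: bigcapT_measurable => k; case: ifP => _.
    exact: measurable_pts_rect.
  by apply: measurableC; exact: measurable_pts_rect.
apply/seteqP; split=> w /=.
  move=> [s [us [ss h]]]; exists s => //; rewrite /S us ss eqxx /= => k _.
  by case: ifPn => [/h//|/negP ks] /= r; apply: ks; apply/h.
move=> [s _]; rewrite /S; case: ifP => // /andP[us /eqP ss] h.
exists s; split=> //; split=> // k; have := h k I.
by case: ifPn => [ks /= r|ks /= r]; split=> //.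
Qed.

Lemma cvg_prod_ord K (f : nat -> nat -> R) (l : nat -> R) :
  (forall i, f i a @[a --> \oo] --> l i) ->
  (\prod_(i < K) f i a) @[a --> \oo] --> \prod_(i < K) l i.
Proof.
move=> h; elim: K => [|K IH].
  by under eq_fun do rewrite big_ord0; rewrite big_ord0; exact: cvg_cst.
by under eq_fun do rewrite big_ord_recr; rewrite big_ord_recr; exact: cvgM.
Qed.

(** A sublevel event of the largest mark, stated as a void event: no supremum has to be formed, even
    on samples where the marks of the slot are unbounded. *)
Definition slot (n k : nat) (x : R) : set Omega :=
  [set w | forall p, Num.truncn (n%:R * tk p w) = k -> n%:R * jk p w <= x].

Lemma cvg_natS2_infty : (a.+2%:R : R) @[a --> \oo] --> +oo.
Proof.
apply/cvgryPge => A; near=> a.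
have : A <= a%:R by near: a; exact: nbhs_infty_ger.
by move/le_trans; apply; rewrite ler_nat -addn2 leq_addr.
Unshelve. all: by end_near. Qed.

Lemma cvg_natS2_inv : (a.+2%:R^-1 : R) @[a --> \oo] --> (0 : R).
Proof. by apply/gtr0_cvgV0; [exact: nearW|exact: cvg_natS2_infty]. Qed.

(** [is_PRM] speaks only of rectangles bounded in both directions with marks away from 0, so marks
    above [x / n] are exhausted by []x/n + 1/(a+2), x/n + (a+2)]]. The shift by 2 keeps the ends
    strictly ordered at [a = 0]. For [x = 0] the mean diverges, in accordance with
    [frechet 0 = 0]. *)
Lemma mean_void (n : nat) (x : R) : (0 < n)%N -> 0 <= x ->
  expR (- (n%:R^-1 * (c / (x / n%:R + a.+2%:R^-1) - c / (x / n%:R + a.+2%:R))))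
    @[a --> \oo] --> frechet x.
Proof.
move=> n0 x0; have nR0 : 0 < n%:R :> R by rewrite ltr0n.
have lim2 y : 0 <= y -> (c / (y + a.+2%:R)) @[a --> \oo] --> (0 : R).
  move=> y0; rewrite -[X in _ --> X](mulr0 c); apply: cvgM; first exact: cvg_cst.
  apply/gtr0_cvgV0; first by apply: nearW => a; rewrite ltr_wpDl.
  apply/cvgryPge => A; have /cvgryPge/(_ A) := cvg_natS2_infty.
  by apply: filterS => a /le_trans; apply; rewrite lerDr.
rewrite /frechet; case: ifPn => [xle|]; last first.
  rewrite -ltNge => xgt.
  have y0 : 0 < x / n%:R by rewrite divr_gt0.
  apply: continuous_cvg; first exact: continuous_expR.
  apply: cvgN.
  have -> : c / x = n%:R^-1 * (c / (x / n%:R + 0) - 0).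
    by rewrite addr0 subr0; field; rewrite !gt_eqF.
  apply: cvgM; first exact: cvg_cst.
  apply: cvgB; last by apply: lim2; exact: ltW.
  apply: cvgM; first exact: cvg_cst.
  apply: cvgV; first by rewrite addr0 gt_eqF.
  by apply: cvgD; [exact: cvg_cst|exact: cvg_natS2_inv].
have {xle} -> : x = 0 by apply/le_anti; rewrite xle x0.
rewrite mul0r; under eq_fun do rewrite !add0r invrK.
apply: (cvg_comp (fun a : nat => n%:R^-1 * (c * a.+2%:R - c / a.+2%:R)) (fun z => expR (- z)) _ (@cvgr_expR R)).
apply/cvgryPge => A.
have /cvgryPge/(_ (n%:R * A / c + 1)) := cvg_natS2_infty.
apply: filterS => a ha.
have h1 : n%:R * A <= c * (a.+2%:R - 1) by rewrite [leRHS]mulrC -ler_pdivrMr// lerBrDr.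
have inv1 : a.+2%:R^-1 <= 1 :> R by rewrite invf_le1// ler1n.
rewrite -(ler_pM2l nR0) mulrA divff ?gt_eqF// mul1r; apply: le_trans h1 _.
by rewrite mulrBr mulr1 lerD2l lerN2 ler_piMr// ltW.
Qed.

(** Distinct slots give disjoint rectangles, hence a product; continuity from above along the
    exhausting rectangles then reaches the slot events, both for measurability and for the
    probability. *)
Lemma slot_void (K : nat) (kap : nat -> nat) (x : nat -> R) (n : nat) :
  (0 < n)%N -> (forall i j, (i < K)%N -> (j < K)%N -> kap i = kap j -> i = j) ->
  (forall i, 0 <= x i) ->
  measurable (\bigcap_(i in [set i | (i < K)%N]) slot n (kap i) (x i)) /\
  P (\bigcap_(i in [set i | (i < K)%N]) slot n (kap i) (x i)) =
    (\prod_(i < K) frechet (x i))%:E.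
Proof.
move=> n0 inj x0; have nR0 : 0 < n%:R :> R by rewrite ltr0n.
have [_ [_ [pos H]]] := prm.
pose s1 i : R := (kap i)%:R / n%:R; pose s2 i : R := (kap i).+1%:R / n%:R.
pose x1 a i : R := x i / n%:R + a.+2%:R^-1.
pose x2 a i : R := x i / n%:R + a.+2%:R.
have slotE (t : R) k : 0 <= t -> (Num.truncn (n%:R * t) = k) <-> (k%:R / n%:R <= t < k.+1%:R / n%:R).
  move=> t0; rewrite ler_pdivrMr// ltr_pdivlMr// [t * _]mulrC.
  rewrite -truncn_eq ?mulr_ge0//; split=> [->|/eqP//]; exact: eqxx.
pose V a := [set w | forall i, (i < K)%N ->
  count_is (pts w) (rect (s1 i) (s2 i) (x1 a i) (x2 a i)) 0].
have mV a : measurable (V a).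
  rewrite (_ : V a = \bigcap_(i in [set i | (i < K)%N])
     [set w | count_is (pts w) (rect (s1 i) (s2 i) (x1 a i) (x2 a i)) 0])//.
  by apply: bigcap_measurableType => i _; exact: measurable_count_is.
have inv_lt a : a.+2%:R^-1 < a.+2%:R :> R.
  by rewrite (@lt_trans _ _ 1)// ?invf_lt1 ?ltr1n.
have meanE a i : mean_rect c 1 (s1 i) (s2 i) (x1 a i) (x2 a i) =
    n%:R^-1 * (c / (x i / n%:R + a.+2%:R^-1) - c / (x i / n%:R + a.+2%:R)).
  have xi : 0 <= x i / n%:R by rewrite divr_ge0.
  have s21 : s2 i - s1 i = n%:R^-1 by rewrite /s1 /s2 -natr1; ring.
  have p1 : 0 <= x1 a i by rewrite addr_ge0 ?invr_ge0.
  have p2 : 0 <= x2 a i by rewrite addr_ge0.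
  by rewrite /mean_rect s21 (powR_inv1 p1) (powR_inv1 p2).
have PV a : P (V a) = (\prod_(i < K) expR (- (n%:R^-1 *
    (c / (x i / n%:R + a.+2%:R^-1) - c / (x i / n%:R + a.+2%:R)))))%:E.
  rewrite (H K s1 s2 (x1 a) (x2 a) (fun=> 0%N)).
  - by congr EFin; apply: eq_bigr => i _; rewrite /Defs.poisson_pmf meanE expr0 fact0 mulr1 divr1.
  - move=> i iK; have xi : 0 <= x i / n%:R by rewrite divr_ge0.
    rewrite /s1 /s2 /x1 /x2 divr_ge0//= ltr_pM2r ?invr_gt0// ltr_nat ltnSn/=.
    by rewrite ltrD2l inv_lt andbT ltr_wpDl ?invr_gt0.
  - move=> i j iK jK ij; rewrite -subset0 => -[t j'] [/= [h1 _] [h2 _]].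
    have t0 : 0 <= t by case/andP: h1 => h1 _; apply: le_trans h1; rewrite divr_ge0.
    by apply: ij; apply: inj => //; rewrite -(slotE t (kap i) t0).2// -(slotE t (kap j) t0).2.
have capV : \bigcap_a V a = \bigcap_(i in [set i | (i < K)%N]) slot n (kap i) (x i).
  apply/seteqP; split=> w /=.
    move=> h i /= iK p pk; rewrite leNgt; apply/negP => hx.
    have [t0 j0] := pos p w.
    have jx : 0 < jk p w - x i / n%:R by rewrite subr_gt0 ltr_pdivrMr// mulrC.
    (* [a + 2] exceeds the mark as well as the inverse of its excess over [x i / n], so the mark
       falls into the [a]-th rectangle. *)
    pose a := Num.truncn (jk p w + (jk p w - x i / n%:R)^-1).
    have a1 : jk p w + (jk p w - x i / n%:R)^-1 < a.+2%:R.
      by apply: lt_trans (truncnS_gt _) _; rewrite ltr_nat.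
    have inv0 : 0 < (jk p w - x i / n%:R)^-1 by rewrite invr_gt0.
    have xn0 : 0 <= x i / n%:R by rewrite divr_ge0.
    have /count_is0P/(_ p) := h a I i iK; apply.
    split; first exact: (slotE _ _ t0).1 pk.
    rewrite /x1 /x2 /=; apply/andP; split; last by lra.
    rewrite -ltrBrDl invf_plt ?posrE//; lra.
  move=> h a _ i iK; apply/count_is0P => p [/= h1 /andP[h2 _]].
  have [t0 j0] := pos p w.
  have := h i iK p ((slotE _ _ t0).2 h1); apply/negP; rewrite -ltNge mulrC -ltr_pdivrMr//.
  by apply: le_lt_trans h2; rewrite lerDl invr_ge0.
have mcap : measurable (\bigcap_a V a) by exact: bigcapT_measurable.
split; first by rewrite -capV.
have noninc : {homo V : m n / (m <= n)%N >-> (n <= m)%O}.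
  move=> a b ab; apply/subsetPset => w h i iK; apply/count_is0P => p [/= h1 /andP[h2 h3]].
  have /count_is0P/(_ p) := h i iK; apply; split=> //; apply/andP; split.
    by apply: le_lt_trans h2; rewrite lerD2l lef_pV2 ?posrE ?ler_nat// !ltnS.
  by apply: le_trans h3 _; rewrite lerD2l ler_nat !ltnS.
have V0fin : (P (V 0%N) < +oo)%E by rewrite (le_lt_trans (probability_le1 _ (mV 0%N)))// ltry.
have := nonincreasing_cvg_mu V0fin mV mcap noninc.
rewrite capV => /cvg_lim <- //.
apply/cvg_lim => //.
rewrite (_ : P \o V = EFin \o (fun a => \prod_(i < K) expR (- (n%:R^-1 *
    (c / (x i / n%:R + a.+2%:R^-1) - c / (x i / n%:R + a.+2%:R)))))); last first.
  by apply/funext => a /=; rewrite PV.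
apply/cvg_EFin; first exact: nearW.
apply: (@cvg_prod_ord K (fun i a => expR (- (n%:R^-1 *
    (c / (x i / n%:R + a.+2%:R^-1) - c / (x i / n%:R + a.+2%:R)))))
  (fun i => frechet (x i))) => i.
exact: mean_void.
Qed.

End VoidProbability.

Lemma pmf_of_cdf d (Omega : measurableType d) (R : realType) (P : probability Omega R)
    (Z : nat -> Omega -> nat) (G : nat -> R) (K : nat) :
  (forall k, measurable_fun setT (Z k)) ->
  (forall v : nat -> nat, P [set w | forall k, (k < K)%N -> (Z k w <= v k)%N] =
     (\prod_(k < K) G (v k))%:E) ->
  forall v : nat -> nat, P [set w | forall k, (k < K)%N -> Z k w = v k] =
     (\prod_(k < K) (G (v k) - if v k is u.+1 then G u else 0))%:E.
Proof.
move=> mZ cdf.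
pose g u := G u - if u is u'.+1 then G u' else 0.
(* Inequalities become equalities one coordinate at a time, by subtracting the event with [v i]
   lowered by one. *)
pose H i (v : nat -> nat) := [set w | forall k, (k < K)%N ->
  if (k < i)%N then Z k w = v k else (Z k w <= v k)%N].
have mH i v : measurable (H i v).
  rewrite (_ : H i v = \bigcap_(k in [set k | (k < K)%N]) Z k @^-1` [set y |
     if (k < i)%N then y = v k else (y <= v k)%N])//.
  by apply: bigcap_measurableType => k _; exact: measurable_nateq.
have PH i v : (i <= K)%N -> P (H i v) =
    (\prod_(k < K) if (k < i)%N then g (v k) else G (v k))%:E.
  elim: i v => [|i IH] v iK; first by rewrite -cdf.
  pose v' k := if k == i then (v i).-1 else v k.
  pose c := \prod_(k < K | k != Ordinal iK) if (k < i)%N then g (v k) else G (v k).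
  have E1 : \prod_(k < K) (if (k < i)%N then g (v k) else G (v k)) = G (v i) * c.
    by rewrite (bigD1 (Ordinal iK))//= ltnn.
  have E2 : \prod_(k < K) (if (k < i.+1)%N then g (v k) else G (v k)) = g (v i) * c.
    rewrite (bigD1 (Ordinal iK))//= ltnSn; congr (_ * _); apply: eq_bigr => k ki.
    have {}ki : (k : nat) != i by apply: contra ki => /eqP ki; apply/eqP/val_inj.
    by rewrite ltnS leq_eqVlt (negbTE ki).
  have E3 : \prod_(k < K) (if (k < i)%N then g (v' k) else G (v' k)) = G (v i).-1 * c.
    rewrite (bigD1 (Ordinal iK))//= ltnn /v' eqxx; congr (_ * _); apply: eq_bigr => k ki.
    have {}ki : (k : nat) != i by apply: contra ki => /eqP ki; apply/eqP/val_inj.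
    by rewrite (negbTE ki).
  rewrite E2 /g; case Evi : (v i) => [|u].
    rewrite subr0; have -> : H i.+1 v = H i v.
      apply/seteqP; split=> w /= h k kK; have := h k kK; rewrite ltnS [(k <= i)%N]leq_eqVlt.
        by case: eqP => [->|_]; rewrite ?ltnn//=; move=> ->.
      by case: eqP => [->|_]; rewrite ?ltnn//=; rewrite Evi leqn0 => /eqP.
    by rewrite IH ?(ltnW iK)// E1 Evi.
  have -> : H i.+1 v = H i v `\` H i v'.
    apply/seteqP; split=> w /=.
      move=> h; split=> [k kK|h'].
        have := h k kK; rewrite ltnS [(k <= i)%N]leq_eqVlt.
        by case: eqP => [->|_]; rewrite ?ltnn//= => ->.
      have := h' i iK; rewrite ltnn /v' eqxx; have := h i iK; rewrite ltnSn => ->.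
      by rewrite Evi ltnn.
    move=> [h h'] k kK; have := h k kK; rewrite ltnS [(k <= i)%N]leq_eqVlt.
    case: eqP => [->|_]; rewrite ?ltnn//= => hi.
    apply/eqP; rewrite eqn_leq hi/= leqNgt; apply/negP => Zi; apply: h' => l lK.
    have := h l lK; rewrite /v'; case: eqP => [->|_]//.
    by rewrite ltnn Evi/= => _; rewrite -ltnS -Evi.
  have sub : H i v' `<=` H i v.
    move=> w h k kK; have := h k kK; rewrite /v'; case: eqP => [->|_]//.
    by rewrite ltnn => /leq_trans; apply; exact: leq_pred.
  have fin : (P (H i v) < +oo)%E by rewrite (le_lt_trans (probability_le1 _ (mH i v)))// ltry.
  have -> : P (H i v `\` H i v') = (P (H i v) - P (H i v'))%E.
    by rewrite measureD//; congr (_ - P _)%E; exact: setIidr.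
  rewrite !IH ?(ltnW iK)// E1 E3 Evi -EFinB.
  by congr EFin; rewrite mulrBl.
move=> v; rewrite (_ : [set w | _] = H K v).
  by rewrite PH//; congr EFin; apply: eq_bigr => k _; rewrite ltn_ord.
by apply/seteqP; split=> w /= h k kK; have := h k kK; rewrite kK.
Qed.

Section GoodSamples.
Context d (Omega : measurableType d) (R : realType).
Variables (P : probability Omega R) (c : R) (tk jk : nat -> Omega -> R).
Hypothesis c0 : 0 < c.
Hypothesis prm : is_PRM P c 1 tk jk.

Lemma slot_void1 n k x : (0 < n)%N -> 0 <= x ->
  measurable (slot tk jk n k x) /\ P (slot tk jk n k x) = (frechet c x)%:E.
Proof.
move=> n0 x0.
have inj i j : (i < 1)%N -> (j < 1)%N -> k = k -> i = j.
  by rewrite !ltnS !leqn0 => /eqP-> /eqP->.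
have := @slot_void _ _ _ P c tk jk c0 prm 1 (fun=> k) (fun=> x) n n0 inj (fun=> x0).
rewrite big_ord1 (_ : \bigcap_(i in _) _ = slot tk jk n k x)//.
apply/seteqP; split=> w /=; first by move=> /(_ 0%N (ltnSn 0)).
by move=> h i _.
Qed.

(** The event of level 0 says that the slot carries no point, since marks are positive, and it has
    probability [frechet 0 = 0]. *)
Lemma ae_dense_times : {ae P, forall w, dense_times (tk ^~ w)}.
Proof.
have [_ [_ [pos _]]] := prm.
have : {ae P, forall w, forall n k : nat, ~ slot tk jk n.+1 k 0 w}.
  apply: ae_foralln => n; apply: ae_foralln => k.
  have [m1 p1] := @slot_void1 n.+1 k 0 isT (lexx 0).
  exists (slot tk jk n.+1 k 0); split=> //; first by apply: (eq_trans p1); rewrite /frechet lexx.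
  by move=> w /= h; apply: contrapT => h'; apply: h.
apply: filterS => w hw a b a0 ab.
(* The mesh is at most half of [b - a], so the slot after the one containing [a] lies inside
   [[a, b)]. *)
pose n := Num.truncn (2 / (b - a)); have N0 : 0 < n.+1%:R :> R by rewrite ltr0n.
have hn : 2 <= n.+1%:R * (b - a).
  by rewrite -ler_pdivrMr ?subr_gt0//; exact/ltW/truncnS_gt.
pose k := (Num.truncn (n.+1%:R * a)).+1.
have /andP[k1 k2] := @truncn_itv R (n.+1%:R * a) (mulr_ge0 (ltW N0) a0).
have := hw n k; rewrite /slot /= => /existsNP[p /not_implyP[pk _]].
have [t0 _] := pos p w.
have /andP[h1 h2] := @truncn_itv R (n.+1%:R * tk p w) (mulr_ge0 (ltW N0) t0).
exists p; rewrite -(ler_pM2l N0) -(ltr_pM2l N0); split.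
  by apply: le_trans h1; rewrite pk; exact: ltW.
apply: lt_le_trans h2 _; rewrite pk /k -natr1 -natr1.
by move: hn k1; rewrite mulrBr; lra.
Qed.

Lemma ae_marks_bounded : {ae P, forall w, forall T : nat, exists x : nat,
  forall p, (Num.truncn (tk p w) < T)%N -> jk p w <= x%:R}.
Proof.
apply: ae_foralln => T.
pose V (x : nat) := \bigcap_(i in [set i | (i < T)%N]) slot tk jk 1 i x.+1%:R.
have VP (x : nat) : measurable (V x) /\ P (V x) = (frechet c x.+1%:R ^+ T)%:E.
  have := @slot_void _ _ _ P c tk jk c0 prm T id (fun=> x.+1%:R) 1 isT
    (fun i j _ _ ij => ij) (fun=> ler0n _ _).
  by rewrite prodr_const card_ord.
have mA : measurable (\bigcap_x ~` V x).
  by apply: bigcapT_measurable => x; apply: measurableC; have [] := VP x.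
exists (\bigcap_x ~` V x); split=> //.
  apply/eqP; rewrite eq_le measure_ge0 andbT; apply/lee_addgt0Pr => e e0; rewrite add0e.
  pose x := Num.truncn (T%:R * c / e); have x0 : 0 < x.+1%:R :> R by rewrite ltr0n.
  apply: (@le_trans _ _ (P (~` V x))).
    apply: le_measure; rewrite ?inE//; first by apply: measurableC; have [] := VP x.
    by move=> w /(_ x I).
  have [mVx PVx] := VP x; rewrite probability_setC// PVx -EFinB lee_fin.
  rewrite /frechet (leNgt x.+1%:R) x0/= -expRM_natl lerBlDr.
  apply: le_trans (_ : e + (1 + T%:R * - (c / x.+1%:R)) <= _); last first.
    by rewrite lerD2l expR_ge1Dx.
  have : T%:R * (c / x.+1%:R) <= e.
    by rewrite mulrA ler_pdivrMr// [e * _]mulrC -ler_pdivrMr//; exact/ltW/truncnS_gt.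
  by rewrite mulrN; move: (T%:R * _) => u; lra.
move=> w /= nex x _ Vx; apply: nex; exists x.+1 => p pT.
have := Vx _ pT p; rewrite !mul1r; exact.
Qed.

(** Finiteness is not part of [is_PRM]; it holds because the Poisson weights sum to one over finite
    counts. *)
Lemma ae_count_finite : {ae P, forall w, forall (T i x : nat), exists n,
  count_is (fun p => (tk p w, jk p w)) (rect 0 T.+1%:R i.+1%:R^-1 x.+2%:R) n}.
Proof.
have [_ [_ [_ H]]] := prm.
apply: ae_foralln => T; apply: ae_foralln => i; apply: ae_foralln => x.
pose C n := [set w | count_is (fun p => (tk p w, jk p w)) (rect 0 T.+1%:R i.+1%:R^-1 x.+2%:R) n].
have mC n : measurable (C n) by exact: (@measurable_count_is _ _ _ _ _ _ _ prm).
set m := mean_rect c 1 0 T.+1%:R i.+1%:R^-1 x.+2%:R.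
have i1 : i.+1%:R^-1 < x.+2%:R :> R.
  apply: (@le_lt_trans _ _ 1); first by rewrite invf_le1 ?ler1n.
  by rewrite ltr1n.
have i0 : 0 < i.+1%:R^-1 :> R by rewrite invr_gt0.
have PC n : P (C n) = (Defs.poisson_pmf m n)%:E.
  have := H 1%N (fun=> 0) (fun=> T.+1%:R) (fun=> i.+1%:R^-1) (fun=> x.+2%:R) (fun=> n).
  rewrite big_ord1 => <-.
  - congr (P _); apply/seteqP; split=> w /=; first by move=> h _ _.
    by move=> /(_ 0%N isT).
  - by move=> _ _; rewrite lexx ltr0n i0 i1.
  - by move=> [|//] [|//].
have m0 : 0 <= m.
  rewrite /m /mean_rect subr0 (powR_inv1 (ltW i0)) (powR_inv1 (ler0n _ _)).
  by rewrite mulr_ge0// subr_ge0 ler_pM2l// lef_pV2 ?posrE// ltW.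
have mU : measurable (\bigcup_n C n) by exact: bigcup_measurable.
have trivC : trivIset setT C.
  apply/trivIsetP => a b _ _ ab; rewrite -subset0 => w [[s [us [ss hs]]] [t [ut [st ht]]]].
  have : perm_eq s t.
    apply: uniq_perm => // k; apply/idP/idP => [/hs|/ht] r; [exact/ht|exact/hs].
  by move=> /perm_size; rewrite ss st => /eqP; rewrite (negbTE ab).
have PU : P (\bigcup_n C n) = 1%E.
  rewrite measure_semi_bigcup//; rewrite (eq_eseriesr (fun n _ => PC n)).
  rewrite (_ : (fun n => _) = EFin \o (fun n => expR (- m) * series (exp_coeff m) n)); last first.
    apply/funext => n /=; rewrite sumEFin /series/= mulr_sumr; congr EFin.
    by apply: eq_bigr => k _; rewrite /Defs.poisson_pmf /exp_coeff /= mulrA.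
  rewrite EFin_lim; last by apply: is_cvgMr; exact: is_cvg_series_exp_coeff.
  rewrite limM; [|exact: is_cvg_cst|exact: is_cvg_series_exp_coeff].
  by rewrite lim_cst// -/(expR m) expRN mulVf// gt_eqF// expR_gt0.
have PN : P (~` \bigcup_n C n) = 0%E by rewrite probability_setC// PU subee.
exists (~` \bigcup_n C n); split; [exact: measurableC|exact: PN|].
move=> w /= nex [n _ Cn]; apply: nex; by exists n.
Qed.

Lemma ae_locally_finite : {ae P, forall w, locally_finite_points (tk ^~ w) (jk ^~ w)}.
Proof.
have [_ [_ [pos _]]] := prm.
apply: filterS2 ae_marks_bounded ae_count_finite => w hb hc T e e0.
pose T' := Num.truncn T.
have [x hx] := hb T'.+2.
pose i := Num.truncn e^-1.
have [n [s [us [ss hs]]]] := hc T'.+1 i x.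
have ie : i.+1%:R^-1 <= e by rewrite invf_ple ?posrE//; exact/ltW/truncnS_gt.
exists s => k kT ek; apply/hs; have [t0 j0] := pos k w.
have TT : T < T'.+1%:R by exact: truncnS_gt.
have kt : (Num.truncn (tk k w) < T'.+2)%N by rewrite ltnS ltnW// ltnS; exact: le_truncn.
split=> /=; first by rewrite t0/= (le_lt_trans kT)// (lt_trans TT)// ltr_nat.
rewrite (le_lt_trans ie ek)/= (le_trans (hx k kt))// ler_nat.
by rewrite ltnW.
Qed.

End GoodSamples.

(** * Coupling immigrants with Poisson points *)

Section Threshold.
Variables (R : realType) (c : R) (G : nat -> R).
Hypothesis c0 : 0 < c.
Hypothesis G0 : forall N, 0 <= G N.
Hypothesis G1 : forall N, G N < 1.
Hypothesis Gmono : forall M N, (M <= N)%N -> G M <= G N.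
Hypothesis tail : (ln N%:R * (1 - G N)) @[N --> \oo] --> c.

(* The [G N]-quantile of the Frechet law [frechet c]; for [G N = 0] the
   conventions [ln 0 = 0] and [c / 0 = 0] give the right value [0]. *)
Definition threshold (N : nat) : R := c / - ln (G N).

Lemma ln_le_sub1 (x : R) : 0 < x -> ln x <= x - 1.
Proof. by move=> x0; rewrite -ler_expR lnK//; have := expR_ge1Dx (x - 1); lra. Qed.

Lemma threshold_ge0 N : 0 <= threshold N.
Proof.
apply: divr_ge0; first exact: ltW.
by rewrite oppr_ge0 ln_le0// ltW.
Qed.

Lemma neg_ln_gt0 N : 0 < G N -> 0 < - ln (G N).
Proof. by move=> h; rewrite oppr_gt0 ln_lt0// h G1. Qed.

Lemma frechet_threshold N : frechet c (threshold N) = G N.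
Proof.
have := G0 N; rewrite le_eqVlt => /orP[/eqP E|h].
  by rewrite /frechet /threshold -E ln0// oppr0 invr0 mulr0 lexx.
have l0 := neg_ln_gt0 h.
rewrite /frechet leNgt divr_gt0//= /threshold invfM invrK mulrA divff ?gt_eqF//.
by rewrite mul1r opprK lnK.
Qed.

Lemma threshold_mono M N : (M <= N)%N -> threshold M <= threshold N.
Proof.
move=> MN; have := G0 M; rewrite le_eqVlt => /orP[/eqP E|h].
  by rewrite {1}/threshold -E ln0// oppr0 invr0 mulr0 threshold_ge0.
have h' : 0 < G N by exact: lt_le_trans (Gmono MN).
rewrite /threshold ler_pM2l// lef_pV2 ?posrE ?neg_ln_gt0//.
by rewrite lerN2 ler_ln ?posrE// Gmono.
Qed.

Lemma ln_nat_ge0 (N : nat) : 0 <= ln (N%:R : R).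
Proof. by case: N => [|N]; [rewrite ln0|rewrite ln_ge0// ler1n]. Qed.

(** From [- ln G >= 1 - G] the threshold is at most [c / (1 - G)], which the tail assumption
    compares with [ln N]. Monotonicity lets [C] cover the finitely many small [N]. *)
Lemma threshold_upper (e : R) : 0 < e -> exists C : R,
  forall N, threshold N <= (1 + e) * ln N%:R + C.
Proof.
move=> e0.
have ce : c / (1 + e) < c.
  by rewrite ltr_pdivrMr ?addr_gt0// mulrDr mulr1 ltrDl mulr_gt0.
have [N0 _ HN0] : \forall N \near \oo, c / (1 + e) <= ln N%:R * (1 - G N).
  by apply: (cvgr_ge _ tail).
exists (threshold N0) => N.
have [NN|NN] := leqP N0 N; last first.
  apply: le_trans (threshold_mono (ltnW NN)) _.
  by rewrite lerDr mulr_ge0 ?ln_nat_ge0// addr_ge0// ltW.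
rewrite -[leLHS]addr0 lerD ?threshold_ge0//.
have := G0 N; rewrite le_eqVlt => /orP[/eqP E|h].
  rewrite /threshold -E ln0// oppr0 invr0 mulr0 mulr_ge0 ?ln_nat_ge0//; lra.
rewrite /threshold ler_pdivrMr ?neg_ln_gt0//.
have := HN0 N NN; rewrite /= ler_pdivrMr ?addr_gt0// => /le_trans; apply.
rewrite mulrC mulrA ler_wpM2l ?mulr_ge0 ?ln_nat_ge0//; first lra.
by rewrite lerNr opprB ln_le_sub1.
Qed.

(** From [- ln G <= (1 - G) / G] the threshold is at least [c / (1 - G) - c]. The index [N.-1] is
    the level that the largest mark exceeds when the immigration equals [N]. *)
Lemma threshold_lower (e : R) : 0 < e -> e < 1 -> exists C : R,
  forall N, (1 < N)%N -> (1 - e) * ln N%:R <= threshold N.-1 + C.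
Proof.
move=> e0 e1; have s0 : 0 < 1 - e by rewrite subr_gt0.
have ce : c < c / (1 - e).
  by rewrite ltr_pdivlMr// mulrBr mulr1 gtrBl mulr_gt0.
have [M1 _ HM1] : \forall N \near \oo, ln N%:R * (1 - G N) <= c / (1 - e).
  by apply: (cvgr_le _ tail).
(* Once [ln M >= A], the tail bound forces [1 - G M <= 1/2], hence [G M > 0]. *)
pose A := 2 * (c / (1 - e)) + 1.
have A0 : 0 < A by rewrite addr_gt0// mulr_gt0// divr_gt0.
pose M0 := maxn M1 (Num.truncn (expR A)).+1.
have big M : (M0 <= M)%N -> A <= ln M%:R /\ ln M%:R * (1 - G M) <= c / (1 - e).
  rewrite geq_max => /andP[h1 h2]; split; last exact: HM1.
  rewrite -[A]expRK ler_ln ?posrE ?expR_gt0 ?ltr0n//; last exact: leq_trans h2.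
  by apply/ltW/(lt_le_trans (truncnS_gt _)); rewrite ler_nat.
(* [c] is lost in the bound on [threshold], 1 in [ln (M + 1) <= ln M + 1], and the last term covers
   small [M]. *)
exists (c + 1 + ln M0.+1%:R) => -[//|M]; rewrite ltnS /= => Mpos.
have MR0 : 0 < M%:R :> R by rewrite ltr0n.
have [h|h] := leqP M0 M; last first.
  have : ln M.+1%:R <= ln M0.+1%:R :> R by rewrite ler_ln ?posrE// ler_nat ltnW.
  have := threshold_ge0 M; have := ln_nat_ge0 M.+1.
  have : 0 <= e * ln M.+1%:R by rewrite mulr_ge0 ?ln_nat_ge0// ltW.
  by move: (ln M.+1%:R) (ln M0.+1%:R) (threshold M) => a b t; have := c0; lra.
have [lA lq] := big M h.
have l0 : 0 < ln M%:R :> R by exact: lt_le_trans lA.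
have q0 : 0 < 1 - G M by rewrite subr_gt0.
have q2 : 1 - G M <= 2^-1.
  rewrite leNgt; apply/negP => hq.
  have : ln M%:R * 2^-1 <= ln M%:R * (1 - G M) by rewrite ler_wpM2l ?(ltW l0)// ltW.
  by move: lA lq; rewrite /A; move: (c / (1 - e)) => D; lra.
have g0 : 0 < G M by lra.
have nl0 := neg_ln_gt0 g0.
have th : (1 - e) * ln M%:R - c <= threshold M.
  have nl : - ln (G M) <= (1 - G M) / G M.
    rewrite -lnV ?posrE//; apply: le_trans (ln_le_sub1 _) _; first by rewrite invr_gt0.
    by rewrite mulrBl mul1r divff ?gt_eqF.
  rewrite /threshold ler_pdivlMr//.
  have [neg|pos] := leP ((1 - e) * ln M%:R - c) 0.
    by apply: le_trans (ltW c0); rewrite mulr_le0_ge0// ltW.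
  apply: (@le_trans _ _ (((1 - e) * ln M%:R - c) * ((1 - G M) / G M))).
    by rewrite ler_wpM2l// ltW.
  rewrite mulrA ler_pdivrMr// mulrBl.
  have : (1 - e) * ln M%:R * (1 - G M) <= c.
    by rewrite -mulrA mulrC -ler_pdivlMr.
  by lra.
have lM : ln M.+1%:R <= ln M%:R + 1 :> R.
  have -> : M.+1%:R = M%:R * (M.+1%:R / M%:R) :> R by field; rewrite gt_eqF.
  rewrite lnM ?posrE ?divr_gt0// lerD2l.
  apply: le_trans (ln_le_sub1 _) _; first by rewrite divr_gt0.
  have : M.+1%:R / M%:R <= 2 :> R.
    by rewrite ler_pdivrMr// -natrM ler_nat mul2n -addnn -addn1 leq_add2l.
  by lra.
have : (1 - e) * ln M.+1%:R <= (1 - e) * (ln M%:R + 1) by rewrite ler_wpM2l// ltW.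
have := ln_nat_ge0 M0.+1; rewrite mulrDr mulr1; lra.
Qed.

Lemma threshold_unbounded (x : R) : exists N, x <= threshold N.
Proof.
have h0 : 0 < 2^-1 :> R by rewrite invr_gt0.
have h1 : 2^-1 < 1 :> R by rewrite invf_lt1 ?ltr1n.
have [C HC] := threshold_lower h0 h1.
pose y := 2 * (`|x| + `|C|).
pose N := (Num.truncn (expR y)).+1; exists N.
have N0 : (0 < N)%N by [].
have lN : y <= ln N.+1%:R.
  rewrite -[y]expRK ler_ln ?posrE ?expR_gt0//.
  by apply/ltW/(lt_le_trans (truncnS_gt _)); rewrite ler_nat.
have := HC N.+1 (N0 : (1 < N.+1)%N); rewrite /=.
have := ler_norm x; have := ler_norm C; rewrite /y in lN; lra.
Qed.

End Threshold.

Section FirstHit.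
Implicit Types A : nat -> Prop.

Definition first_hit A : nat :=
  if pselect (exists N, `[< A N >]) is left e then ex_minn e else 0%N.

Lemma first_hitP A N : (forall M M', (M <= M')%N -> A M -> A M') -> (exists M, A M) ->
  (first_hit A <= N)%N <-> A N.
Proof.
move=> mono [M AM]; rewrite /first_hit; case: pselect => [e|ne]; last by case: ne; exists M; exact/asboolP.
case: ex_minnP => m /asboolP Am min; split=> [mN|AN]; first exact: mono Am.
by apply: min; exact/asboolP.
Qed.

Lemma first_hit_eq A N : first_hit A = N <->
  (A N /\ forall M, (M < N)%N -> ~ A M) \/ (N = 0%N /\ forall M, ~ A M).
Proof.
rewrite /first_hit; case: pselect => [e|ne].
  case: ex_minnP => m /asboolP Am min; split=> [<-|[[AN h]|[_ h]]]; last by case: (h m).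
    by left; split=> // M Mm /asboolP /min; rewrite leqNgt Mm.
  apply/eqP; rewrite eqn_leq min ?asboolT//= leqNgt; apply/negP => /h; exact.
split=> [<-|[[AN _]|[-> //]]]; last by case: ne; exists N; exact/asboolP.
by right; split=> // M AM; apply: ne; exists M; exact/asboolP.
Qed.

End FirstHit.

Section Coupling.
Context d (Omega : measurableType d) (R : realType).
Variables (P : probability Omega R) (c : R) (tk jk : nat -> Omega -> R) (G : nat -> R).
Hypothesis c0 : 0 < c.
Hypothesis prm : is_PRM P c 1 tk jk.
Hypothesis G0 : forall N, 0 <= G N.
Hypothesis G1 : forall N, G N < 1.
Hypothesis Gmono : forall M N, (M <= N)%N -> G M <= G N.
Hypothesis tail : (ln N%:R * (1 - G N)) @[N --> \oo] --> c.

(* [immigrants n k] is the quantile transform of [n] times the largest mark of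
   the time slot [k/n, (k+1)/n). *)
Definition immigrants (n k : nat) (w : Omega) : nat :=
  first_hit (fun N => slot tk jk n k (threshold c G N) w).

Let slot_mono n k w M N : (M <= N)%N ->
  slot tk jk n k (threshold c G M) w -> slot tk jk n k (threshold c G N) w.
Proof. by move=> MN h p pk; apply: le_trans (h p pk) _; exact: threshold_mono. Qed.

Lemma measurable_immigrants n k : (0 < n)%N -> measurable_fun setT (immigrants n k).
Proof.
move=> n0; pose S N := slot tk jk n k (threshold c G N).
have mS N : measurable (S N).
  by have [] := @slot_void1 _ _ _ _ _ _ _ c0 prm n k (threshold c G N) n0 (threshold_ge0 c0 G1 N).
have mN N : measurable (immigrants n k @^-1` [set N]).
  rewrite (_ : _ @^-1` _ = (S N `&` \bigcap_(M in [set M | (M < N)%N]) ~` S M) `|`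
     (if N == 0%N then \bigcap_M ~` S M else set0)); last first.
    apply/seteqP; split=> w /=.
      move=> /first_hit_eq [[SN h]|[-> h]]; first by left; split.
      by right=> M _; exact: h.
    move=> [[SN h]|h]; apply/first_hit_eq; first by left; split=> // M MN; exact: h.
    by case: eqP h => // N0 h; right; split=> // M; exact: h.
  apply: measurableU.
    apply: measurableI => //; apply: bigcap_measurableType => M _; exact: measurableC.
  by case: ifP => // _; apply: bigcapT_measurable => M; exact: measurableC.
move=> _ B _; rewrite setTI (_ : _ @^-1` B = \bigcup_(N in B) immigrants n k @^-1` [set N]).
  by apply: bigcup_measurable => N _; exact: mN.
apply/seteqP; split=> w /=; first by exists (immigrants n k w).
by move=> [N BN EN]; rewrite EN.
Qed.

Lemma slot_threshold_exists n k w : (0 < n)%N -> (forall p, 0 <= tk p w) ->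
  locally_finite_points (tk ^~ w) (jk ^~ w) ->
  exists N, slot tk jk n k (threshold c G N) w.
Proof.
move=> n0 t0 fin; have [B B0 HB] := marks_bounded fin k.+1%:R.
have [N HN] := threshold_unbounded c0 G1 tail (n%:R * B).
exists N => p pk; apply: le_trans HN; rewrite ler_wpM2l//; apply: HB.
have /andP[_ h] := @truncn_itv R (n%:R * tk p w) (mulr_ge0 (ler0n _ _) (t0 p)).
rewrite pk in h; apply: le_trans (ltW h); rewrite ler_peMl//.
by rewrite ler1n.
Qed.

(** Off the null set of samples that are not locally finite some threshold is hit, and then being at
    most [v k] is exactly a slot event; on the null set the default value 0 of [first_hit] would
    break this. *)
Lemma immigrants_cdf n K (v : nat -> nat) : (0 < n)%N ->
  P [set w | forall k, (k < K)%N -> (immigrants n k w <= v k)%N] =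
  (\prod_(k < K) G (v k))%:E.
Proof.
move=> n0; have [_ [_ [pos _]]] := prm.
have [mS PS] := @slot_void _ _ _ P c tk jk c0 prm K id (fun k => threshold c G (v k)) n n0
  (fun i j _ _ ij => ij) (fun k => threshold_ge0 c0 G1 (v k)).
under [in RHS]eq_bigr do rewrite -(frechet_threshold c0 G0 G1).
rewrite -PS.
set A := mkset _; set B := \bigcap_(i in _) _ in mS *.
have mA : measurable A.
  rewrite (_ : A = \bigcap_(k in [set k | (k < K)%N])
     immigrants n k @^-1` [set y | (y <= v k)%N])//.
  apply: bigcap_measurableType => k _; apply: measurable_nateq; exact: measurable_immigrants.
have [N [mN N0 sN]] := ae_locally_finite c0 prm.
have AB w : ~ N w -> A w <-> B w.
  move=> Nw; have fin : locally_finite_points (tk ^~ w) (jk ^~ w).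
    by apply: contrapT => h; apply: Nw; exact: sN.
  have ex k := slot_threshold_exists k n0 (fun p => (pos p w).1) fin.
  split=> [h k kK|h k kK].
    by apply/(first_hitP _ (@slot_mono n k w) (ex k)); exact: h.
  by apply/(first_hitP _ (@slot_mono n k w) (ex k)); exact: h.
have le C D : measurable C -> measurable D -> (forall w, ~ N w -> C w -> D w) -> (P C <= P D)%E.
  move=> mC mD CD; apply: (@le_trans _ _ (P (D `|` N))).
    apply: le_measure; rewrite ?inE//; first exact: measurableU.
    by move=> w Cw; have [Nw|Nw] := pselect (N w); [right|left; exact: CD].
  have PN : P N = 0%E by exact: N0.
  by rewrite -[leRHS]adde0 -PN; exact: measureU2.
apply/eqP; rewrite eq_le; apply/andP; split; apply: le => // w Nw; first by move/(AB w Nw).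
by move=> h; apply/(AB w Nw).
Qed.

Lemma immigrants_pmf n K (v : nat -> nat) : (0 < n)%N ->
  P [set w | forall k, (k < K)%N -> immigrants n k w = v k] =
  (\prod_(k < K) (G (v k) - if v k is u.+1 then G u else 0))%:E.
Proof.
move=> n0; apply: pmf_of_cdf => [k|u]; first exact: measurable_immigrants.
exact: immigrants_cdf.
Qed.

(** Minimality of the first hit: all marks of the slot lie below the threshold at the immigration
    number, and some mark lies above the preceding threshold. *)
Lemma immigrants_marks w : (forall p, 0 <= tk p w) ->
  locally_finite_points (tk ^~ w) (jk ^~ w) ->
  marks_below_immigration (tk ^~ w) (jk ^~ w) (fun n k => immigrants n k w) /\
  immigration_below_marks (tk ^~ w) (jk ^~ w) (fun n k => immigrants n k w).
Proof.
move=> t0 fin; split=> [e e0|e e0 e1].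
  have [C HC] := threshold_upper c0 G0 G1 Gmono tail e0.
  exists C => n p n0; set k := Num.truncn _.
  have ex := slot_threshold_exists k n0 t0 fin.
  have := (first_hitP (immigrants n k w) (@slot_mono n k w) ex).1 (leqnn _).
  by move=> /(_ p erefl) /le_trans; apply; exact: HC.
have [C HC] := threshold_lower c0 G1 tail e0 e1.
exists C => n i n0 J1; have ex := slot_threshold_exists i n0 t0 fin.
have : ~ slot tk jk n i (threshold c G (immigrants n i w).-1) w.
  move=> /(first_hitP _ (@slot_mono n i w) ex).
  by rewrite -/(immigrants n i w) leqNgt; case: (immigrants n i w) J1 => // m _ /=; rewrite ltnSn.
move=> /existsNP[p /not_implyP[pk /negP]]; rewrite -ltNge => h.
exists p => //; apply: le_trans (HC _ J1) _; rewrite lerD2r; exact: ltW.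
Qed.

End Coupling.

(** * Laws of the driving variables *)

Section NullRestriction.
Context d (T : measurableType d) (R : realType).
Variable mu : {measure set T -> \bar R}.
Import HBNNSimple.

(** Meant for [F] of the limit process, measurable only off [N]; hence the argument on simple
    functions, multiplied by the indicator of the complement. *)
Lemma ge0_integral_null_restrict (f : T -> \bar R) (N : set T) :
  measurable N -> mu N = 0%E -> (forall x, 0 <= f x)%E ->
  (\int[mu]_x f x = \int[mu]_(x in ~` N) f x)%E.
Proof.
move=> mN N0 f0.
rewrite ge0_integralTE// ge0_integralE//.
apply/eqP; rewrite eq_le; apply/andP; split.
  apply/ge_ereal_sup => /= _ [h /= hf <-].
  have mNC : measurable (~` N) by exact: measurableC.
  have -> : sintegral mu h = sintegral mu (proj_nnsfun h mNC).
    rewrite -!integralT_nnsfun.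
    rewrite (@ge0_negligible_integral _ _ _ mu setT N)//; last first.
    - by move=> x _; rewrite lee_fin.
    - exact/measurable_EFinP.
    rewrite setTD integral_mkcond; apply: eq_integral => x _.
    by rewrite patchE /=; rewrite mindicE; case: ifPn => xN; rewrite ?mulr1 ?mulr0.
  apply: ereal_sup_ubound => /=; exists (proj_nnsfun h mNC) => // x /=.
  rewrite patchE mindicE; case: ifPn => xN; rewrite ?mulr1 ?mulr0//.
apply/ge_ereal_sup => /= _ [h /= hf <-].
apply: ereal_sup_ubound => /=; exists h => // x.
apply: le_trans (hf x) _; rewrite patchE; case: ifP => // _; exact: f0.
Qed.

End NullRestriction.

Section BoundedIntegral.
Context d (T : measurableType d) (R : realType) (P : probability T R).
Import HBNNSimple.

Lemma ge0_integral_le_cst (f : T -> \bar R) (M : R) :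
  (forall x, 0 <= f x)%E -> (forall x, f x <= M%:E)%E -> (\int[P]_x f x <= M%:E)%E.
Proof.
move=> f0 fM; rewrite ge0_integralTE//; apply/ge_ereal_sup => /= _ [h /= hf <-].
rewrite -integralT_nnsfun; apply: (@le_trans _ _ (\int[P]_(x in setT) (cst M%:E) x)%E).
  apply: ge0_le_integral => //; first by move=> x _; rewrite lee_fin.
    exact/measurable_EFinP.
  by move=> x _; exact: le_trans (hf x) (fM x).
by rewrite integral_cst//= probability_setT mule1.
Qed.

End BoundedIntegral.

(** * Countable-coordinate state space and measurability of path functionals *)

Section StateSpace.

(* In a state [(j, x)], [j k] stands for [J_k] and [x i k l] for [X_{i,k}(l)]. *)
Definition state : Type := ((nat -> nat) * (nat -> nat -> nat -> nat))%type.

Definition cylinder (K : nat) (t : state) : set state := [set s |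
  (forall k, (k < K)%N -> s.1 k = t.1 k) /\
  (forall i k l, (i < K)%N -> (k < K)%N -> (l < K)%N -> s.2 i k l = t.2 i k l)].

Definition cylinders : set (set state) :=
  [set A | A = set0 \/ exists K t, A = cylinder K t].

Definition state_space := g_sigma_algebraType cylinders.

Lemma cylinder_nested K K' t t' : (K <= K')%N ->
  cylinder K t `&` cylinder K' t' = set0 \/ cylinder K t `&` cylinder K' t' = cylinder K' t'.
Proof.
move=> KK'; have [[s [h1 h2]]|no] := pselect (exists s, (cylinder K t `&` cylinder K' t') s).
  right; apply/seteqP; split=> [r [_ //]|r hr]; split=> //.
  case: h1 h2 hr => [a1 a2] [b1 b2] [c1 c2]; split=> [k kK|i k l iK kK lK].
    by rewrite -a1// b1 ?c1// (leq_trans _ KK').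
  by rewrite -a2// b2 ?c2// (leq_trans _ KK').
by left; rewrite -subset0 => s hs; apply: no; exists s.
Qed.

Lemma cylinders_setI : setI_closed cylinders.
Proof.
move=> _ _ [->|[K [t ->]]] [->|[K' [t' ->]]]; rewrite ?set0I ?setI0; try by left.
have [KK|/ltnW KK] := leqP K K'.
  by have [->|->] := cylinder_nested t t' KK; [left|right; exists K', t'].
by rewrite setIC; have [->|->] := cylinder_nested t' t KK; [left|right; exists K, t].
Qed.

Lemma cylinder0 t : cylinder 0 t = setT.
Proof. by apply/seteqP; split=> // s _; split=> [k|i k l]. Qed.

Lemma measurable_cylinder K t : measurable (cylinder K t : set state_space).
Proof. by apply: sub_sigma_algebra; right; exists K, t. Qed.

Definition gwi (s : state) (m : nat) : nat :=
  (\sum_(k < m.+1) \sum_(i < s.1 k) s.2 i k (m - k))%N.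

Definition truncate K (s : state) : state :=
  (fun k => if (k < K)%N then s.1 k else 0%N,
   fun i k l => if [&& (i < K), (k < K) & (l < K)]%N then s.2 i k l else 0%N).

Lemma gwi_truncate (s : state) (M : nat) :
  \forall K \near \oo, forall m, (m < M)%N -> gwi (truncate K s) m = gwi s m.
Proof.
exists (M + \max_(k < M) s.1 k)%N => // K /= hK m mM.
have MK : (M <= K)%N by exact: leq_trans (leq_addr _ _) hK.
apply: eq_bigr => k _; have kM : (k < M)%N by exact: leq_trans (ltn_ord k) mM.
rewrite /= (leq_trans kM MK); apply: eq_bigr => i _ /=.
have iK : (i < K)%N.
  apply: leq_trans (ltn_ord i) _; apply: leq_trans hK; apply: leq_trans (leq_addl _ _).
  exact: (leq_bigmax (Ordinal kM)).
rewrite iK /= (leq_ltn_trans (leq_subr _ _))//.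
exact: leq_trans mM MK.
Qed.

Variable R : realType.

(** Truncated states form a countable set, so every function of them is measurable: its preimages
    are countable unions of cylinders. *)
Lemma measurable_truncate K (g : state -> R) :
  measurable_fun setT ((fun s => g (truncate K s)) : state_space -> R).
Proof.
pose I := ({ffun 'I_K -> nat} * {ffun 'I_K * 'I_K * 'I_K -> nat})%type.
pose emb (q : I) : state :=
  (fun k => if insub k is Some k' then q.1 k' else 0%N,
   fun i k l => if (insub i, insub k, insub l) is (Some i', Some k', Some l')
                then q.2 (i', k', l') else 0%N).
pose proj (s : state) : I :=
  ([ffun k : 'I_K => s.1 k], [ffun q : 'I_K * 'I_K * 'I_K => s.2 q.1.1 q.1.2 q.2]).
have emb_proj s : cylinder K (emb (proj s)) s.
  split=> [k kK|i k l iK kK lK] /=; first by rewrite insubT ffunE.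
  by rewrite !insubT ffunE.
have trunc_eq s t : cylinder K t s -> truncate K s = truncate K t.
  move=> [h1 h2]; congr pair; first by apply/funext => k; case: ifP => // /h1.
  apply/funext => i; apply/funext => k; apply/funext => l.
  by case: ifP => // /and3P[iK kK lK]; exact: h2.
move=> _ B _; rewrite setTI.
rewrite (_ : _ @^-1` B = \bigcup_(q : I)
   (if `[< B (g (truncate K (emb q))) >] then cylinder K (emb q) else set0)); last first.
  apply/seteqP; split=> s /=.
    move=> Bs; exists (proj s) => //; rewrite asboolT//.
    by rewrite -(trunc_eq _ _ (emb_proj s)).
  by move=> [q _]; case: ifP => // /asboolP Bq cs; rewrite (trunc_eq _ _ cs).
apply: countable_bigcupT_measurable => [|q]; first exact: countableP.
by case: ifP => _; [exact: measurable_cylinder|exact: measurable0].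
Qed.

Definition path_functional (F : (R -> R) -> R) (n : nat) (s : state) : R :=
  F (step_path n (gwi s)).

Lemma measurable_path_functional F n : J1_continuous F ->
  measurable_fun setT (path_functional F n : state_space -> R).
Proof.
move=> cF; apply: (@measurable_fun_cvg _ state_space R setT
  (fun K s => path_functional F n (truncate K s)) (path_functional F n)).
  by move=> K; exact: (measurable_truncate K (path_functional F n)).
move=> s _; apply: cF; [by move=> K; exact: cadlag_step_path|exact: cadlag_step_path|].
by apply: J1_conv_step_path => M; exact: gwi_truncate.
Qed.

Lemma measurable_to_state d (T : measurableType d) (j : nat -> T -> nat)
    (x : nat -> nat -> nat -> T -> nat) :
  (forall k, measurable_fun setT (j k)) ->
  (forall i k l, measurable_fun setT (x i k l)) ->
  measurable_fun setT ((fun w => (fun k => j k w, fun i k l => x i k l w)) : T -> state_space).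
Proof.
move=> mj mx; apply: (@measurability _ _ T state_space setT _ cylinders) => //.
move=> _ [_ [->|[K [t ->]]] <-]; rewrite setTI; first by rewrite preimage_set0.
rewrite (_ : _ @^-1` _ =
  (\bigcap_(k in [set k | (k < K)%N]) j k @^-1` [set t.1 k]) `&`
  (\bigcap_i \bigcap_k \bigcap_l (if [&& (i < K), (k < K) & (l < K)]%N
     then x i k l @^-1` [set t.2 i k l] else setT))); last first.
  apply/seteqP; split=> w /=.
    by move=> [h1 h2]; split=> // i _ k _ l _; case: ifP => // /and3P[iK kK lK]; exact: h2.
  move=> [h1 h2]; split=> // i k l iK kK lK.
  by have := h2 i I k I l I; rewrite iK kK lK.
apply: measurableI.
  by apply: bigcap_measurableType => k _; exact: measurable_nateq.
apply: bigcapT_measurable => i; apply: bigcapT_measurable => k; apply: bigcapT_measurable => l.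
by case: ifP => // _; exact: measurable_nateq.
Qed.

End StateSpace.

Lemma ge0_integral_same_law (R : realType) d1 d2 (T1 : measurableType d1)
    (T2 : measurableType d2) (m1 : {finite_measure set T1 -> \bar R})
    (m2 : {measure set T2 -> \bar R}) (phi1 : T1 -> state_space) (phi2 : T2 -> state_space)
    (f : state_space -> \bar R) :
  measurable_fun setT phi1 -> measurable_fun setT phi2 ->
  (forall K t, m1 (phi1 @^-1` cylinder K t) = m2 (phi2 @^-1` cylinder K t)) ->
  measurable_fun setT f -> (forall s, 0 <= f s)%E ->
  (\int[m1]_x f (phi1 x) = \int[m2]_x f (phi2 x))%E.
Proof.
move=> mphi1 mphi2 E mf f0.
transitivity (\int[pushforward m1 phi1]_s f s)%E.
  by rewrite ge0_integral_pushforward.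
transitivity (\int[pushforward m2 phi2]_s f s)%E; last by rewrite ge0_integral_pushforward.
pose p1 : {mfun T1 >-> state_space} := HB.pack phi1 (isMeasurableFun.Build _ _ _ _ _ mphi1).
pose p2 : {mfun T2 >-> state_space} := HB.pack phi2 (isMeasurableFun.Build _ _ _ _ _ mphi2).
apply: (@eq_measure_integral _ _ _ setT (pushforward m2 p2) (pushforward m1 p1)) => A mA _.
apply: (@measure_unique _ R state_space cylinders (fun=> setT)) => //.
- exact: cylinders_setI.
- move=> _; right; exists 0%N, ((fun=> 0%N), (fun _ _ _ => 0%N)).
  by rewrite cylinder0.
- by apply/seteqP; split=> // s _; exists 0%N.
- move=> _ [->|[K [t ->]]]; last exact: E.
  by rewrite !measure0.
- move=> _; change (m1 (phi1 @^-1` setT) < +oo)%E; rewrite preimage_setT.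
  by rewrite -ge0_fin_numE// fin_num_measure.
Qed.

Section Law.
Context d (Omega : measurableType d) (R : realType).
Variable P : probability Omega R.
Variables (X : nat -> nat -> nat -> Omega -> nat) (J : nat -> Omega -> nat).
Hypothesis indep : mutually_independent P
    (fun (a : (nat * nat) + nat) => match a with
       | inl ik => X ik.1 ik.2
       | inr k => fun _ => J k end).

Lemma sigma_of_process_path (Z : nat -> Omega -> nat) K (u : nat -> nat) :
  sigma_of_process Z [set w | forall l, (l < K)%N -> Z l w = u l].
Proof.
rewrite /sigma_of_process (_ : mkset _ = setT `\`
  \bigcup_l (setT `\` Z l @^-1` [set y | (l < K)%N -> y = u l])); last first.
  apply/seteqP; split=> w /=; first by move=> h; split=> // -[l _ [_ /=]]; apply; exact: h.
  by move=> [_ h] l; apply: contra_notP h => h'; exists l.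
apply: sigma_algebraCD; apply: sigma_algebra_bigcup => l.
apply: sigma_algebraCD; apply: sub_sigma_algebra.
by exists l, [set y | (l < K)%N -> y = u l].
Qed.

(** Only the immigrants are factored out. The block of all [X] stays whole, since the coupling
    leaves it unchanged. *)
Lemma state_law K (t : state) :
  P ((fun w => (fun k => J k w, fun i k l => X i k l w)) @^-1` cylinder K t) =
  ((\prod_(k < K) P [set w | J k w = t.1 k]) *
   P [set w | forall i k l, (i < K)%N -> (k < K)%N -> (l < K)%N -> X i k l w = t.2 i k l])%E.
Proof.
pose A (a : (nat * nat) + nat) : set Omega := match a with
  | inl ik => [set w | forall l, (l < K)%N -> X ik.1 ik.2 l w = t.2 ik.1 ik.2 l]
  | inr k => [set w | J k w = t.1 k] end.
pose s1 := [seq inl p : (nat * nat) + nat | p <- [seq (i, k) | i <- iota 0 K, k <- iota 0 K]].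
pose s2 := [seq inr k : (nat * nat) + nat | k <- iota 0 K].
have inl_inj : injective (inl : nat * nat -> (nat * nat) + nat) by move=> x y [].
have inr_inj : injective (inr : nat -> (nat * nat) + nat) by move=> x y [].
have us1 : uniq s1.
  rewrite map_inj_uniq// allpairs_uniq ?iota_uniq// => -[a b] [a' b'] _ _ //.
have us2 : uniq s2 by rewrite map_inj_uniq// iota_uniq.
have us : uniq (s1 ++ s2).
  rewrite cat_uniq us1 us2 andbT/=; apply/hasPn => _ /mapP[k _ ->].
  by apply/negP => /mapP[].
have sA a : sigma_of_process (match a with
       | inl ik => X ik.1 ik.2
       | inr k => fun _ => J k end) (A a).
  case: a => [[i k]|k]; first exact: sigma_of_process_path.
  by apply: sub_sigma_algebra; exists 0%N, [set y | y = t.1 k].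
(* Independence is used twice: for the full list, and for the [X] indices alone to reassemble their
   block. *)
have i1 := indep us1 (fun a _ => sA a).
have i2 := indep us (fun a _ => sA a).
have s1E : \bigcap_(a in [set` s1]) A a = [set w | forall i k l,
    (i < K)%N -> (k < K)%N -> (l < K)%N -> X i k l w = t.2 i k l].
  apply/seteqP; split=> w /=.
    move=> h i k l iK kK lK; have := h (inl (i, k)); rewrite /= mem_map//.
    rewrite allpairs_f ?mem_iota//; exact.
  move=> h _ /mapP[_ /allpairsP[[i k] [/= hi hk ->]] ->] l lK.
  by apply: h => //; [move: hi|move: hk]; rewrite mem_iota.
have s2E : \bigcap_(a in [set` s1 ++ s2]) A a =
    (fun w => (fun k => J k w, fun i k l => X i k l w)) @^-1` cylinder K t.
  apply/seteqP; split=> w /=.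
    move=> h; split.
      move=> k kK; have := h (inr k); rewrite /= mem_cat mem_map// mem_iota/= add0n kK orbT.
      exact.
    have : (\bigcap_(a in [set` s1]) A a) w.
      by move=> a as1; apply: h; rewrite /= mem_cat as1.
    by rewrite s1E.
  move=> [h1 h2] a; rewrite /= mem_cat => /orP[as1|/mapP[k + ->]].
    have : (\bigcap_(a in [set` s1]) A a) w by rewrite s1E.
    exact.
  by rewrite mem_iota add0n => /h1.
rewrite -s2E i2 -s1E i1 big_cat/= muleC; congr (_ * _)%E.
by rewrite big_map -{1}(subn0 K) -/(index_iota 0 K) big_mkord.
Qed.

End Law.

(** * Convergence in law *)

Section Assembly.
Context (R : realType) d (Omega : measurableType d) (P : probability Omega R).
Variables (X : nat -> nat -> nat -> Omega -> nat) (J : nat -> Omega -> nat) (mu c : R).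
Hypothesis mX : forall i k n, measurable_fun setT (X i k n).
Hypothesis mJ : forall k, measurable_fun setT (J k).
Hypothesis indep : mutually_independent P
    (fun (a : (nat * nat) + nat) => match a with
       | inl ik => X ik.1 ik.2
       | inr k => fun _ => J k end).
Hypothesis lawX : forall i k, same_law P (X i k) (X 0%N 0%N).
Hypothesis lawJ : forall k, same_law P (fun _ => J k) (fun _ => J 0%N).
Hypothesis gwX : forall i k, is_GW P (X i k).
Hypothesis X0 : forall i k w, X i k 0%N w = 1%N.
Hypothesis mu0 : 0 < mu.
Hypothesis mean : forall i k, (\int[P]_w ((X i k 1%N w)%:R : R)%:E)%E = mu%:E.
Hypothesis c0 : 0 < c.
Hypothesis tail :
  ((x%:E * P [set w | (x < ln ((J 0%N w)%:R : R))%R])%E @[x --> +oo] --> c%:E).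
Context d' (Omega' : measurableType d') (P' : probability Omega' R).
Variables (tk jk : nat -> Omega' -> R).
Hypothesis prm : is_PRM P' c 1 tk jk.

Let G (N : nat) : R := fine (P [set w | (J 0%N w <= N)%N]).

Let mG N : measurable [set w | (J 0%N w <= N)%N].
Proof. exact: (measurable_nateq (fun y => (y <= N)%N) (mJ 0)). Qed.

Let PG N : P [set w | (J 0%N w <= N)%N] = (G N)%:E.
Proof. by rewrite /G fineK// fin_num_measure. Qed.

Let G0 N : 0 <= G N.
Proof. by rewrite -lee_fin -PG. Qed.

Let Gmono M N : (M <= N)%N -> G M <= G N.
Proof.
move=> MN; rewrite -lee_fin -!PG; apply: le_measure; rewrite ?inE//.
by move=> w /leq_trans; apply.
Qed.

Let Gpmf k v : P [set w | J k w = v] = (G v - if v is u.+1 then G u else 0)%:E.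
Proof.
have -> : P [set w | J k w = v] = P [set w | J 0%N w = v].
  have := @lawJ k [set g | g 0%N = v]; apply; apply: sub_sigma_algebra.
  by exists 0%N, [set v].
case: v => [|u].
  rewrite subr0 -PG; congr (P _); apply/seteqP; split=> w /=; first by move=> ->.
  by rewrite leqn0 => /eqP.
rewrite (_ : mkset _ = [set w | (J 0%N w <= u.+1)%N] `\` [set w | (J 0%N w <= u)%N]).
  have sub : [set w | (J 0%N w <= u)%N] `<=` [set w | (J 0%N w <= u.+1)%N].
    by move=> w /= /leqW.
  have -> : P ([set w | (J 0%N w <= u.+1)%N] `\` [set w | (J 0%N w <= u)%N]) =
     (P [set w | (J 0%N w <= u.+1)%N] - P [set w | (J 0%N w <= u)%N])%E.
    rewrite measureD//; first by congr (_ - P _)%E; exact: setIidr.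
    by rewrite (le_lt_trans (probability_le1 _ (mG _)))// ltry.
  by rewrite !PG EFinB.
apply/seteqP; split=> w /=; first by move=> ->; rewrite leqnn ltnn.
by move=> [h1 /negP]; rewrite -ltnNge => h2; apply/eqP; rewrite eqn_leq h1 h2.
Qed.

Let Gtail : (ln N%:R * (1 - G N)) @[N --> \oo] --> c.
Proof.
have lninf : (ln (N%:R : R)) @[N --> \oo] --> +oo.
  apply/cvgryPge => A; near=> N.
  have h : expR A <= N%:R by near: N; exact: nbhs_infty_ger.
  by rewrite -[A]expRK ler_ln ?posrE ?expR_gt0// (lt_le_trans (expR_gt0 A)).
have := cvg_comp _ _ lninf tail.
move=> /fine_cvgP[_ h]; apply: cvg_trans h; apply: near_eq_cvg; near=> N.
have N0 : 0 < N%:R :> R by rewrite ltr0n; near: N; exists 1%N.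
rewrite /= (_ : mkset _ = ~` [set w | (J 0%N w <= N)%N]); last first.
  apply/seteqP; split=> w /=.
    move=> h1 h2; move: h1; apply/negP; rewrite -leNgt.
    have [->|Jpos] := posnP (J 0%N w); first by rewrite ln0// ln_nat_ge0.
    have JR0 : 0 < (J 0%N w)%:R :> R by rewrite ltr0n.
    by rewrite ler_ln ?posrE// ler_nat.
  move=> /negP; rewrite -ltnNge => h.
  have JR0 : 0 < (J 0%N w)%:R :> R by rewrite ltr0n (leq_ltn_trans _ h).
  by rewrite ltr_ln ?posrE// ltr_nat.
by rewrite probability_setC// PG -EFinB.
Unshelve. all: by end_near. Qed.

(** If [G] reached 1, the tail would vanish from there on and its limit would be 0 instead of
    [c > 0]. *)
Let G1 N : G N < 1.
Proof.
rewrite ltNge; apply/negP => GN.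
have GM M : (N <= M)%N -> 1 - G M = 0.
  move=> NM; apply/eqP; rewrite subr_eq0 eq_le (le_trans GN (Gmono NM))/=.
  by rewrite -lee_fin -PG probability_le1.
suff : (fun M => ln M%:R * (1 - G M)) @ \oo --> (0 : R).
  move=> h0; have := cvg_lim (@norm_hausdorff _ R) Gtail.
  by rewrite (cvg_lim (@norm_hausdorff _ R) h0) => E; move: c0; rewrite -E ltxx.
apply: cvg_near_cst; exists N => // M /= NM; by rewrite GM// mulr0.
Qed.

Let Jn n k w' := immigrants c tk jk G n k w'.

(* The population fed by the immigrants read off the Poisson points. *)
Let Y' n m w' w := GWI X (fun k _ => Jn n k w') m w.

Let Phi F n : state_space -> \bar R := fun s => (path_functional (R := R) F n s)%:E.

Lemma measurable_section (F : (R -> R) -> R) n w' : J1_continuous F ->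
  measurable_fun setT (fun w => (F (step_path n (fun m => Y' n m w' w)))%:E).
Proof.
move=> cF; apply/measurable_EFinP.
have mphi := @measurable_to_state _ Omega (fun k _ => Jn n k w') X
  (fun k => measurable_cst _) mX.
exact: (measurableT_comp (measurable_path_functional n cF) mphi).
Qed.

(** The two states have the same cylinder probabilities, hence the same law, and Tonelli separates
    the Poisson sample from the offspring. The measurability in [w'] feeds the outer dominated
    convergence. *)
Lemma coupling_integral (F : (R -> R) -> R) n : J1_continuous F -> (forall x, 0 <= F x) -> (0 < n)%N ->
  (\int[P]_w (F (scaled_log (GWI X J) n w))%:E =
   \int[P']_w' \int[P]_w (F (step_path n (fun m => Y' n m w' w)))%:E)%E /\
  measurable_fun setT (fun w' =>
     (\int[P]_w (F (step_path n (fun m => Y' n m w' w)))%:E)%E).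
Proof.
move=> cF F0 n0.
have mPhi : measurable_fun setT (Phi F n).
  by apply/measurable_EFinP; exact: measurable_path_functional.
have Phi0 s : (0 <= Phi F n s)%E by rewrite lee_fin; exact: F0.
have mJn k : measurable_fun setT (Jn n k) by exact: (measurable_immigrants c0 prm G1 k n0).
pose T2 (z : Omega' * Omega) : state := (fun k => Jn n k z.1, fun i k l => X i k l z.2).
have mT2 : measurable_fun setT (T2 : (Omega' * Omega)%type -> state_space).
  apply: (@measurable_to_state _ _ (fun k z => Jn n k z.1) (fun i k l z => X i k l z.2)).
    by move=> k; exact: (measurableT_comp (mJn k) (@measurable_fst _ _ Omega' Omega)).
  by move=> i k l; exact: (measurableT_comp (mX i k l) (@measurable_snd _ _ Omega' Omega)).
have mT1 := measurable_to_state mJ mX.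
have mf : measurable_fun setT (Phi F n \o T2) by exact: (measurableT_comp mPhi mT2).
have f0 z : (0 <= (Phi F n \o T2) z)%E by exact: Phi0.
split; last exact: (measurable_fun_fubini_tonelli_F (Phi F n \o T2) mf f0).
transitivity (\int[(P' \x P)%E]_z (Phi F n (T2 z)))%E; last first.
  exact: (fubini_tonelli1 (Phi F n \o T2) mf f0).
apply: (@ge0_integral_same_law R _ _ _ _ P (P' \x P)%E
  (fun w => (fun k => J k w, fun i k l => X i k l w)) T2 (Phi F n)) => // K t.
have JE := immigrants_pmf c0 prm G0 G1 Gmono Gtail K t.1 n0.
pose JP := [set w' | forall k, (k < K)%N -> Jn n k w' = t.1 k].
pose XP := [set w | forall i k l, (i < K)%N -> (k < K)%N -> (l < K)%N ->
  X i k l w = t.2 i k l].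
have mJP : measurable JP.
  rewrite (_ : JP = \bigcap_(k in [set k | (k < K)%N]) Jn n k @^-1` [set t.1 k])//.
  by apply: bigcap_measurableType => k _; exact: measurable_nateq.
have mXP : measurable XP.
  rewrite (_ : XP = \bigcap_i \bigcap_k \bigcap_l X i k l @^-1` [set y |
    (i < K)%N -> (k < K)%N -> (l < K)%N -> y = t.2 i k l]).
    apply: bigcapT_measurable => i; apply: bigcapT_measurable => k.
    by apply: bigcapT_measurable => l; exact: measurable_nateq.
  apply/seteqP; split=> w /=; first by move=> h i _ k _ l _ /=; exact: h.
  by move=> h i k l; exact: (h i I k I l I).
have -> : T2 @^-1` cylinder K t = JP `*` XP by [].
transitivity (P' JP * P XP)%E; last by apply/esym; exact: product_measure1E.
apply: (eq_trans (state_law indep K t)); congr (_ * _)%E.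
rewrite JE -prodEFin; apply: eq_bigr => k _; exact: Gpmf.
Qed.

Lemma good_samples : {ae P', forall w',
  dense_times (tk ^~ w') /\ locally_finite_points (tk ^~ w') (jk ^~ w')}.
Proof. by apply: filterS2 (ae_dense_times c0 prm) (ae_locally_finite c0 prm). Qed.

Let Z := sup_process mu tk jk.

Lemma section_cvg (F : (R -> R) -> R) M w' : J1_continuous F -> (forall x, `|F x| <= M) ->
  dense_times (tk ^~ w') -> locally_finite_points (tk ^~ w') (jk ^~ w') ->
  (\int[P]_w (F (step_path n (fun m => Y' n m w' w)))%:E)%E @[n --> \oo] -->
  (F (Z w'))%:E.
Proof.
move=> cF FM dense fin; have [_ [_ [pos _]]] := prm.
have t0 p : 0 <= tk p w' by have [] := pos p w'.
have j0 p : 0 < jk p w' by have [] := pos p w'.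
have [mb ib] := immigrants_marks c0 G0 G1 Gmono Gtail t0 fin.
have lim : (F (Z w'))%:E = (\int[P]_w (cst (F (Z w'))%:E) w)%E.
  by rewrite integral_cst//= probability_setT mule1.
rewrite lim.
have [] := @dominated_convergence _ Omega R P setT measurableT
  (fun n w => (F (step_path n (fun m => Y' n m w' w)))%:E) (cst (F (Z w'))%:E) (cst M%:E).
- by move=> n; exact: measurable_section.
- exact: measurable_cst.
- apply: filterS2 (ae_population_upper mX lawX gwX X0 mu0 mean (fun n k => Jn n k w'))
    (ae_population_lower mX mJ indep lawX gwX X0 mu0 mean (fun n k => Jn n k w')) => w hU hL _.
  apply: cvg_EFin; first exact: nearW.
  apply: cF; [by move=> n; exact: cadlag_step_path|exact: cadlag_sup_path|].
  exact: (J1_conv_step_sup t0 j0 fin dense mb ib hU hL).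
- exact: finite_measure_integrable_cst.
- by apply: aeW => w n _; rewrite /= lee_fin.
by [].
Qed.

Lemma weak_cvg_ge0 (F : (R -> R) -> R) M : J1_continuous F -> (forall x, `|F x| <= M) -> (forall x, 0 <= F x) ->
  (\int[P]_w (F (scaled_log (GWI X J) n w))%:E)%E @[n --> \oo] -->
  (\int[P']_w (F (Z w))%:E)%E.
Proof.
(* The shift drops [n = 0], for which there are no slots. *)
move=> cF FM F0; rewrite -(cvg_shiftS (fun n => \int[P]_w (F (scaled_log (GWI X J) n w))%:E)%E).
pose H n w' := (\int[P]_w (F (step_path n.+1 (fun m => Y' n.+1 m w' w)))%:E)%E.
have mH n : measurable_fun setT (H n) by have [] := @coupling_integral F n.+1 cF F0 isT.
have H0 n w' : (0 <= H n w')%E by apply: integral_ge0 => w _; rewrite lee_fin.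
have HM n w' : (H n w' <= M%:E)%E.
  apply: (@le_trans _ _ (\int[P]_(w in setT) (cst M%:E) w)%E); last first.
    by rewrite integral_cst//= probability_setT mule1.
  apply: ge0_le_integral => //; first by move=> w _; rewrite lee_fin.
    exact: measurable_section.
  by move=> w _; rewrite /= lee_fin; apply: le_trans (FM _); exact: ler_norm.
have [N [mN N0 sN]] := good_samples.
have PN : P' N = 0%E by exact: N0.
have mD : measurable (~` N) by exact: measurableC.
have HZ w' : (~` N) w' -> H n w' @[n --> \oo] --> (F (Z w'))%:E.
  move=> Nw; have [dense fin] : dense_times (tk ^~ w') /\
      locally_finite_points (tk ^~ w') (jk ^~ w').
    by apply: contrapT => h; apply: Nw; exact: sN.
  have := section_cvg cF FM dense fin.
  by rewrite -(cvg_shiftS (fun n => \int[P]_w (F (step_path n (fun m => Y' n m w' w)))%:E)%E).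
rewrite (ge0_integral_null_restrict mN PN); last by move=> w'; rewrite lee_fin.
have -> : (fun n => \int[P]_w (F (scaled_log (GWI X J) n.+1 w))%:E)%E =
    (fun n => \int[P']_(w' in ~` N) H n w')%E.
  apply/funext => n; have [-> _] := @coupling_integral F n.+1 cF F0 isT.
  exact: (ge0_integral_null_restrict mN PN (H0 n)).
have [] := @dominated_convergence _ Omega' R P' (~` N) mD H
  (fun w' => (F (Z w'))%:E) (cst M%:E).
- by move=> n; exact: measurable_funTS.
- apply: (@emeasurable_fun_cvg _ _ _ _ H) => [n|w' Nw']; first exact: measurable_funTS.
  exact: HZ.
- by apply: aeW => w'; exact: HZ.
- exact: finite_measure_integrable_cst.
- by apply: aeW => w' n _; rewrite gee0_abs.
by [].
Qed.

Lemma weak_cvg : weak_conv_J1 P (scaled_log (GWI X J)) P' Z.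
Proof.
move=> F cF [M FM].
have cmax (g : R -> R) : continuous g -> J1_continuous (fun x => Num.max (g (F x)) 0).
  move=> cg xn x h1 h2 h3; rewrite maxr_absE.
  under eq_fun do rewrite maxr_absE.
  have lim : g (F (xn n)) @[n --> \oo] --> g (F x).
    by apply: continuous_cvg; [exact: cg|exact: cF].
  apply: cvgM; last exact: cvg_cst.
  apply: cvgD; first by apply: cvgD => //; exact: cvg_cst.
  by apply: cvg_norm; apply: cvgB => //; exact: cvg_cst.
pose Fp x := Num.max (F x) 0; pose Fn x := Num.max (- F x) 0.
have cFp : J1_continuous Fp by apply: (cmax id) => y; exact: cvg_id.
have cFn : J1_continuous Fn by apply: (cmax -%R) => y; apply: cvgN; exact: cvg_id.
have M0 : 0 <= M by apply: le_trans (FM (fun=> 0)).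
have Fp0 x : 0 <= Fp x by rewrite /Fp le_max lexx orbT.
have Fn0 x : 0 <= Fn x by rewrite /Fn le_max lexx orbT.
have FpM x : `|Fp x| <= M.
  by rewrite ger0_norm// ge_max M0 andbT (le_trans (ler_norm _)).
have FnM x : `|Fn x| <= M.
  by rewrite ger0_norm// ge_max M0 andbT (le_trans (ler_norm _))// normrN.
(* The integral is by definition the difference of those of the positive and negative parts, so this
   holds for any [W]. *)
have split_int d1 (T : measurableType d1) (Q : probability T R) (W : T -> R -> R) :
    (\int[Q]_w (F (W w))%:E = \int[Q]_w (Fp (W w))%:E - \int[Q]_w (Fn (W w))%:E)%E.
  rewrite integralE; congr (_ - _)%E; apply: eq_integral => w _.
    by rewrite funeposE /Fp EFin_max.
  by rewrite funenegE /Fn EFin_max EFinN.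
rewrite split_int; under eq_fun do rewrite split_int.
apply: cvgeB; [|exact: weak_cvg_ge0 cFp FpM Fp0|exact: weak_cvg_ge0 cFn FnM Fn0].
apply: fin_num_adde_defl; rewrite fin_numN ge0_fin_numE; last first.
  by apply: integral_ge0 => w _; rewrite lee_fin.
apply: le_lt_trans (ltry M); apply: ge0_integral_le_cst => w; rewrite lee_fin//.
by apply: le_trans (ler_norm _) (FnM _).
Qed.

End Assembly.

Unset Implicit Arguments.

Theorem theorem1 (R : realType) (d : measure_display) (Omega : measurableType d)
  (P : probability Omega R)
  (X : nat -> nat -> nat -> Omega -> nat) (J : nat -> Omega -> nat) (mu c : R) :
  (* measurability of all random variables *)
  (forall i k n (B : set nat), measurable (X i k n @^-1` B)) ->
  (forall k (B : set nat), measurable (J k @^-1` B)) ->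
  (* the family {X_{i,k}} u {J_k} is mutually independent *)
  mutually_independent P
    (fun (a : (nat * nat) + nat) => match a with
       | inl ik => X ik.1 ik.2
       | inr k => fun _ => J k end) ->
  (* each family is i.i.d. *)
  (forall i k, same_law P (X i k) (X 0%N 0%N)) ->
  (forall k, same_law P (fun _ => J k) (fun _ => J 0%N)) ->
  (* Galton--Watson processes with X(0) = 1 and offspring mean mu in (0,oo) *)
  (forall i k, is_GW P (X i k)) ->
  (forall i k w, X i k 0%N w = 1%N) ->
  0 < mu ->
  (forall i k, (\int[P]_w ((X i k 1%N w)%:R : R)%:E)%E = mu%:E) ->
  (* P{J = 0} < 1 *)
  (P [set w | J 0%N w = 0%N] < 1)%E ->
  (* lim_{x -> oo} x P{log J > x} = c > 0 *)
  0 < c ->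
  ((x%:E * P [set w | (x < ln ((J 0%N w)%:R : R))%R])%E @[x --> +oo] --> c%:E) ->
  (* conclusion: for every Poisson random measure N^{(c,1)}, weak convergence in (D[0,oo), J1) *)
  forall (d' : measure_display) (Omega' : measurableType d') (P' : probability Omega' R)
    (tk jk : nat -> Omega' -> R),
    is_PRM P' c 1 tk jk ->
    weak_conv_J1 P (scaled_log (GWI X J)) P' (sup_process mu tk jk).
Proof.
move=> mX mJ indep lawX lawJ gwX X0 mu0 mean _ c0 tail d' Omega' P' tk jk prm.
have mX' i k n : measurable_fun setT (X i k n) by move=> _ B _; rewrite setTI; exact: mX.
have mJ' k : measurable_fun setT (J k) by move=> _ B _; rewrite setTI; exact: mJ.
exact: (weak_cvg mX' mJ' indep lawX lawJ gwX X0 mu0 mean c0 tail prm).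
Qed.
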